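(* Let $d\ge 2$ and let $D\subset\mathbb{R}^d$ be a bounded domain with smooth boundary which is discretely simply connected. Let $\beta(\varepsilon)>0$ satisfy $\beta(\varepsilon)+9d\log\varepsilon\to\infty$ as $\varepsilon\to 0$. For each $\varepsilon>0$ let $\theta^\varepsilon$ be distributed according to the XY Gibbs measure $\mu^\varepsilon_{\beta(\varepsilon)}$ on $D^\varepsilon$ with zero (Dirichlet) boundary condition, let $\eta^\varepsilon$ be the associated reduced gradient field with values in $[-\pi,\pi)$, and let $\tilde\eta^\varepsilon=\sqrt{\beta(\varepsilon)}\,\eta^\varepsilon$. For $\varphi\in C_0^\infty(D)$ set $$\langle\tilde\eta^\varepsilon,\varphi\rangle=\varepsilon^{(d/2)-1}\sum_{b\in(D^\varepsilon)^*}\nabla\varphi(b)\,\tilde\eta^\varepsilon(b),\qquad \nabla\varphi(b)=\varphi(y)-\varphi(x)\ \text{ for } b=(x,y).$$ Then for every $\varphi\in C_0^\infty(D)$ and every $t\in\mathbb{R}$, $$\lim_{\varepsilon\to0}\mathbb{E}\left[e^{it\langle\tilde\eta^\varepsilon,\varphi\rangle}\right]=\exp\left[-\frac{t^2}{2}\langle\partial\varphi,\partial\varphi\rangle\right],\qquad \langle\partial\varphi,\partial\varphi\rangle=\int_D\sum_{\alpha=1}^d\left(\frac{\partial\varphi}{\partial x_\alpha}\right)^2dx .$$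
   Context: Lattice domain: $D^\varepsilon=D\cap\varepsilon\mathbb{Z}^d$; $\partial D^\varepsilon$ is the set of vertices of $D^\varepsilon$ having a nearest neighbor in $\varepsilon\mathbb{Z}^d\setminus D^\varepsilon$. $(D^\varepsilon)^*$ is the set of directed nearest-neighbor edges $(x,y)$ with $x,y\in D^\varepsilon$. In sums over $(D^\varepsilon)^*$ each nearest-neighbor pair is counted once, with an arbitrary orientation (the summands do not depend on the orientation, up to events of probability zero). XY Gibbs measure: for $\beta>0$, $\mu^\varepsilon_\beta$ is the probability measure on $[-\pi,\pi)^{D^\varepsilon}$ $$d\mu_\beta^\varepsilon=Z_\beta^{-1}\exp\Big[\beta\sum_{(i,j)\in(D^\varepsilon)^*}\cos(\theta^\varepsilon(i)-\theta^\varepsilon(j))\Big]\prod_{i\in D^\varepsilon\setminus\partial D^\varepsilon}d\theta^\varepsilon(i)\prod_{i\in\partial D^\varepsilon}\delta_0(d\theta^\varepsilon(i)),$$ where $Z_\beta$ is the normalizing constant. Reduced gradient: for $b=(i,j)\in(D^\varepsilon)^*$, $\eta^\varepsilon(b)$ is the unique element of $[-\pi,\pi)$ that equals $\theta^\varepsilon(j)-\theta^\varepsilon(i)$ modulo $2\pi$. Discretely simply connected: $(D^\varepsilon)^*$ is called simply connected if for any site self-avoiding loop $b$ in it there is a finite sequence of loops $b_1=b,b_2,\dots,b_N$ in $(D^\varepsilon)^*$ such that $b_j$ and $b_{j-1}$ differ algebraically (i.e. as oriented chains of edges) by a single plaquette (elementary lattice square) for each $j$, and $b_N$ is a trivial loop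 with no edge. $D$ is discretely simply connected if for each $\varepsilon>0$ such that $(D^\varepsilon)^*$ is nonempty, $(D^\varepsilon)^*$ is simply connected. *)

(* Defs.v *)
From HB Require Import structures.
From mathcomp Require Import all_boot all_order all_algebra.
From mathcomp Require Import finmap complex zify ring lra.
From mathcomp Require Import all_classical all_reals all_analysis.
From mathcomp Require Import measurable_realfun.

Set Implicit Arguments.
Unset Strict Implicit.
Unset Printing Implicit Defensive.

Import Order.TTheory GRing.Theory Num.Theory.
Import numFieldNormedType.Exports.

Local Open Scope classical_set_scope.
Local Open Scope ring_scope.

Section cons_product.
Local Open Scope ereal_scope.
Context {d} {T : measurableType d} {R : realType} {n : nat}.
Variables (m1 : {sigma_finite_measure set T -> \bar R})
          (m2 : {sigma_finite_measure set (n.-tuple T) -> \bar R}).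

Let cons_pair (p : T * n.-tuple T) : n.+1.-tuple T := [tuple of p.1 :: p.2].

Let measurable_cons_pair : measurable_fun setT cons_pair.
Proof. by apply: measurable_cons. Qed.

Definition cons_product := pushforward (m1 \x m2) cons_pair.

Let mu : {measure set (n.+1.-tuple T) -> \bar R} :=
  measure_function_pushforward__canonical__measure_function_Measure
    (m1 \x m2) measurable_cons_pair.

HB.instance Definition _ := isMeasure.Build _ _ _ cons_product
  (measure0 mu) (measure_ge0 mu) (@measure_semi_sigma_additive _ _ _ mu).

Lemma cons_product_setX (A : set T) (B : set (n.-tuple T)) :
  measurable A -> measurable B ->
  cons_product [set t | A (thead t) /\ B [tuple of behead t]] = m1 A * m2 B.
Proof.
move=> mA mB; rewrite -product_measure1E//; congr product_measure1.
apply/seteqP; split => -[x t] /=; rewrite /cons_pair/= theadE;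
  suff -> : [tuple of behead (x :: t)] = t by [].
- exact/val_inj.
- exact/val_inj.
Qed.

Let cons_product_sigma_finite : sigma_finite setT cons_product.
Proof.
have /sigma_finiteP[F [TF ndF Foo]] := sigma_finiteT m1.
have /sigma_finiteP[G [TG ndG Goo]] := sigma_finiteT m2.
pose H k := [set t : n.+1.-tuple T | F k (thead t) /\ G k [tuple of behead t]].
have mthead : measurable_fun setT (fun t : n.+1.-tuple T => thead t).
  exact: measurable_tnth.
exists H.
  apply/seteqP; split => // t _.
  have [i _ Fi] : (\bigcup_i F i) (thead t) by rewrite -TF.
  have [j _ Gj] : (\bigcup_i G i) [tuple of behead t] by rewrite -TG.
  exists (maxn i j) => //; split.
  - by move: Fi; apply/subsetPset/ndF/leq_maxl.
  - by move: Gj; apply/subsetPset/ndG/leq_maxr.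
move=> k; have [mF Fkoo] := Foo k; have [mG Gkoo] := Goo k; split.
  apply: measurableI.
  - by rewrite -[X in measurable X]setTI; exact: mthead.
  - by rewrite -[X in measurable X]setTI; exact: measurable_behead.
by rewrite cons_product_setX// lte_mul_pinfty// ge0_fin_numE.
Qed.

HB.instance Definition _ := Measure_isSigmaFinite.Build _ _ _ cons_product
  cons_product_sigma_finite.

End cons_product.

Fixpoint tuple_product d (T : measurableType d) (R : realType) (n : nat) :
    ('I_n -> {sigma_finite_measure set T -> \bar R}) ->
    {sigma_finite_measure set (n.-tuple T) -> \bar R} :=
  match n with
  | 0 => fun=> dirac [tuple]
  | n'.+1 => fun m =>
      cons_product (m ord0) (tuple_product (fun i => m (lift ord0 i)))
  end.

Lemma tuple_product_box d (T : measurableType d) (R : realType) (n : nat)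
    (m : 'I_n -> {sigma_finite_measure set T -> \bar R}) (A : 'I_n -> set T) :
  (forall i, measurable (A i)) ->
  tuple_product m [set t | forall i, A i (tnth t i)] =
  (\prod_(i < n) m i (A i))%E.
Proof.
elim: n m A => [|n IH] m A mA /=.
  by rewrite big_ord0 diracE mem_set// => -[].
have mB : measurable [set t : n.-tuple T | forall i, A (lift ord0 i) (tnth t i)].
  rewrite (_ : [set _ | _] =
      \bigcap_(i in [set: 'I_n]) ((fun t => tnth t i) @^-1` A (lift ord0 i))).
    apply: fin_bigcap_measurable => // i _.
    by rewrite -[X in measurable X]setTI; exact: measurable_tnth.
  by apply/seteqP; split=> t /= At i => [_|]; exact: At.
rewrite big_ord_recl -IH// -cons_product_setX//; congr (cons_product _ _ _).
have tE (t : n.+1.-tuple T) j :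
    tnth [tuple of behead t] j = tnth t (lift ord0 j).
  by rewrite [in RHS](tuple_eta t) tnthS.
apply/seteqP; split => t /= => [At|[A0 At] i].
  by split=> [|i]; [exact: At|rewrite tE; exact: At].
by case: (unliftP ord0 i) => [j|] -> //; rewrite -tE.
Qed.

Section euclidean_space.
Context {R : realType}.

(* Row vectors carry no sigma-algebra in the library, hence tuples. *)
Definition lebesgue_tuple (n : nat) :
    {sigma_finite_measure set (n.-tuple (measurableTypeR R)) -> \bar R} :=
  tuple_product (fun=> lebesgue_measure).

Context {d : nat}.
Implicit Types (D : set 'rV[R]_d) (f : 'rV[R]_d -> R).

Definition row_of_tuple (x : d.-tuple (measurableTypeR R)) : 'rV[R]_d := \row_i tnth x i.

Definition partial (i : 'I_d) f : 'rV[R]_d -> R :=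
  fun x => 'D_(delta_mx 0 i) (f : 'rV[R]_d -> R^o) x.

Definition smooth f := forall s : seq 'I_d,
  let g := foldr partial f s in
  continuous g /\
  forall i x, derivable (g : 'rV[R]_d -> R^o) x (delta_mx 0 i).

Definition bounded_domain D :=
  [/\ D !=set0, open D, connected D & bounded_set D].

(* Near each boundary point, D is the negativity set of a smooth function
   whose gradient does not vanish there. *)
Definition smooth_boundary D :=
  forall p, (closure D `\` interior D) p ->
  exists U : set 'rV[R]_d, exists rho : 'rV[R]_d -> R,
    [/\ nbhs p U, smooth rho, exists i, partial i rho p != 0 &
        forall x, U x -> (D x <-> rho x < 0)].

Definition test_function D f :=
  let supp := closure [set x | f x != 0] in
  [/\ smooth f, compact supp & supp `<=` D].

Definition dirichlet_energy D f : R :=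
  \int[lebesgue_tuple d]_(x in [set x | D (row_of_tuple x)])
    \sum_(i < d) (partial i f (row_of_tuple x)) ^+ 2.

End euclidean_space.

Section lattice.
Context {d : nat}.
Implicit Types k l : 'rV[int]_d.

Definition nearest_neighbor : rel 'rV[int]_d := fun k l =>
  [exists i : 'I_d, (l == k + delta_mx 0 i) || (k == l + delta_mx 0 i)].

(* A closed lattice path is the cyclic sequence of its successive sites; the
   loop without edges is [::]. *)
Definition loop_in (V : {fset 'rV[int]_d}) (c : seq 'rV[int]_d) :=
  cycle nearest_neighbor c && all (mem V) c.

(* The 2-cycle x, y, x runs twice along the same edge and is excluded. *)
Definition self_avoiding (c : seq 'rV[int]_d) := uniq c && (2 < size c)%N.

(* The oriented chain of edges of c, as an antisymmetric function of e. *)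
Definition chain (c : seq 'rV[int]_d) (e : 'rV[int]_d * 'rV[int]_d) : int :=
  let steps := zip c (rot 1 c) in
  (count_mem e steps)%:Z - (count_mem (e.2, e.1) steps)%:Z.

Definition plaquette k (i j : 'I_d) : seq 'rV[int]_d :=
  [:: k; k + delta_mx 0 i; k + delta_mx 0 i + delta_mx 0 j; k + delta_mx 0 j].

(* Both orientations of the plaquette are covered, by exchanging i and j. *)
Definition differ_by_plaquette (c c' : seq 'rV[int]_d) :=
  exists k (i j : 'I_d), i != j /\
    forall e, chain c e - chain c' e = chain (plaquette k i j) e.

Definition simply_connected (V : {fset 'rV[int]_d}) :=
  forall c, loop_in V c -> self_avoiding c ->
  exists (N : nat) (b : nat -> seq 'rV[int]_d),
    [/\ b 0%N = c, b N = [::],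
        forall j, (j <= N)%N -> loop_in V (b j) &
        forall j, (j < N)%N -> differ_by_plaquette (b j.+1) (b j)].

End lattice.

Section lattice_domain.
Context {R : realType} {d : nat}.
Variables (D : set 'rV[R]_d) (eps : R).

(* The vertices of the lattice with mesh eps are indexed by integer vectors. *)
Definition vertex (k : 'rV[int]_d) : 'rV[R]_d := eps *: map_mx intr k.

Definition sites : {fset 'rV[int]_d} := fset_set [set k | D (vertex k)].

(* fset_set is only meaningful for finite sets. *)
Lemma finite_sites : bounded_set D -> 0 < eps ->
  finite_set [set k | D (vertex k)].
Proof.
move=> [M [Mreal bD]] eps0.
have DM x : D x -> `|x| <= `|M| + 1.
  by apply: bD; rewrite (le_lt_trans (ler_norm M))// ltrDl.
pose N := `|Num.ceil ((`|M| + 1) / eps)|%N.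
pose g (h : 'rV['I_(N + N).+1]_d) : 'rV[int]_d := \row_i ((h 0 i)%:Z - N%:Z).
apply: (@sub_finite_set _ _ (range g)); last exact: finite_image.
move=> k /= /DM kM.
have kN i : `|k 0 i| <= N%:Z.
  have : `|vertex k 0 i| <= `|M| + 1.
    by apply: le_trans kM; rewrite [leRHS]mx_normrE; apply/bigmax_geP; right;
      exists (0, i).
  rewrite !mxE normrM gtr0_norm// mulrC -ler_pdivlMr// => kiM.
  have /(le_trans kiM) := ceil_ge ((`|M| + 1) / eps).
  rewrite -intr_norm ler_int => /le_trans; apply.
  by rewrite /N abszE ler_norm.
have kN' i : (absz (k 0 i + N%:Z)%R < (N + N).+1)%N.
  have := kN i; rewrite ler_norml => /andP[k1 k2].
  by rewrite ltnS -lez_nat gez0_abs; lia.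
exists (\row_i inord (absz (k 0 i + N%:Z))) => //.
apply/rowP => i; rewrite !mxE inordK// gez0_abs ?addrK//.
by have := kN i; rewrite ler_norml; lia.
Qed.

Definition boundary_sites : {fset 'rV[int]_d} :=
  [fset k in sites |
    `[< exists2 l, nearest_neighbor k l & l \notin sites >]]%fset.

(* Each nearest-neighbor pair appears once, with the positive orientation. *)
Definition edges : {fset 'rV[int]_d * 'rV[int]_d} :=
  [fset e in sites `*` sites |
    [exists i : 'I_d, e.2 == (e.1 + delta_mx 0 i)%R]]%fset.

End lattice_domain.

Definition discretely_simply_connected (R : realType) (d : nat)
    (D : set 'rV[R]_d) :=
  forall eps, 0 < eps -> edges D eps != fset0 -> simply_connected (sites D eps).

Section xy_model.
Context {R : realType} {d : nat}.
Variables (D : set 'rV[R]_d) (beta eps : R).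

(* Angle configurations, listed along the enumeration of the sites. *)
Definition config := (size (sites D eps)).-tuple (measurableTypeR R).

Definition angle (th : config) (k : 'rV[int]_d) : R :=
  nth 0 (th : seq R) (index k (sites D eps)).

Definition cos_sum (th : config) : R :=
  \sum_(e <- edges D eps) cos (angle th e.1 - angle th e.2).

Let arc : set (measurableTypeR R) := `[- pi, pi[%classic.

Let measurable_arc : measurable arc.
Proof. exact: measurable_itv. Qed.

Let lebesgue_arc : lebesgue_measure arc = (2 * pi)%:E :> \bar R.
Proof.
rewrite lebesgue_measure_itv/= lte_fin gtrN ?pi_gt0//.
by rewrite -EFinD opprK mulr_natl mulr2n.
Qed.

Let lebesgue_arc_fin : (@lebesgue_measure R arc < +oo)%E.
Proof. by rewrite lebesgue_arc ltry. Qed.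

Definition site_measure (k : 'rV[int]_d) :
    {sigma_finite_measure set (measurableTypeR R) -> \bar R} :=
  if k \in boundary_sites D eps
  then [the {sigma_finite_measure set (measurableTypeR R) -> \bar R} of
        @dirac _ (measurableTypeR R) (0 : R) R]
  else [the {sigma_finite_measure set (measurableTypeR R) -> \bar R} of
        mfrestr measurable_arc lebesgue_arc_fin].

Definition reference_measure :
    {sigma_finite_measure set config -> \bar R} :=
  tuple_product (fun i => site_measure (tnth (in_tuple (sites D eps)) i)).

Definition gibbs_weight (A : set config) : \bar R :=
  (\int[reference_measure]_(th in A) (expR (beta * cos_sum th))%:E)%E.

Definition partition_function : \bar R := gibbs_weight setT.

Let measurable_angle k :
  measurable_fun setT ((fun th => angle th k) : config -> measurableTypeR R).
Proof.
have [kV|kV] := ltnP (index k (sites D eps)) (size (sites D eps)).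
  rewrite (_ : (fun _ => _) = (fun th : config => tnth th (Ordinal kV))).
    exact: measurable_tnth.
  by apply/funext => th; rewrite (tnth_nth 0).
rewrite (_ : (fun _ => _) = cst 0); first exact: measurable_cst.
by apply/funext => th; rewrite /angle nth_default// size_tuple.
Qed.

Let measurable_density :
  measurable_fun setT
    (EFin \o (fun th => expR (beta * cos_sum th)) : config -> \bar R).
Proof.
apply/measurable_EFinP; apply: measurableT_comp => //.
apply: measurable_funM => //; apply: measurable_sum => e.
apply: measurableT_comp.
  by apply: continuous_measurable_fun; exact: continuous_cos.
by apply: measurable_funB; exact: measurable_angle.
Qed.

Let density_ge0 th : (0 <= (expR (beta * cos_sum th))%:E)%E.
Proof. by rewrite lee_fin expR_ge0. Qed.

Let gibbs_weight0 : gibbs_weight set0 = 0%E.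
Proof. exact: integral_set0. Qed.

Let gibbs_weight_ge0 A : (0 <= gibbs_weight A)%E.
Proof. by apply: integral_ge0 => th _; exact: density_ge0. Qed.

Let gibbs_weight_sigma_additive : semi_sigma_additive gibbs_weight.
Proof.
move=> /= F mF tF mUF; rewrite /gibbs_weight; apply: cvg_toP.
  apply: ereal_nondecreasing_is_cvgn => m n mn.
  by apply: lee_sum_nneg_natr => // k _ _; exact: integral_ge0.
by rewrite ge0_integral_bigcup//; exact: measurable_funTS.
Qed.

HB.instance Definition _ := isMeasure.Build _ _ _ gibbs_weight
  gibbs_weight0 gibbs_weight_ge0 gibbs_weight_sigma_additive.

Let site_measure_bounds k : (0 < site_measure k setT < +oo)%E.
Proof.
rewrite /site_measure; case: ifP => _ /=.
  by rewrite diracT lte01 ltry.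
by rewrite /mfrestr /mrestr setTI lebesgue_arc lte_fin mulr_gt0// ?pi_gt0// ltry.
Qed.

Let reference_measureT : (0 < reference_measure setT < +oo)%E.
Proof.
have -> : reference_measure setT = (\prod_(i < size (sites D eps))
    site_measure (tnth (in_tuple (sites D eps)) i) setT)%E.
  rewrite -tuple_product_box//; congr (tuple_product _ _).
  by apply/seteqP; split.
elim/big_ind : _ => [|x y /andP[x0 xoo] /andP[y0 yoo]|i _].
- by rewrite lte01 ltry.
- by rewrite mule_gt0//= lte_mul_pinfty// ?ge0_fin_numE// ltW.
- exact: site_measure_bounds.
Qed.

Lemma partition_function_bounds : (0 < partition_function < +oo)%E.
Proof.
have /andP[m0 moo] := reference_measureT.
pose C := `|beta| * (size (edges D eps))%:R.
have HC th : `|beta * cos_sum th| <= C.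
  rewrite normrM ler_wpM2l// (le_trans (ler_norm_sum _ _ _))//.
  rewrite -sum1_size natr_sum ler_sum// => e _.
  by rewrite ler_norml cos_geN1 cos_le1.
have intC (c : R) : (\int[reference_measure]_th (expR c)%:E =
    (expR c)%:E * reference_measure setT)%E by rewrite integral_cst.
apply/andP; split.
- apply: (@lt_le_trans _ _ (\int[reference_measure]_th (expR (- C))%:E)%E).
    by rewrite intC mule_gt0// lte_fin expR_gt0.
  apply: ge0_le_integral => //= th _; rewrite ?lee_fin ?expR_ge0//.
  by rewrite ler_expR; have := HC th; rewrite ler_norml => /andP[].
- apply: (@le_lt_trans _ _ (\int[reference_measure]_th (expR C)%:E)%E); last first.
    by rewrite intC lte_mul_pinfty// lee_fin expR_ge0.
  apply: ge0_le_integral => //= th _; rewrite ?lee_fin ?expR_ge0//.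
  by rewrite ler_expR; have := HC th; rewrite ler_norml => /andP[].
Qed.

Definition gibbs (A : set config) : \bar R :=
  (((fine partition_function)^-1)%:E * gibbs_weight A)%E.

Let Z_gt0 : 0 < fine partition_function.
Proof. by rewrite fine_gt0// partition_function_bounds. Qed.

Let invZ_ge0 : 0 <= (fine partition_function)^-1.
Proof. by rewrite invr_ge0 ltW. Qed.

Let gibbs_mscale := mscale (NngNum invZ_ge0) gibbs_weight.

HB.instance Definition _ := isMeasure.Build _ _ _ gibbs
  (measure0 gibbs_mscale) (measure_ge0 gibbs_mscale)
  (@measure_semi_sigma_additive _ _ _ gibbs_mscale).

Let gibbsT : gibbs setT = 1%E.
Proof.
have /andP[Z0 Zoo] := partition_function_bounds.
rewrite /gibbs -/partition_function -[X in (_ * X)%E]fineK.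
  by rewrite -EFinM mulVf// gt_eqF.
by rewrite ge0_fin_numE// ltW.
Qed.

HB.instance Definition _ := Measure_isProbability.Build _ _ _ gibbs gibbsT.

End xy_model.

Arguments gibbs {R d} D beta eps A.

Section reduced_angle.
Context {R : realType}.
Implicit Types x u : R.

Definition reduced_angle x : R :=
  x - (Num.floor ((x + pi) / (2 * pi)))%:~R * (2 * pi).

Lemma reduced_angleP x u :
  (- pi <= u < pi /\ exists m : int, u = x + m%:~R * (2 * pi)) <->
  u = reduced_angle x.
Proof.
have pi2 : 0 < 2 * pi :> R by rewrite mulr_gt0// pi_gt0.
split=> [[/andP[u1 u2] [m um]]|->]; last first.
  have := floor_itv ((x + pi) / (2 * pi)).
  rewrite /reduced_angle; set m := Num.floor _.
  rewrite ler_pdivlMr// ltr_pdivrMr// intrD mulr1z => /andP[? ?].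
  split; last by exists (- m); rewrite mulrNz mulNr.
  by apply/andP; split; lra.
rewrite /reduced_angle (_ : Num.floor _ = - m).
  by rewrite um mulrNz mulNr opprK.
apply/floor_def; rewrite ler_pdivlMr// ltr_pdivrMr// intrD mulr1z mulrNz.
by apply/andP; split; lra.
Qed.

End reduced_angle.

Section gradient_field.
Context {R : realType} {d : nat}.
Variables (D : set 'rV[R]_d) (beta eps : R).

Definition reduced_gradient (th : config D eps)
    (e : 'rV[int]_d * 'rV[int]_d) : R :=
  reduced_angle (angle th e.2 - angle th e.1).

Definition pairing (f : 'rV[R]_d -> R) (th : config D eps) : R :=
  eps `^ (d%:R / 2 - 1) *
  \sum_(e <- edges D eps)
    (f (vertex eps e.2) - f (vertex eps e.1)) *
    (Num.sqrt beta * reduced_gradient th e).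

End gradient_field.

Arguments pairing {R d} D beta eps f th.

Section complex_expectation.
Context {R : realType}.
Local Open Scope complex_scope.

(* The topology of R[i] is the one of its modulus. *)
HB.instance Definition _ := NormedModule.copy R[i] (R[i] : numFieldType)^o.

Definition expi (x : R) : R[i] := cos x +i* sin x.

Definition complex_expectation d (T : measurableType d)
    (P : probability T R) (X : T -> R[i]) : R[i] :=
  fine ('E_P[fun w => complex.Re (X w)])%E +i*
  fine ('E_P[fun w => complex.Im (X w)])%E.

End complex_expectation.

(* Main.v *)
Require Import Defs.
From HB Require Import structures.
From mathcomp Require Import all_boot all_order all_algebra.
From mathcomp Require Import finmap complex zify ring lra.
From mathcomp Require Import all_classical all_reals all_analysis.
From mathcomp Require Import measurable_realfun.

Set Implicit Arguments.
Unset Strict Implicit.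
Unset Printing Implicit Defensive.

Import Order.TTheory GRing.Theory Num.Theory.
Import numFieldNormedType.Exports.

Local Open Scope classical_set_scope.
Local Open Scope ring_scope.


(** Let delta_e be the angle difference along an edge e, v_e = 1 - cos delta_e
    its versine, and s_e the coefficient of e in the pairing, so that the
    pairing is the sum of the s_e times the reduced delta_e ([pairingE]). The
    s_e are proportional to the increments of f, and the sum of their squares
    is beta times a Riemann sum of the Dirichlet energy
    ([lattice_energy_cvg]).

    With sines in place of reduced angles, the characteristic function follows
    from a change of contour. The shift of the angles by i psi, with psi
    proportional to f and thus zero at the pinned sites, preserves the
    partition function ([complex_shift]). Since
    cos (delta + i a) = cosh a cos delta - i sinh a sin delta, this says that
    exp (- D - i Theta) has mean exp (- K), where Theta is close to t times
    the sum of the s_e sin delta_e, where K is close to half of t^2 times the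
    energy, and where the sum D of the beta (cosh a_e - 1) v_e is nonnegative
    with small mean ([characteristic_bound]).

    To pass from reduced angles to sines, expand an angle in ]-pi, pi[ as
    sin x times a power series in the versine 1 - cos x, truncated at an order
    M close to beta / 2. The remainder is at most a multiple of
    M (v_e / 2)^(M + 1). As exp (beta v_e) has mean at most of order sqrt beta
    ([exponential_moment]), each edge contributes at most exp (- beta / 2) up
    to a power of beta; the number of edges is a power of 1 / eps, hence less
    than exp (beta / 4) by the assumption on beta ([inverse_mesh_le]). The
    other terms, sums over e of s_e sin delta_e v_e^j with j > 0, have mean
    squares bounded as if the edges were independent ([power_sum_square]), and
    vanish in the limit ([angle_sum_linearization]).

    Both moment estimates rest on positivity. The site measures, uniform on the
    circle or concentrated at zero, have nonnegative Fourier coefficients, and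
    the Gibbs density is a series with nonnegative coefficients in the
    cosines; so a combination of modes with nonnegative coefficients has a
    nonnegative integral ([fourier_limit_ge0]). Weighting each mode of the
    density by 1 - cos (z a), where z is its degree in one edge, compares the
    model with the one in which this edge is rotated, and an average over a
    removes the edge ([remove_edge_le]). Weighting each mode by z^2, where z
    is a sum of charges over the edges, gives the bound on mean squares
    ([sum_square_le]); Charlier polynomials are the charges that produce
    sin x (1 - cos x)^j. *)

(** * Bounded measurable functions *)

Section bounded_measurable.
Context {d} {T : measurableType d} {R : realType}.
Implicit Types F G : T -> R.

Definition bounded_measurable F :=
  measurable_fun setT F /\ exists K, forall x, `|F x| <= K.

Lemma bm_ext F G : F =1 G -> bounded_measurable F -> bounded_measurable G.
Proof. by move=> /funext ->. Qed.

Lemma bm_cst c : bounded_measurable (fun=> c).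
Proof. by split; [exact: measurable_cst|exists `|c|]. Qed.

Lemma bmD F G : bounded_measurable F -> bounded_measurable G ->
  bounded_measurable (fun x => F x + G x).
Proof.
move=> [mF [K FK]] [mG [L GL]]; split; first exact: measurable_funD.
by exists (K + L) => x; rewrite (le_trans (ler_normD _ _))// lerD.
Qed.

Lemma bmN F : bounded_measurable F -> bounded_measurable (fun x => - F x).
Proof.
move=> [mF [K FK]]; split; last by exists K => x; rewrite normrN.
exact: measurableT_comp.
Qed.

Lemma bmB F G : bounded_measurable F -> bounded_measurable G ->
  bounded_measurable (fun x => F x - G x).
Proof. by move=> bF bG; apply: bmD => //; exact: bmN. Qed.

Lemma bmM F G : bounded_measurable F -> bounded_measurable G ->
  bounded_measurable (fun x => F x * G x).
Proof.
move=> [mF [K FK]] [mG [L GL]]; split; first exact: measurable_funM.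
by exists (K * L) => x; rewrite normrM ler_pM.
Qed.

Lemma bmX F n : bounded_measurable F -> bounded_measurable (fun x => F x ^+ n).
Proof.
move=> bF; elim: n => [|n IH]; first exact: bm_cst.
by apply: bm_ext (bmM bF IH) => x; rewrite exprS.
Qed.

Lemma bm_sum (I : Type) (s : seq I) (P : pred I) (F : I -> T -> R) :
  (forall i, bounded_measurable (F i)) ->
  bounded_measurable (fun x => \sum_(i <- s | P i) F i x).
Proof.
move=> bF; elim: s => [|i s IH].
  by apply: bm_ext (bm_cst 0) => x; rewrite big_nil.
case: (boolP (P i)) => Pi.
  by apply: bm_ext (bmD (bF i) IH) => x; rewrite big_cons Pi.
by apply: bm_ext IH => x; rewrite big_cons (negbTE Pi).
Qed.

Lemma bm_norm F : bounded_measurable F -> bounded_measurable (fun x => `|F x|).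
Proof.
move=> [mF [K FK]]; split; last by exists K => x; rewrite normr_id.
exact: measurableT_comp.
Qed.

Lemma bm_expR F : bounded_measurable F ->
  bounded_measurable (fun x => expR (F x)).
Proof.
move=> [mF [K FK]]; split; first exact: measurableT_comp.
exists (expR K) => x; rewrite ger0_norm ?expR_ge0// ler_expR.
exact: le_trans (ler_norm _) (FK _).
Qed.

Lemma bm_cos F : measurable_fun setT F -> bounded_measurable (fun x => cos (F x)).
Proof.
move=> mF; split; last by exists 1 => x; exact: cos_max.
apply: measurableT_comp mF.
by apply: continuous_measurable_fun; exact: continuous_cos.
Qed.

Lemma bm_sin F : measurable_fun setT F -> bounded_measurable (fun x => sin (F x)).
Proof.
move=> mF; split; last by exists 1 => x; exact: sin_max.
apply: measurableT_comp mF.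
by apply: continuous_measurable_fun; exact: continuous_sin.
Qed.

End bounded_measurable.

Section integral_functional.
Context {d} {T : measurableType d} {R : realType}.
Variable mu : {measure set T -> \bar R}.
Hypothesis mu_fin : (mu setT < +oo)%E.
Implicit Types F G : T -> R.

Lemma bm_integrable F : bounded_measurable F -> mu.-integrable setT (EFin \o F).
Proof.
move=> [mF [K FK]]; apply: measurable_bounded_integrable => //.
exists K; split; first exact: num_real.
by move=> y Ky x _ /=; apply: le_trans (FK x) (ltW Ky).
Qed.

Definition integ F : R := \int[mu]_x F x.

Lemma integE F : bounded_measurable F ->
  (\int[mu]_x (F x)%:E)%E = (integ F)%:E.
Proof.
move=> bF; rewrite /integ /Rintegral fineK//.
by apply: integrable_fin_num => //; exact: bm_integrable.
Qed.

Lemma integD F G : bounded_measurable F -> bounded_measurable G ->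
  integ (fun x => F x + G x) = integ F + integ G.
Proof. by move=> bF bG; rewrite /integ RintegralD//; exact: bm_integrable. Qed.

Lemma integB F G : bounded_measurable F -> bounded_measurable G ->
  integ (fun x => F x - G x) = integ F - integ G.
Proof. by move=> bF bG; rewrite /integ RintegralB//; exact: bm_integrable. Qed.

Lemma integZl c F : bounded_measurable F ->
  integ (fun x => c * F x) = c * integ F.
Proof. by move=> bF; rewrite /integ RintegralZl//; exact: bm_integrable. Qed.

Lemma integ0 : integ (fun=> 0) = 0.
Proof. by rewrite /integ /Rintegral integral0. Qed.

Lemma integ_sum (I : Type) (s : seq I) (F : I -> T -> R) :
  (forall i, bounded_measurable (F i)) ->
  integ (fun x => \sum_(i <- s) F i x) = \sum_(i <- s) integ (F i).
Proof.
move=> bF; elim: s => [|i s IH].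
  by rewrite big_nil -[RHS]integ0; congr integ; apply/funext => x; rewrite big_nil.
rewrite big_cons -IH -integD//; last exact: bm_sum.
by congr integ; apply/funext => x; rewrite big_cons.
Qed.

Lemma integ_ge0 F : (forall x, 0 <= F x) -> 0 <= integ F.
Proof. by move=> F0; exact: Rintegral_ge0. Qed.

Lemma le_integ F G : bounded_measurable F -> bounded_measurable G ->
  (forall x, F x <= G x) -> integ F <= integ G.
Proof.
by move=> bF bG FG; apply: le_Rintegral => // *; exact: bm_integrable.
Qed.

Lemma ler_norm_integ F : bounded_measurable F ->
  `|integ F| <= integ (fun x => `|F x|).
Proof. by move=> bF; apply: le_normr_Rintegral => //; exact: bm_integrable. Qed.

Lemma bm_cvg (F_ : nat -> T -> R) F (K : R) :
  (forall m, bounded_measurable (F_ m)) -> (forall m x, `|F_ m x| <= K) ->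
  (forall x, F_ ^~ x @ \oo --> F x) -> bounded_measurable F.
Proof.
move=> bF FK FF; split.
  by apply: (@measurable_fun_cvg _ _ _ _ F_) => // m; have [] := bF m.
exists K => x; have /cvg_norm FFx := FF x.
rewrite -(cvg_lim _ FFx)//; apply: limr_le; first by apply/cvg_ex; eexists; exact: FFx.
by apply: nearW => m; exact: FK.
Qed.

Lemma cvg_integ (F_ : nat -> T -> R) F (K : R) :
  (forall m, bounded_measurable (F_ m)) -> (forall m x, `|F_ m x| <= K) ->
  (forall x, F_ ^~ x @ \oo --> F x) -> integ (F_ m) @[m --> \oo] --> integ F.
Proof.
move=> bF FK FF; have bFF := bm_cvg bF FK FF.
have [] := @dominated_convergence _ T R mu setT measurableT
    (fun m => EFin \o F_ m) (EFin \o F) (fun=> K%:E).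
- by move=> m; apply/measurable_EFinP; have [] := bF m.
- by apply/measurable_EFinP; have [] := bFF.
- by apply: aeW => x _; apply/fine_cvgP; split; [exact: nearW|exact: FF].
- exact: bm_integrable (bm_cst K).
- by apply: aeW => x m _; rewrite /= lee_fin.
move=> _ _; rewrite (integE bFF) => /fine_cvgP[_].
by apply: cvg_trans; apply: near_eq_cvg; exact: nearW.
Qed.

End integral_functional.

(** * Trigonometric moments of the site measures *)

Section angle_periodicity.
Context {R : realType}.

Lemma sin_periodic (x : R) (k : int) : sin (x + k%:~R * (2 * pi)) = sin x.
Proof.
have E m y : sin (y + m%:R * (2 * pi)) = sin y :> R.
  by rewrite -(periodicn (@sinD2pi R) m y); congr (sin (_ + _)); ring.
case: k => n; first exact: E.
by rewrite NegzE mulrNz mulNr -(E n.+1 (x - _)) subrK.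
Qed.

Lemma cos_periodic (x : R) (k : int) : cos (x + k%:~R * (2 * pi)) = cos x.
Proof. by rewrite -!sinDpihalf addrAC sin_periodic. Qed.

End angle_periodicity.

Section site_fourier.
Context {R : realType}.
Local Notation T := (measurableTypeR R).

Definition arc : set T := `[- pi, pi[%classic.

(** The phase [a] covers cosines and sines at once. The sign condition on [c]
    holds for free and for pinned sites; all comparison inequalities below come
    from it. *)
Definition trigonometric_moments (mu : {measure set T -> \bar R})
    (c : int -> R) :=
  [/\ (mu setT < +oo)%E, forall k, 0 <= c k &
      forall (k : int) (a : R),
        (\int[mu]_x (cos (k%:~R * x + a))%:E)%E = (cos a * c k)%:E].

Lemma measurable_affine (k a : R) : measurable_fun setT (fun x : T => k * x + a).
Proof.
by apply: measurable_funD; [exact: measurable_funM|exact: measurable_cst].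
Qed.

Lemma dirac0_moments :
  trigonometric_moments (@dirac _ T (0 : R) R) (fun=> 1).
Proof.
split=> [||k a].
- by rewrite /= /dirac indicE in_setT ltry.
- by move=> _; exact: ler01.
rewrite integral_dirac//.
  by rewrite /dirac indicE in_setT mul1e mulr0 add0r mulr1.
apply/measurable_EFinP.
by have [] := bm_cos (measurable_affine k%:~R a).
Qed.

Lemma integral_mfrestr (D : set T) (mD : measurable D)
    (Doo : (@lebesgue_measure R D < +oo)%E) (F : T -> R) :
  bounded_measurable F ->
  (\int[mfrestr mD Doo]_x (F x)%:E)%E = (\int[@lebesgue_measure R]_(x in D) (F x)%:E)%E.
Proof.
move=> bF; have rfin : (mfrestr mD Doo setT < +oo)%E.
  by rewrite /mfrestr /mrestr setTI.
rewrite (@negligible_integral _ _ _ _ setT (~` D))//=; last 3 first.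
- exact: measurableC.
- exact: bm_integrable.
- by rewrite /mfrestr /mrestr setICl measure0.
rewrite setDE setCK setTI; apply: eq_measure_integral => A mA AD /=.
by rewrite /mfrestr /mrestr; congr (_ _); rewrite setIidl.
Qed.

Lemma arc_moments (mD : measurable arc) (Doo : (@lebesgue_measure R arc < +oo)%E) :
  trigonometric_moments (mfrestr mD Doo) (fun k => if k == 0 then 2 * pi else 0).
Proof.
split=> [||k a].
- by rewrite /= /mfrestr /mrestr setTI.
- by move=> k; case: ifP => // _; rewrite mulr_ge0// pi_ge0.
rewrite integral_mfrestr; last exact: bm_cos (measurable_affine _ _).
have npi : - pi < pi :> R by rewrite gtrN// pi_gt0.
case: eqP => [->|/eqP k0].
  under eq_integral do rewrite mul0r add0r.
  rewrite integral_cst//= lebesgue_measure_itv/= lte_fin npi.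
  by rewrite -EFinB -EFinM; congr EFin; rewrite opprK mulr2n mulrDl mul1r.
rewrite integral_itv_bndo_bndc; last first.
  apply/measurable_EFinP; apply: measurable_funTS.
  by have [] := bm_cos (measurable_affine k%:~R a).
have k0' : k%:~R != 0 :> R by rewrite intr_eq0.
have dl (x : R) : is_derive x (1 : R) (fun y : R => k%:~R * y + a) k%:~R.
  by apply: is_derive_eq; rewrite addr0 scaler1.
pose F (x : R) := (k%:~R)^-1 * sin (k%:~R * x + a).
have dF (x : R) : is_derive x (1 : R) F (cos (k%:~R * x + a)).
  rewrite -[X in is_derive _ _ _ X](mulKf k0').
  have ds := @is_derive1_comp _ sin (fun y : R => k%:~R * y + a) _ _ _ (is_derive_sin _) (dl x).
  rewrite [k%:~R * cos _]mulrC.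
  exact: (is_deriveZ k%:~R^-1 ds).
have cF : continuous F.
  by move=> x; apply/differentiable_continuous/derivable1_diffP; have [] := dF x.
rewrite (@continuous_FTC2 _ _ F)//.
- rewrite mulr0 -EFinB; congr EFin; rewrite /F -mulrBr.
  have -> : k%:~R * pi + a = k%:~R * - pi + a + k%:~R * (2 * pi) :> R.
    by ring.
  by rewrite sin_periodic subrr mulr0.
- apply: continuous_subspaceT => x; apply: continuous_comp; last exact: continuous_cos.
  by apply/differentiable_continuous/derivable1_diffP; have [] := dl x.
- split.
  + by move=> x _; have [] := dF x.
  + by apply: cvg_at_right_filter; exact: cF.
  + by apply: cvg_at_left_filter; exact: cF.
- by move=> x _; rewrite derive1E; have [_ ->] := dF x.
Qed.
End site_fourier.

(** * Trigonometric moments of product measures *)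

Section product_integral.
Context {d} {T : measurableType d} {R : realType}.

Lemma tuple_product_fin n (m : 'I_n -> {sigma_finite_measure set T -> \bar R}) :
  (forall i, m i setT < +oo)%E -> (tuple_product m setT < +oo)%E.
Proof.
move=> mfin; have -> : tuple_product m setT = (\prod_(i < n) m i setT)%E.
  rewrite -tuple_product_box//; congr (tuple_product _ _).
  by apply/seteqP; split.
suff /andP[] : (0 <= \prod_(i < n) m i setT < +oo)%E by [].
elim/big_ind : _ => [|x y /andP[x0 xoo] /andP[y0 yoo]|i _].
- by rewrite lee01 ltry.
- by rewrite mule_ge0//= lte_mul_pinfty// ge0_fin_numE.
- by rewrite measure_ge0 mfin.
Qed.

Lemma integ_cons_product n (m1 : {sigma_finite_measure set T -> \bar R})
    (m2 : {sigma_finite_measure set (n.-tuple T) -> \bar R})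
    (F : n.+1.-tuple T -> R) :
  (m1 setT < +oo)%E -> (m2 setT < +oo)%E -> bounded_measurable F ->
  (\int[cons_product m1 m2]_t (F t)%:E =
   \int[m1]_x \int[m2]_t (F [tuple of x :: t])%:E)%E.
Proof.
move=> m1fin m2fin bF.
pose cp (p : T * n.-tuple T) : n.+1.-tuple T := [tuple of p.1 :: p.2].
have mcp : measurable_fun setT cp by exact: measurable_cons.
have bFcp : bounded_measurable (F \o cp).
  have [mF [K FK]] := bF; split; first exact: measurableT_comp.
  by exists K => x; exact: FK.
have pfin : ((m1 \x m2)%E setT < +oo)%E.
  rewrite -setXTT product_measure1E// lte_mul_pinfty//.
  by rewrite ge0_fin_numE.
transitivity (\int[pushforward (m1 \x m2)%E cp]_t (F t)%:E)%E.
  exact: eq_measure_integral.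
rewrite integral_pushforward//=; last 2 first.
- by apply/measurable_EFinP; have [] := bF.
- exact: bm_integrable bFcp.
rewrite preimage_setT -(integral12_prod_meas1 (bm_integrable pfin bFcp)).
by [].
Qed.

End product_integral.

Section product_moments.
Context {R : realType}.
Local Notation T := (measurableTypeR R).

Definition phase n (kappa : {ffun 'I_n -> int}) (t : n.-tuple T) : R :=
  \sum_(i < n) (kappa i)%:~R * tnth t i.

Lemma measurable_phase n (kappa : {ffun 'I_n -> int}) :
  measurable_fun setT (phase kappa).
Proof.
apply: measurable_sum => i; apply: measurable_funM => //.
exact: measurable_tnth.
Qed.

(** Freezing the first angle only changes the phase of the mode in the others,
    so that the induction goes through with an arbitrary phase [a]. *)
Lemma tuple_product_cos n (m : 'I_n -> {sigma_finite_measure set T -> \bar R})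
    (c : 'I_n -> int -> R) :
  (forall i, trigonometric_moments (m i) (c i)) ->
  forall (kappa : {ffun 'I_n -> int}) a,
  (\int[tuple_product m]_t (cos (phase kappa t + a))%:E)%E =
  (cos a * \prod_(i < n) c i (kappa i))%:E.
Proof.
elim: n m c => [|n IH] m c mc kappa a.
  rewrite /= integral_dirac//.
    rewrite /dirac indicE in_setT mul1e big_ord0 mulr1.
    by rewrite /phase big_ord0 add0r.
  apply/measurable_EFinP.
  have [|//] := @bm_cos _ _ R (fun t => phase kappa t + a).
  by apply: measurable_funD => //; exact: measurable_phase.
have mfin i : (m i setT < +oo)%E by have [] := mc i.
have m'fin : (tuple_product (fun i => m (lift ord0 i)) setT < +oo)%E.
  exact: tuple_product_fin.
rewrite /= integ_cons_product//; last first.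
  apply: bm_cos; apply: measurable_funD => //; exact: measurable_phase.
pose kappa' := [ffun i => kappa (lift ord0 i)].
have phaseE x (t : n.-tuple T) : phase kappa [tuple of x :: t] + a =
    phase kappa' t + ((kappa ord0)%:~R * x + a).
  rewrite /phase big_ord_recl tnth0 -addrA addrCA; congr (_ + _).
  by apply: eq_bigr => i _; rewrite tnthS ffunE.
have [_ _ mc0] := mc ord0.
transitivity (\int[m ord0]_x
   (cos ((kappa ord0)%:~R * x + a) * \prod_(i < n) c (lift ord0 i) (kappa' i))%:E)%E.
  apply: eq_integral => x _.
  under eq_integral do rewrite phaseE.
  exact: (IH _ (fun i => c (lift ord0 i))).
under eq_integral do rewrite EFinM.
rewrite integralZr//; last first.
  exact: (bm_integrable (mfin ord0) (bm_cos (measurable_affine (kappa ord0)%:~R a))).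
rewrite mc0 -EFinM big_ord_recl mulrA; congr (_ * _)%:E.
by apply: eq_bigr => i _; rewrite ffunE.
Qed.

End product_moments.

(** * Formal Fourier polynomials *)

Section complex_algebra.
Context {R : realType}.
Implicit Types x y : R[i].
Local Notation Re := complex.Re.
Local Notation Im := complex.Im.

Lemma cReD x y : Re (x + y) = Re x + Re y. Proof. by case: x y => [? ?] []. Qed.
Lemma cImD x y : Im (x + y) = Im x + Im y. Proof. by case: x y => [? ?] []. Qed.
Lemma cReM x y : Re (x * y) = Re x * Re y - Im x * Im y.
Proof. by case: x y => [? ?] []. Qed.
Lemma cImM x y : Im (x * y) = Re x * Im y + Im x * Re y.
Proof. by case: x y => [? ?] []. Qed.

Lemma expiD (a b : R) : expi (a + b) = expi a * expi b.
Proof.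
rewrite /expi cosD sinD; apply/eqP; rewrite eq_complex cReM cImM /=.
by rewrite eqxx /= addrC eqxx.
Qed.

Lemma expi0 : expi 0 = 1 :> R[i].
Proof. by rewrite /expi cos0 sin0. Qed.

Definition ccvg (u : nat -> R[i]) (l : R[i]) :=
  (Re (u m) @[m --> \oo] --> Re l) /\ (Im (u m) @[m --> \oo] --> Im l).

Lemma ccvg_cst l : ccvg (fun=> l) l.
Proof. by split; exact: cvg_cst. Qed.

Lemma ccvg_const u l : (forall m, u m = l) -> ccvg u l.
Proof. by move=> /funext ->; exact: ccvg_cst. Qed.

Lemma ccvgD u v x y : ccvg u x -> ccvg v y -> ccvg (fun m => u m + v m) (x + y).
Proof.
move=> [u1 u2] [v1 v2]; split.
  by rewrite cReD; under eq_fun do rewrite cReD; exact: cvgD.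
by rewrite cImD; under eq_fun do rewrite cImD; exact: cvgD.
Qed.

Lemma ccvgM u v x y : ccvg u x -> ccvg v y -> ccvg (fun m => u m * v m) (x * y).
Proof.
move=> [u1 u2] [v1 v2]; split.
  by rewrite cReM; under eq_fun do rewrite cReM; apply: cvgB; exact: cvgM.
by rewrite cImM; under eq_fun do rewrite cImM; apply: cvgD; exact: cvgM.
Qed.

Lemma ccvg_real (u : nat -> R) (l : R) : u m @[m --> \oo] --> l ->
  ccvg (fun m => (u m)%:C%C) (l%:C)%C.
Proof. by move=> ul; split => //; exact: cvg_cst. Qed.

Lemma ccvg_eq u v l : (forall m, u m = v m) -> ccvg u l -> ccvg v l.
Proof. by move=> /funext ->. Qed.

End complex_algebra.

Section fourier_polynomials.
Context {R : realType} {n : nat}.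
Local Notation T := (measurableTypeR R).
Local Notation K := {ffun 'I_n -> int}.

(** A triple [(w, z, k)] stands for [w * expi (phase k)] together with a formal
    charge [z]. Charges add up in products, and an evaluation [fval g] weights
    each triple by a function [g] of its charge and mode. One list of nonnegative
    weights thus yields several functions of the angles, related to one another
    by the choice of [g]. *)
Definition fpoly := seq (R * R * K).
Implicit Types (l : fpoly) (g : R -> K -> R[i]) (t : n.-tuple T).

Definition fval g l t : R[i] :=
  \sum_(x <- l) (x.1.1)%:C%C * g x.1.2 x.2 * expi (phase x.2 t).

Definition fpos l := all (fun x => 0 <= x.1.1) l.

Definition fmul l l' : fpoly :=
  [seq (x.1.1 * y.1.1, x.1.2 + y.1.2, x.2 + y.2) | x <- l, y <- l'].

Definition fone : fpoly := [:: (1, 0, 0)].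

Definition fpow l k := iter k (fmul l) fone.

Definition fprod (ls : seq fpoly) := foldr fmul fone ls.

Definition fscale (w z : R) l : fpoly :=
  [seq (w * x.1.1, z * x.1.2, x.2) | x <- l].

(** Evaluation is multiplicative for such weights, whereas [charge1] and
    [charge2] obey the Leibniz rules of first and second derivatives. *)
Definition multiplicative_charge g :=
  g 0 0 = 1 /\ forall z z' k k', g (z + z') (k + k') = g z k * g z' k'.

Definition charge0 : R -> K -> R[i] := fun _ _ => 1.
Definition charge1 : R -> K -> R[i] := fun z _ => (z%:C)%C.
Definition charge2 : R -> K -> R[i] := fun z _ => ((z ^+ 2)%:C)%C.

Lemma phaseD (k k' : K) t : phase (k + k') t = phase k t + phase k' t.
Proof.
by rewrite /phase -big_split; apply: eq_bigr => i _; rewrite ffunE intrD mulrDl.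
Qed.

Lemma phase0 t : phase 0 t = 0.
Proof. by rewrite /phase big1 // => i _; rewrite ffunE mul0r. Qed.

Lemma phaseN (k : K) t : phase (- k) t = - phase k t.
Proof.
by rewrite /phase -sumrN; apply: eq_bigr => i _; rewrite ffunE intrN mulNr.
Qed.

Lemma multiplicative_charge0 : multiplicative_charge charge0.
Proof. by split => // *; rewrite mulr1. Qed.

Lemma fval_cons g x l t : fval g (x :: l) t =
  (x.1.1)%:C%C * g x.1.2 x.2 * expi (phase x.2 t) + fval g l t.
Proof. by rewrite /fval big_cons. Qed.

Lemma fval_cat g l l' t : fval g (l ++ l') t = fval g l t + fval g l' t.
Proof. by rewrite /fval big_cat. Qed.

Lemma fval_flatten g (ls : seq fpoly) t :
  fval g (flatten ls) t = \sum_(l <- ls) fval g l t.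
Proof.
elim: ls => [|l ls IH] /=; first by rewrite /fval !big_nil.
by rewrite fval_cat IH big_cons.
Qed.

Lemma fval_one g t : g 0 0 = 1 -> fval g fone t = 1.
Proof. by move=> g1; rewrite /fval big_seq1 /= g1 phase0 expi0 !mulr1. Qed.

Lemma fval_mulE g l l' t : fval g (fmul l l') t =
  \sum_(x <- l) \sum_(y <- l') (x.1.1)%:C%C * (y.1.1)%:C%C *
     g (x.1.2 + y.1.2) (x.2 + y.2) * (expi (phase x.2 t) * expi (phase y.2 t)).
Proof.
rewrite /fval /fmul big_allpairs_dep; apply: eq_bigr => x _.
by apply: eq_bigr => y _; rewrite /= phaseD expiD rmorphM.
Qed.

Lemma fval_mul g l l' t : multiplicative_charge g ->
  fval g (fmul l l') t = fval g l t * fval g l' t.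
Proof.
move=> [_ gM]; rewrite fval_mulE [X in X * _]/fval mulr_suml.
apply: eq_bigr => x _; rewrite /fval mulr_sumr; apply: eq_bigr => y _.
by rewrite gM; ring.
Qed.

Lemma fval1_mul l l' t : fval charge1 (fmul l l') t =
  fval charge1 l t * fval charge0 l' t + fval charge0 l t * fval charge1 l' t.
Proof.
rewrite fval_mulE [X in X * _ + _]/fval [X in _ + X * _]/fval !mulr_suml.
rewrite -big_split; apply: eq_bigr => x _ /=; rewrite /fval !mulr_sumr.
rewrite -big_split; apply: eq_bigr => y _ /=.
by rewrite /charge0 /charge1 rmorphD /=; ring.
Qed.

Lemma fval2_mul l l' t : fval charge2 (fmul l l') t =
  fval charge2 l t * fval charge0 l' t +
  2 * (fval charge1 l t * fval charge1 l' t) +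
  fval charge0 l t * fval charge2 l' t.
Proof.
rewrite fval_mulE [X in X * _ + _]/fval [X in 2 * (X * _)]/fval.
rewrite [X in _ + X * _]/fval !mulr_suml mulr_sumr.
rewrite -!big_split; apply: eq_bigr => x _ /=; rewrite /fval !mulr_sumr.
rewrite -!big_split; apply: eq_bigr => y _ /=.
by rewrite /charge0 /charge1 /charge2 !expr2 !rmorphM /= !rmorphD /=; ring.
Qed.

Lemma fval_pow g l k t : multiplicative_charge g ->
  fval g (fpow l k) t = fval g l t ^+ k.
Proof.
move=> gM; elim: k => [|k IH]; first by rewrite expr0 fval_one//; have [] := gM.
by rewrite /= fval_mul// IH exprS.
Qed.

Lemma fpos_mul l l' : fpos l -> fpos l' -> fpos (fmul l l').
Proof.
move=> /allP pl /allP pl'; apply/allP => _ /allpairsP[[x y] [xl yl' ->]] /=.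
by rewrite mulr_ge0//; [exact: pl|exact: pl'].
Qed.

Lemma fpos_one : fpos fone.
Proof. by rewrite /= ler01. Qed.

Lemma fpos_pow l k : fpos l -> fpos (fpow l k).
Proof. by move=> pl; elim: k => [|k IH]; [exact: fpos_one|exact: fpos_mul]. Qed.

Lemma fpos_prod ls : all fpos ls -> fpos (fprod ls).
Proof.
elim: ls => [_|l ls IH /= /andP[pl pls]]; first exact: fpos_one.
by apply: fpos_mul => //; exact: IH.
Qed.

Lemma fpos_scale w z l : 0 <= w -> fpos l -> fpos (fscale w z l).
Proof.
move=> w0 /allP pl; apply/allP => _ /mapP[x xl ->] /=.
by rewrite mulr_ge0//; exact: pl.
Qed.

Lemma fpos_flatten (ls : seq fpoly) : all fpos ls -> fpos (flatten ls).
Proof.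
elim: ls => //= l ls IH /andP[pl pls]; rewrite /fpos all_cat.
by apply/andP; split => //; exact: IH.
Qed.

Lemma fval0_scale w z l t : fval charge0 (fscale w z l) t =
  (w%:C)%C * fval charge0 l t.
Proof.
rewrite /fval big_map mulr_sumr; apply: eq_bigr => x _ /=.
by rewrite rmorphM /=; ring.
Qed.

Lemma fval1_scale w z l t : fval charge1 (fscale w z l) t =
  ((w * z)%:C)%C * fval charge1 l t.
Proof.
rewrite /fval big_map mulr_sumr; apply: eq_bigr => x _ /=.
by rewrite /charge1 !rmorphM /=; ring.
Qed.

Lemma fval2_scale w z l t : fval charge2 (fscale w z l) t =
  ((w * z ^+ 2)%:C)%C * fval charge2 l t.
Proof.
rewrite /fval big_map mulr_sumr; apply: eq_bigr => x _ /=.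
by rewrite /charge2 !exprMn !rmorphM /=; ring.
Qed.

(** The charge is [1] on [expi (phase k)] and [-1] on its conjugate: it tells
    how a mode responds to a rotation of the angle [phase k]. *)
Definition fcos (k : K) : fpoly := [:: (2^-1, 1, k); (2^-1, -1, - k)].

Lemma fpos_cos k : fpos (fcos k).
Proof. by rewrite /fpos /= invr_ge0 ler0n. Qed.

Lemma fval0_cos k t : fval charge0 (fcos k) t = ((cos (phase k t))%:C)%C.
Proof.
rewrite /fval /charge0 !big_cons big_nil /= phaseN /expi cosN sinN.
apply/eqP; rewrite eq_complex !(cReD, cImD, cReM, cImM) /=; apply/andP.
by split; apply/eqP; field.
Qed.

Lemma fval1_cos k t : fval charge1 (fcos k) t = Complex 0 (sin (phase k t)).
Proof.
rewrite /fval /charge1 !big_cons big_nil /= phaseN /expi cosN sinN.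
apply/eqP; rewrite eq_complex !(cReD, cImD, cReM, cImM) /=; apply/andP.
by split; apply/eqP; field.
Qed.

Lemma fval2_cos k t : fval charge2 (fcos k) t = ((cos (phase k t))%:C)%C.
Proof.
rewrite /fval /charge2 !big_cons big_nil /= phaseN /expi cosN sinN.
apply/eqP; rewrite eq_complex !(cReD, cImD, cReM, cImM) /=; apply/andP.
by split; apply/eqP; field.
Qed.

End fourier_polynomials.
Arguments fpoly : clear implicits.

(** * Integrals of Fourier polynomials *)

Section fourier_integrals.
Context {R : realType} {n : nat}.
Local Notation T := (measurableTypeR R).
Local Notation K := {ffun 'I_n -> int}.
Local Notation Re := complex.Re.
Local Notation Im := complex.Im.
Variables (m : 'I_n -> {sigma_finite_measure set T -> \bar R})
  (c : 'I_n -> int -> R).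
Hypothesis mc : forall i, trigonometric_moments (m i) (c i).

Local Notation mu := (tuple_product m).
Local Notation integ := (integ (tuple_product m)).

Lemma mu_fin : (mu setT < +oo)%E.
Proof. by apply: tuple_product_fin => i; have [] := mc i. Qed.

Definition fcoef (k : K) := \prod_(i < n) c i (k i).

Lemma fcoef_ge0 k : 0 <= fcoef k.
Proof. by apply: prodr_ge0 => i _; have [_ c0 _] := mc i; exact: c0. Qed.

Lemma bm_cos_phase (k : K) : bounded_measurable (fun t : n.-tuple T => cos (phase k t)).
Proof. by apply: bm_cos; exact: measurable_phase. Qed.

Lemma bm_sin_phase (k : K) : bounded_measurable (fun t : n.-tuple T => sin (phase k t)).
Proof. by apply: bm_sin; exact: measurable_phase. Qed.

Lemma integ_cos_phase (k : K) : integ (fun t => cos (phase k t)) = fcoef k.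
Proof.
have := tuple_product_cos mc k 0; under eq_integral do rewrite addr0.
by rewrite (integE mu_fin (bm_cos_phase k)) cos0 mul1r => -[].
Qed.

Lemma integ_sin_phase (k : K) : integ (fun t => sin (phase k t)) = 0.
Proof.
have := tuple_product_cos mc k (- (pi / 2)).
under eq_integral do rewrite cosBpihalf.
by rewrite (integE mu_fin (bm_sin_phase k)) cosN cos_pihalf mul0r => -[].
Qed.

Implicit Types (l : fpoly R n) (g : R -> K -> R) (t : n.-tuple T).

Definition cplx g : R -> K -> R[i] := fun z k => (g z k)%:C%C.

Lemma Re_fval g l t : Re (fval (cplx g) l t) =
  \sum_(x <- l) x.1.1 * g x.1.2 x.2 * cos (phase x.2 t).
Proof.
elim: l => [|x l IH]; first by rewrite /fval !big_nil.
by rewrite fval_cons big_cons cReD IH !cReM !cImM /=; congr (_ + _); ring.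
Qed.

Lemma Im_fval g l t : Im (fval (cplx g) l t) =
  \sum_(x <- l) x.1.1 * g x.1.2 x.2 * sin (phase x.2 t).
Proof.
elim: l => [|x l IH]; first by rewrite /fval !big_nil.
by rewrite fval_cons big_cons cImD IH cImM cReM !cImM /=; congr (_ + _); ring.
Qed.

Lemma bm_Re_fval g l : bounded_measurable (fun t => Re (fval (cplx g) l t)).
Proof.
apply: bm_ext (bm_sum l xpredT (fun x => _)) => [t|x]; first by rewrite Re_fval.
by apply: bmM (bm_cst _) (bm_cos_phase _).
Qed.

Lemma bm_Im_fval g l : bounded_measurable (fun t => Im (fval (cplx g) l t)).
Proof.
apply: bm_ext (bm_sum l xpredT (fun x => _)) => [t|x]; first by rewrite Im_fval.
by apply: bmM (bm_cst _) (bm_sin_phase _).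
Qed.

Lemma integ_Re_fval g l : integ (fun t => Re (fval (cplx g) l t)) =
  \sum_(x <- l) x.1.1 * g x.1.2 x.2 * fcoef x.2.
Proof.
transitivity (integ (fun t =>
    \sum_(x <- l) x.1.1 * g x.1.2 x.2 * cos (phase x.2 t))).
  by congr integ; apply/funext => t; rewrite Re_fval.
rewrite integ_sum//; last 2 first.
- exact: mu_fin.
- by move=> x; apply: bmM (bm_cst _) (bm_cos_phase _).
apply: eq_bigr => x _; rewrite integZl ?integ_cos_phase//.
- exact: mu_fin.
- exact: bm_cos_phase.
Qed.

Lemma integ_Im_fval g l : integ (fun t => Im (fval (cplx g) l t)) = 0.
Proof.
transitivity (integ (fun t =>
    \sum_(x <- l) x.1.1 * g x.1.2 x.2 * sin (phase x.2 t))).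
  by congr integ; apply/funext => t; rewrite Im_fval.
rewrite integ_sum//; last 2 first.
- exact: mu_fin.
- by move=> x; apply: bmM (bm_cst _) (bm_sin_phase _).
rewrite big1 // => x _; rewrite integZl ?integ_sin_phase ?mulr0//.
- exact: mu_fin.
- exact: bm_sin_phase.
Qed.

Definition origin : n.-tuple T := [tuple (0 : R) | i < n].

Lemma phase_origin (k : K) : phase k origin = 0.
Proof. by rewrite /phase big1 // => i _; rewrite tnth_mktuple mulr0. Qed.

(** All modes equal [1] at the origin, where terms with nonnegative coefficients
    add up without cancellation. *)
Lemma fval_le_origin g l t : (forall z k, 0 <= g z k) -> fpos l ->
  `|Re (fval (cplx g) l t)| <= Re (fval (cplx g) l origin) /\
  `|Im (fval (cplx g) l t)| <= Re (fval (cplx g) l origin).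
Proof.
move=> g0; rewrite !Re_fval Im_fval.
elim: l => [_|x l IH /= /andP[x0 /IH[IH1 IH2]]]; first by rewrite !big_nil normr0.
rewrite !big_cons phase_origin cos0; split; rewrite (le_trans (ler_normD _ _))//.
  rewrite lerD// normrM mulr1 ger0_norm ?mulr_ge0// ler_piMr ?mulr_ge0//.
  exact: cos_max.
rewrite lerD// normrM mulr1 ger0_norm ?mulr_ge0// ler_piMr ?mulr_ge0//.
exact: sin_max.
Qed.

(** By [fval_le_origin] the values at the origin, which converge, bound the
    polynomials uniformly: dominated convergence applies. *)
Lemma fourier_limit g (l : nat -> fpoly R n) (F : n.-tuple T -> R[i]) :
  (forall z k, 0 <= g z k) -> (forall j, fpos (l j)) ->
  (forall t, ccvg (fun j => fval (cplx g) (l j) t) (F t)) ->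
  [/\ bounded_measurable (fun t => Re (F t)), bounded_measurable (fun t => Im (F t)),
      integ (fun t => Re (fval (cplx g) (l j) t)) @[j --> \oo] -->
        integ (fun t => Re (F t)) & integ (fun t => Im (F t)) = 0].
Proof.
move=> g0 pl lF.
have [B [_ /(_ (B + 1))hB]] := cvg_seq_bounded (cvgP _ (lF origin).1).
have {}hB j : Re (fval (cplx g) (l j) origin) <= B + 1.
  by apply: le_trans (ler_norm _) (hB _ _ _) => //; rewrite ltrDl.
have R1 j t : `|Re (fval (cplx g) (l j) t)| <= B + 1.
  exact: le_trans (fval_le_origin t g0 (pl j)).1 (hB j).
have I1 j t : `|Im (fval (cplx g) (l j) t)| <= B + 1.
  exact: le_trans (fval_le_origin t g0 (pl j)).2 (hB j).
split.
- by apply: (bm_cvg _ R1) => [j|t]; [exact: bm_Re_fval|exact: (lF t).1].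
- by apply: (bm_cvg _ I1) => [j|t]; [exact: bm_Im_fval|exact: (lF t).2].
- apply: (cvg_integ mu_fin _ R1) => [j|t]; first exact: bm_Re_fval.
  exact: (lF t).1.
- have : integ (fun t => Im (fval (cplx g) (l j) t)) @[j --> \oo] -->
    integ (fun t => Im (F t)).
    apply: (cvg_integ mu_fin _ I1) => [j|t]; first exact: bm_Im_fval.
    exact: (lF t).2.
  under eq_fun do rewrite integ_Im_fval.
  by move=> /(cvg_unique _ (cvg_cst _)) ->.
Qed.

(** Each mode has a nonnegative mean, so that nonnegative coefficients alone
    give the sign of the integral. *)
Lemma fourier_limit_ge0 g (l : nat -> fpoly R n) (F : n.-tuple T -> R[i]) :
  (forall z k, 0 <= g z k) -> (forall j, fpos (l j)) ->
  (forall t, ccvg (fun j => fval (cplx g) (l j) t) (F t)) ->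
  0 <= integ (fun t => Re (F t)).
Proof.
move=> g0 pl lF; have [_ _ cF _] := fourier_limit g0 pl lF.
rewrite -(cvg_lim _ cF)//; apply: limr_ge; first by apply/cvg_ex; eexists; exact: cF.
apply: nearW => j; rewrite integ_Re_fval; have := pl j.
elim: (l j) => [_|x s IH /= /andP[x0 /IH]]; first by rewrite big_nil.
by rewrite big_cons => ?; rewrite addr_ge0// !mulr_ge0// fcoef_ge0.
Qed.

End fourier_integrals.

(** * Power series in a cosine *)

Section cosine_series.
Context {R : realType} {n : nat}.
Local Notation T := (measurableTypeR R).
Local Notation K := {ffun 'I_n -> int}.
Local Notation Re := complex.Re.
Local Notation Im := complex.Im.
Implicit Types (k : K) (t : n.-tuple T) (al ga : nat -> R).

(** A truncation of the series of the [al j * cos ^+ j] in which the charges of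
    the [j]-th power are multiplied by [ga j]. The value for [charge0] does not
    depend on [ga]; [ga] selects the value for [charge1] (see [fval1_series]). *)
Definition fseries al ga k (M : nat) : fpoly R n :=
  flatten [seq fscale (al j) (ga j) (fpow (fcos k) j) | j <- iota 0 M].

Lemma fpos_series al ga k M : (forall j, 0 <= al j) -> fpos (fseries al ga k M).
Proof.
move=> al0; apply: fpos_flatten; apply/allP => _ /mapP[j _ ->].
by apply: fpos_scale => //; apply: fpos_pow; exact: fpos_cos.
Qed.

Lemma fval0_series al ga k M t : fval charge0 (fseries al ga k M) t =
  ((\sum_(j < M) al j * cos (phase k t) ^+ j)%:C)%C.
Proof.
rewrite fval_flatten big_map -[M in iota 0 M]subn0 big_mkord raddf_sum /=.
apply: eq_bigr => j _; rewrite fval0_scale fval_pow; last exact: multiplicative_charge0.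
by rewrite fval0_cos rmorphM rmorphXn.
Qed.

Lemma fval1_pow_cos k j t : fval charge1 (fpow (fcos k) j) t =
  Complex 0 (j%:R * cos (phase k t) ^+ j.-1 * sin (phase k t)).
Proof.
elim: j => [|j IH].
  by rewrite /fval /fone big_seq1 /charge1 /= mulr0 mul0r !mul0r.
rewrite fval1_mul IH fval1_cos fval0_cos fval_pow; last exact: multiplicative_charge0.
rewrite fval0_cos -rmorphXn; apply/eqP; rewrite eq_complex !(cReD, cImD, cReM, cImM) /=.
apply/andP; split; apply/eqP; first by ring.
case: j IH => [|j] _ /=; first by ring.
by rewrite exprS -natr1; ring.
Qed.

Lemma fval1_series al ga k M t : fval charge1 (fseries al ga k M) t =
  Complex 0 ((\sum_(j < M) al j * ga j * (j%:R * cos (phase k t) ^+ j.-1)) *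
             sin (phase k t)).
Proof.
rewrite fval_flatten big_map -[M in iota 0 M]subn0 big_mkord.
under eq_bigr do rewrite fval1_scale fval1_pow_cos.
elim: M => [|M IH]; first by rewrite !big_ord0 mul0r.
rewrite !big_ord_recr /= IH; apply/eqP.
rewrite eq_complex !(cReD, cImD, cReM, cImM) /=.
by apply/andP; split; apply/eqP; ring.
Qed.

Lemma charge2_cplx : @charge2 R n = cplx (fun z _ => z ^+ 2).
Proof. by []. Qed.

Lemma fpos_charge2 : forall (z : R) (k : K), 0 <= z ^+ 2.
Proof. by move=> *; exact: sqr_ge0. Qed.

(** The charges in the [j]-th power of a cosine are those of a symmetric walk of
    [j] unit steps, whose variance is [j]. *)
Lemma fval2_pow_cos k j t :
  `|Re (fval charge2 (fpow (fcos k) j) t)| <= j%:R /\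
  Im (fval charge2 (fpow (fcos k) j) t) = 0.
Proof.
split.
  have := (fval_le_origin t fpos_charge2 (fpos_pow j (fpos_cos k))).1.
  move=> /le_trans; apply; rewrite -charge2_cplx.
  suff -> : fval charge2 (fpow (fcos k) j) (@origin R n) = (j%:R%:C)%C by [].
  elim: j => [|j IH]; first by rewrite /fval /fone big_seq1 /charge2 expr0n /= mulr0 mul0r.
  rewrite fval2_mul IH !fval1_cos fval1_pow_cos fval2_cos fval0_cos fval_pow;
    last exact: multiplicative_charge0.
  rewrite fval0_cos phase_origin cos0 sin0 -rmorphXn !expr1n.
  by apply/eqP; rewrite eq_complex !(cReD, cImD, cReM, cImM) /= -natr1;
    apply/andP; split; apply/eqP; ring.
elim: j => [|j IH]; first by rewrite /fpow /= /fval /fone big_seq1 /charge2 expr0n /= !(mulr0, mul0r, subr0, addr0).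
rewrite fval2_mul fval1_cos fval1_pow_cos fval2_cos fval0_cos fval_pow;
  last exact: multiplicative_charge0.
by rewrite fval0_cos -rmorphXn !(cReD, cImD, cReM, cImM) /= IH; ring.
Qed.

Lemma fval2_series al ga k M t : fval charge2 (fseries al ga k M) t =
  ((\sum_(j < M) al j * ga j ^+ 2 * Re (fval charge2 (fpow (fcos k) j) t))%:C)%C.
Proof.
rewrite fval_flatten big_map -[M in iota 0 M]subn0 big_mkord raddf_sum /=.
apply: eq_bigr => j _; rewrite fval2_scale; apply/eqP.
rewrite eq_complex !(cReM, cImM) /= (fval2_pow_cos k j t).2.
by apply/andP; split; apply/eqP; ring.
Qed.

Lemma fval2_series_cvg al ga k t (h : R) : (forall j, 0 <= al j) ->
  (forall M : nat, \sum_(j < M) al j * ga j ^+ 2 * j%:R <= h) ->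
  exists2 H, `|H| <= h &
    ccvg (fun M => fval charge2 (fseries al ga k M) t) (H%:C)%C.
Proof.
move=> al0 hh.
pose u j := al j * ga j ^+ 2 * Re (fval charge2 (fpow (fcos k) j) t).
have uh M : [normed series u] M <= h.
  apply: le_trans (hh M); rewrite /normed_series_of /series /= big_mkord ler_sum// => j _.
  rewrite normrM ger0_norm; last by rewrite mulr_ge0 ?sqr_ge0.
  by apply: ler_wpM2l; [rewrite mulr_ge0 ?sqr_ge0 ?al0|exact: (fval2_pow_cos k j t).1].
have nucvg : cvgn [normed series u].
  apply: nondecreasing_is_cvgn.
    by apply/nondecreasing_seqP => i; rewrite /normed_series_of /series /= big_nat_recr//= lerDl.
  by exists h => _ [N _ <-]; exact: uh.
have ucvg : cvgn (series u) by exact: normed_cvg.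
exists (limn (series u)).
  apply: le_trans (lim_series_norm nucvg) _.
  by apply: limr_le => //; exact: nearW.
apply: ccvg_eq (ccvg_real ucvg) => M.
by rewrite fval2_series /series/= big_mkord.
Qed.

End cosine_series.

(** * Domination of mean squares *)

Section gaussian_domination.
Context {R : realType} {n : nat}.
Local Notation T := (measurableTypeR R).
Local Notation K := {ffun 'I_n -> int}.
Variables (m : 'I_n -> {sigma_finite_measure set T -> \bar R})
  (c : 'I_n -> int -> R).
Hypothesis mc : forall i, trigonometric_moments (m i) (c i).
Variables (I : Type) (kap : I -> K) (beta : R).
Hypothesis beta0 : 0 <= beta.

Local Notation integ := (integ (tuple_product m)).
Implicit Types (es : seq I) (t : n.-tuple T).

Definition angdiff e t := phase (kap e) t.
Definition xy_density es t := expR (beta * \sum_(e <- es) cos (angdiff e t)).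
Definition exp_coef j : R := beta ^+ j / j`!%:R.

Lemma exp_coef_ge0 j : 0 <= exp_coef j.
Proof. by rewrite divr_ge0 ?exprn_ge0. Qed.

Lemma exp_coefS j : exp_coef j.+1 * j.+1%:R = beta * exp_coef j.
Proof.
have a0 : j.+1%:R != 0 :> R by rewrite pnatr_eq0.
have b0 : j`!%:R != 0 :> R by rewrite pnatr_eq0 -lt0n fact_gt0.
rewrite /exp_coef exprS factS natrM; move: (j.+1%:R) (j`!%:R) a0 b0 => a b a0 b0.
by field; rewrite ?a0 ?b0.
Qed.

Lemma exp_series_cvg (x : R) :
  \sum_(j < M) exp_coef j * x ^+ j @[M --> \oo] --> expR (beta * x).
Proof.
have /cvg_ex[l] := is_cvg_series_exp_coeff (beta * x).
move=> H; have -> : expR (beta * x) = l by rewrite /expR (cvg_lim _ H).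
apply: cvg_trans H; apply: near_eq_cvg; apply: nearW => M.
rewrite /series/= big_mkord; apply: eq_bigr => j _.
by rewrite /exp_coef /exp_coeff /= exprMn mulrAC.
Qed.

Lemma xy_density_cons e es t : xy_density (e :: es) t =
  expR (beta * cos (angdiff e t)) * xy_density es t.
Proof. by rewrite /xy_density big_cons mulrDr expRD. Qed.

Lemma bm_cosd e : bounded_measurable (fun t => cos (angdiff e t)).
Proof. exact: (bm_cos_phase (kap e)). Qed.

Lemma bm_sind e : bounded_measurable (fun t => sin (angdiff e t)).
Proof. exact: (bm_sin_phase (kap e)). Qed.

Lemma bm_density es : bounded_measurable (xy_density es).
Proof.
apply: bm_expR; apply: bmM (bm_cst _) _.
by apply: bm_sum => e; exact: bm_cosd.
Qed.

(** Give the [j]-th power of the cosine of an edge [e] the charge [s e * ga j].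
    The hypothesis on [ga] says that [charge1] turns the weight of one edge into
    that weight times [f] (up to the factor i), and the Leibniz rule for [charge2]
    produces the square of the sum over the edges, with the sign of i squared,
    plus diagonal terms. The coefficients for [charge2] are nonnegative, hence so
    is the integral of the whole: the square is at most the diagonal terms, as if
    the angle differences were independent. *)
Lemma sum_square_le (es : seq I) (s : I -> R) (ga : nat -> R) (f : R -> R) (h : R) :
  (forall e, bounded_measurable (fun t => f (angdiff e t))) ->
  (forall x, (\sum_(j < M) exp_coef j * ga j * (j%:R * cos x ^+ j.-1)) * sin x
     @[M --> \oo] --> expR (beta * cos x) * f x) ->
  (forall M : nat, \sum_(j < M) exp_coef j * ga j ^+ 2 * j%:R <= h) ->
  integ (fun t => xy_density es t * (\sum_(e <- es) s e * f (angdiff e t)) ^+ 2) <=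
  integ (fun t => xy_density es t * \sum_(e <- es)
    s e ^+ 2 * (f (angdiff e t) ^+ 2 + h * expR (- (beta * cos (angdiff e t))))).
Proof.
move=> bf cf hh.
pose L M := fprod [seq fscale 1 (s e) (fseries exp_coef ga (kap e) M) | e <- es].
have L0 M : fpos (L M).
  apply: fpos_prod; apply/allP => l; rewrite -/(fpos l).
  elim: es {L} => //= e es IH; rewrite inE => /orP[/eqP ->|/IH//].
  by apply: fpos_scale => //; apply: fpos_series; exact: exp_coef_ge0.
have [H Hh HL] : exists2 H : I -> n.-tuple T -> R,
    forall e t, `|H e t| <= h &
    forall e t, ccvg (fun M => fval charge2 (fseries exp_coef ga (kap e) M) t)
      ((H e t)%:C)%C.
  have /choice[H HP] : forall et : I * n.-tuple T, exists y, `|y| <= h /\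
      ccvg (fun M => fval charge2 (fseries exp_coef ga (kap et.1) M) et.2) (y%:C)%C.
    move=> [e t]; have [y yh yc] := fval2_series_cvg (kap e) t exp_coef_ge0 hh.
    by exists y.
  by exists (fun e t => H (e, t)) => e t; have [] := HP (e, t).
pose F t := xy_density es t *
  (\sum_(e <- es) s e ^+ 2 * (H e t * expR (- (beta * cos (angdiff e t))) +
     f (angdiff e t) ^+ 2) - (\sum_(e <- es) s e * f (angdiff e t)) ^+ 2).
have LF t : [/\ ccvg (fun M => fval charge0 (L M) t) ((xy_density es t)%:C)%C,
    ccvg (fun M => fval charge1 (L M) t)
      (Complex 0 (xy_density es t * \sum_(e <- es) s e * f (angdiff e t))) &
    ccvg (fun M => fval charge2 (L M) t) ((F t)%:C)%C].
  rewrite /L /F {L0 L F}; elim: es => [|e es [IH0 IH1 IH2]].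
    rewrite !big_nil /xy_density big_nil mulr0 expR0 expr0n subr0 !mulr0 /=.
    split; apply: ccvg_const => _.
    - by rewrite fval_one.
    - by rewrite /fval /fone big_seq1 /charge1 /= mulr0 mul0r.
    - by rewrite /fval /fone big_seq1 /charge2 /= expr0n mulr0 mul0r.
  set l0 := fun M => fscale 1 (s e) (fseries exp_coef ga (kap e) M).
  have E0 : ccvg (fun M => fval charge0 (l0 M) t) ((expR (beta * cos (angdiff e t)))%:C)%C.
    apply: ccvg_eq (ccvg_real (@exp_series_cvg (cos (angdiff e t)))) => M.
    by rewrite fval0_scale fval0_series mul1r.
  have E1 : ccvg (fun M => fval charge1 (l0 M) t)
      (Complex 0 (expR (beta * cos (angdiff e t)) * (s e * f (angdiff e t)))).
    have -> : Complex 0 (expR (beta * cos (angdiff e t)) * (s e * f (angdiff e t)))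
      = ((s e)%:C)%C * Complex 0 (expR (beta * cos (angdiff e t)) * f (angdiff e t)).
      apply/eqP; rewrite eq_complex cReM cImM /=.
      by apply/andP; split; apply/eqP; ring.
    apply: (@ccvg_eq _ (fun M => ((s e)%:C)%C * fval charge1 (fseries exp_coef ga (kap e) M) t)).
      by move=> M; rewrite fval1_scale mul1r.
    apply: ccvgM (ccvg_cst _) _; split.
      by under eq_fun do rewrite fval1_series /=; exact: cvg_cst.
    by under eq_fun do rewrite fval1_series /=; exact: cf.
  have E2 : ccvg (fun M => fval charge2 (l0 M) t) ((s e ^+ 2 * H e t)%:C)%C.
    rewrite rmorphM.
    apply: (@ccvg_eq _ (fun M => ((s e ^+ 2)%:C)%C * fval charge2 (fseries exp_coef ga (kap e) M) t)).
      by move=> M; rewrite fval2_scale mul1r.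
    by apply: ccvgM (ccvg_cst _) _; exact: HL.
  rewrite /= -/(l0 _).
  set P := xy_density es t in IH0 IH1 IH2 *.
  set S1 := \sum_(e0 <- es) s e0 * f (angdiff e0 t) in IH1 IH2 *.
  set S2 := \sum_(e0 <- es) _ in IH2 *.
  rewrite xy_density_cons -/P !big_cons -/S1 -/S2.
  set u := expR (beta * cos (angdiff e t)) in E0 E1 *.
  have u0 : u != 0 by rewrite gt_eqF// expR_gt0.
  rewrite expRN -/u; split.
  - rewrite rmorphM; apply: ccvg_eq (ccvgM E0 IH0) => M.
    by rewrite fval_mul//; exact: multiplicative_charge0.
  - apply: ccvg_eq; first by move=> M; rewrite fval1_mul; reflexivity.
    rewrite (_ : Complex _ _ = Complex 0 (u * (s e * f (angdiff e t))) * (P%:C)%C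
       + (u%:C)%C * Complex 0 (P * S1)); last first.
      apply/eqP; rewrite eq_complex !(cReD, cImD, cReM, cImM) /=.
      by apply/andP; split; apply/eqP; ring.
    by apply: ccvgD; apply: ccvgM.
  - apply: ccvg_eq; first by move=> M; rewrite fval2_mul; reflexivity.
    rewrite (_ : (_%:C)%C = ((s e ^+ 2 * H e t)%:C)%C * (P%:C)%C
       + 2 * (Complex 0 (u * (s e * f (angdiff e t))) * Complex 0 (P * S1))
       + (u%:C)%C * ((P * (S2 - S1 ^+ 2))%:C)%C); last first.
      apply/eqP; rewrite eq_complex !(cReD, cImD, cReM, cImM) /=.
      by apply/andP; split; apply/eqP; field.
    apply: ccvgD; last exact: ccvgM.
    apply: ccvgD; first exact: ccvgM.
    by apply: ccvgM (ccvg_cst _) _; exact: ccvgM.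
have LF2 t : ccvg (fun M => fval charge2 (L M) t) ((F t)%:C)%C by case: (LF t).
have F0 : 0 <= integ F := fourier_limit_ge0 mc fpos_charge2 L0 LF2.
have [bF _ _ _] := fourier_limit mc fpos_charge2 L0 LF2.
have bsq : bounded_measurable (fun t => xy_density es t *
    (\sum_(e <- es) s e * f (angdiff e t)) ^+ 2).
  apply: bmM (bm_density es) _; apply: bmX; apply: bm_sum => e.
  exact: bmM (bm_cst _) (bf e).
have bdiag : bounded_measurable (fun t => xy_density es t * \sum_(e <- es)
    s e ^+ 2 * (f (angdiff e t) ^+ 2 + h * expR (- (beta * cos (angdiff e t))))).
  apply: bmM (bm_density es) _; apply: bm_sum => e; apply: bmM (bm_cst _) _.
  apply: bmD; first exact: bmX.
  apply: bmM (bm_cst _) _; apply: bm_expR; apply: bmN.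
  exact: bmM (bm_cst _) (bm_cosd e).
rewrite -subr_ge0 -(integB (mu_fin mc) bdiag bsq); apply: le_trans F0 _.
apply: (le_integ (mu_fin mc) bF (bmB bdiag bsq)) => t.
rewrite /F mulrBr lerD2r ler_wpM2l ?expR_ge0// ler_sum// => e _.
rewrite ler_wpM2l ?sqr_ge0// addrC lerD2l ler_wpM2r ?expR_ge0//.
by apply: le_trans (Hh e t); exact: ler_norm.
Qed.

End gaussian_domination.

(** * Exponential moments of an angle difference *)

Section elementary_bounds.
Context {R : realType}.

Lemma sin_le_id (x : R) : 0 <= x -> sin x <= x.
Proof.
move=> x0; have [|c _] := @MVT_segment R sin cos 0 x x0 (fun y _ => is_derive_sin y).
  by apply: continuous_subspaceT; exact: continuous_sin.
by rewrite sin0 !subr0 => ->; rewrite ler_piMl// cos_le1.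
Qed.

Lemma ler_norm_sin (x : R) : `|sin x| <= `|x|.
Proof.
wlog x0 : x / 0 <= x.
  move=> H; have [/H//|/ltW x0] := leP 0 x.
  by rewrite -normrN -sinN -(normrN x) H// oppr_ge0.
rewrite (ger0_norm x0) ler_norml sin_le_id// andbT.
have [|c _] := @MVT_segment R sin cos 0 x x0 (fun y _ => is_derive_sin y).
  by apply: continuous_subspaceT; exact: continuous_sin.
by rewrite sin0 !subr0 => ->; rewrite -mulN1r ler_wpM2r// cos_geN1.
Qed.

Lemma cos_ge (x : R) : 1 - x ^+ 2 / 2 <= cos x.
Proof.
have -> : cos x = 1 - 2 * sin (x / 2) ^+ 2.
  have {1}-> : x = (x / 2) *+ 2 by rewrite -mulr_natr; field.
  by rewrite cos_mulr2n cos2sin2; ring.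
rewrite lerD2l lerN2.
have : sin (x / 2) ^+ 2 <= (x / 2) ^+ 2.
  by rewrite -real_normK ?num_real// -[leRHS]real_normK ?num_real// ler_sqr ?nnegrE// ler_norm_sin.
by rewrite expr_div_n; lra.
Qed.

Lemma pi_le4 : pi <= 4 :> R.
Proof. by have := @pihalf_lt2 R; lra. Qed.

(** Some multiple of 2 pi / q lies within 2 pi / q of [x]; the constant 32 bounds
    half the square of 2 pi. *)
Lemma cos_near_root (q : nat) (x : R) : (0 < q)%N ->
  exists i : 'I_q, 1 - 32 / q%:R ^+ 2 <= cos (x - i%:R * (2 * pi / q%:R)).
Proof.
move=> q0; have q0' : 0 < q%:R :> R by rewrite ltr0n.
pose y := x * q%:R / (2 * pi); pose N := Num.floor y.
have pi0 := pi_gt0 R.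
have q0n : q%:R != 0 :> R by rewrite gt_eqF.
have pin : pi != 0 :> R by rewrite gt_eqF.
have qN : (q%:Z != 0)%R by rewrite eqz_nat -lt0n.
have iq : (`|(N %% q)%Z| < q)%N.
  by rewrite -ltz_nat gez0_abs ?modz_ge0// ltz_pmod.
exists (Ordinal iq) => /=.
have -> : (`|(N %% q)%Z|%N)%:R = ((N %% q)%Z)%:~R :> R.
  by rewrite -[LHS]/((`|(N %% q)%Z|%N : int)%:~R) gez0_abs ?modz_ge0.
have NE : N%:~R = (N %/ q)%Z%:~R * q%:R + (N %% q)%Z%:~R :> R.
  by rewrite {1}(divz_eq N q) intrD intrM.
have xE : x = y * (2 * pi / q%:R).
  by rewrite /y; move: (@pi R) pin => p p0; field; rewrite ?q0n ?p0.
have -> : x - (N %% q)%Z%:~R * (2 * pi / q%:R) =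
    (y - N%:~R) * (2 * pi / q%:R) + (N %/ q)%Z%:~R * (2 * pi).
  by rewrite {1}xE NE; move: (@pi R) => p; field.
rewrite cos_periodic; apply: le_trans (cos_ge _).
have /andP[f0 f1] : 0 <= y - N%:~R <= 1.
  have := floor_itv y; rewrite -/N intrD mulr1z => /andP[? ?].
  by rewrite subr_ge0 lerBlDl (ltW (_ : y < N%:~R + 1))// andbT.
set f := y - _ in f0 f1 *.
have f2 : f ^+ 2 <= 1 by rewrite expr_le1.
have p2 : (2 * pi) ^+ 2 <= 64 :> R.
  by have := pi_le4; move: (@pi R) pi0 => p; nra.
have q2 : 0 < q%:R ^+ 2 :> R by rewrite exprn_gt0.
rewrite lerD2l lerN2 ler_pdivlMr// exprMn expr_div_n.
rewrite [leLHS](_ : _ = f ^+ 2 * (2 * pi) ^+ 2 / 2); last first.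
  by move: (@pi R) (q%:R) q0n => p r r0; field.
have : f ^+ 2 * (2 * pi) ^+ 2 <= 1 * 64 by rewrite ler_pM// ?sqr_ge0.
by lra.
Qed.

End elementary_bounds.

Section exponential_moment.
Context {R : realType} {n : nat}.
Local Notation T := (measurableTypeR R).
Local Notation K := {ffun 'I_n -> int}.
Variables (m : 'I_n -> {sigma_finite_measure set T -> \bar R})
  (c : 'I_n -> int -> R).
Hypothesis mc : forall i, trigonometric_moments (m i) (c i).
Variables (I : eqType) (kap : I -> K) (beta : R).
Hypothesis beta0 : 0 <= beta.

Local Notation integ := (integ (tuple_product m)).
Local Notation angdiff := (angdiff kap).
Local Notation rho := (xy_density kap beta).
Local Notation alpha := (exp_coef beta).
Implicit Types (es : seq I) (t : n.-tuple T) (a : R).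

Definition rotation a : R -> K -> R[i] := fun z _ => expi (z * a).

Lemma multiplicative_rotation a : multiplicative_charge (rotation a).
Proof.
split=> [|z z' k k']; first by rewrite /rotation mul0r expi0.
by rewrite /rotation mulrDl expiD.
Qed.

Lemma fval_scale (g : R -> K -> R[i]) w z l t : fval g (fscale w z l) t =
  (w%:C)%C * fval (fun y k => g (z * y) k) l t.
Proof.
rewrite /fval big_map mulr_sumr; apply: eq_bigr => x _ /=.
by rewrite rmorphM /=; ring.
Qed.

Lemma fval_rotation_cos a k t :
  fval (rotation a) (fcos k) t = ((cos (phase k t + a))%:C)%C.
Proof.
rewrite /fval /rotation !big_cons big_nil /= phaseN mul1r mulN1r /expi !cosN !sinN cosD.
apply/eqP; rewrite eq_complex !(cReD, cImD, cReM, cImM) /=; apply/andP.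
by split; apply/eqP; field.
Qed.

Lemma fval_rotation_series a k M t :
  fval (rotation a) (fseries alpha (fun=> 1) k M) t =
  ((\sum_(j < M) alpha j * cos (phase k t + a) ^+ j)%:C)%C.
Proof.
rewrite fval_flatten big_map -[M in iota 0 M]subn0 big_mkord raddf_sum /=.
apply: eq_bigr => j _; rewrite fval_scale.
rewrite (_ : (fun y k => rotation a (1 * y) k) = rotation a); last first.
  by apply/funext => y; apply/funext => k'; rewrite mul1r.
rewrite fval_pow; last exact: multiplicative_rotation.
by rewrite fval_rotation_cos [RHS]rmorphM rmorphXn.
Qed.

(** The difference of the two sides multiplies each mode by [1 - cos (z * a)],
    where [z] is its charge along the edge [e]. *)
Lemma rotation_le es e a :
  integ (fun t => rho es t * ((expR (beta * cos (angdiff e t + a)) +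
                               expR (beta * cos (angdiff e t - a))) / 2)) <=
  integ (rho (e :: es)).
Proof.
pose L M := fmul (fseries alpha (fun=> 1) (kap e) M)
  (fprod [seq fscale 1 0 (fseries alpha (fun=> 1) (kap e') M) | e' <- es]).
have L0 M : fpos (L M).
  apply: fpos_mul; first by apply: fpos_series; exact: exp_coef_ge0.
  apply: fpos_prod; apply/allP => l; rewrite -/(fpos l).
  elim: es {L} => //= e' es IH; rewrite inE => /orP[/eqP ->|/IH//].
  by apply: fpos_scale => //; apply: fpos_series; exact: exp_coef_ge0.
have LR b t : ccvg (fun M => fval (rotation b) (L M) t)
    ((expR (beta * cos (angdiff e t + b)) * rho es t)%:C)%C.
  have mr := multiplicative_rotation b.
  apply: ccvg_eq; first by move=> M; rewrite fval_mul//; reflexivity.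
  rewrite rmorphM; apply: ccvgM.
    apply: ccvg_eq (ccvg_real (@exp_series_cvg _ _ (cos (angdiff e t + b)))) => M.
    by rewrite fval_rotation_series.
  elim: es {L L0} => [|e' es IH].
    by rewrite /xy_density big_nil mulr0 expR0; apply: ccvg_const => M /=;
      rewrite fval_one//; have [] := mr.
  rewrite xy_density_cons rmorphM.
  apply: ccvg_eq; first by move=> M; rewrite /= fval_mul//; reflexivity.
  apply: ccvgM IH.
  apply: ccvg_eq (ccvg_real (@exp_series_cvg _ _ (cos (angdiff e' t)))) => M.
  rewrite fval_scale mul1r -(fval0_series _ (fun=> 1)) /fval; apply: eq_bigr => x _.
  by rewrite /rotation mul0r mul0r expi0.
pose g (z : R) (k : K) := 1 - cos (z * a).
have g0 z k : 0 <= g z k by rewrite subr_ge0 cos_le1.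
pose F t := rho es t * (expR (beta * cos (angdiff e t)) -
  (expR (beta * cos (angdiff e t + a)) + expR (beta * cos (angdiff e t - a))) / 2).
have LF t : ccvg (fun M => fval (cplx g) (L M) t) ((F t)%:C)%C.
  have gE l : fval (cplx g) l t = fval (rotation 0) l t +
     ((- 2^-1)%:C)%C * (fval (rotation a) l t + fval (rotation (- a)) l t).
    rewrite /fval -big_split mulr_sumr -big_split; apply: eq_bigr => x _ /=.
    have -> : cplx g x.1.2 x.2 = rotation 0 x.1.2 x.2 + ((- 2^-1)%:C)%C *
        (rotation a x.1.2 x.2 + rotation (- a) x.1.2 x.2).
      apply/eqP; rewrite /cplx /g /rotation mulr0 mulrN /expi cos0 sin0 cosN sinN.
      rewrite eq_complex !(cReD, cImD, cReM, cImM) /=.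
      by apply/andP; split; apply/eqP; field.
    by ring.
  apply: ccvg_eq; first by move=> M; rewrite gE; reflexivity.
  have -> : ((F t)%:C)%C = ((expR (beta * cos (angdiff e t + 0)) * rho es t)%:C)%C +
      ((- 2^-1)%:C)%C * (((expR (beta * cos (angdiff e t + a)) * rho es t)%:C)%C +
      ((expR (beta * cos (angdiff e t - a)) * rho es t)%:C)%C).
    apply/eqP; rewrite eq_complex !(cReD, cImD, cReM, cImM) /= /F addr0.
    by apply/andP; split; apply/eqP; field.
  apply: ccvgD => //; apply: ccvgM (ccvg_cst _) _; exact: ccvgD.
have F0 : 0 <= integ F := fourier_limit_ge0 mc g0 L0 LF.
have brot b : bounded_measurable (fun t => expR (beta * cos (angdiff e t + b))).
  apply: bm_expR; apply: bmM (bm_cst _) _; apply: bm_cos.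
  by apply: measurable_funD => //; exact: measurable_phase.
have b1 : bounded_measurable (fun t => rho es t *
    ((expR (beta * cos (angdiff e t + a)) + expR (beta * cos (angdiff e t - a))) / 2)).
  by apply: bmM (bm_density _ _ _) _; apply: bmM _ (bm_cst _); exact: bmD.
rewrite -subr_ge0 -(integB (mu_fin mc) (bm_density _ _ _) b1).
apply: le_trans F0 _; apply: (le_integ (mu_fin mc)).
- apply: bmM (bm_density _ _ _) _; apply: bmB.
    by apply: bm_ext (brot 0) => t; rewrite addr0.
  by apply: bmM _ (bm_cst _); exact: bmD.
- exact: bmB (bm_density _ _ _) b1.
by move=> t; rewrite /F xy_density_cons mulrBr [rho es t * expR _]mulrC.
Qed.

(** Average [rotation_le] over the multiples of 2 pi / q, with [q] of order
    sqrt beta: whatever the angle difference, one of them rotates it within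
    distance 1 / sqrt beta of zero, where the weight of the edge is of order
    [expR beta]. *)
Lemma remove_edge_le es e : expR beta * integ (rho es) <=
  2 * expR 32 * (Num.sqrt beta + 1) * integ (rho (e :: es)).
Proof.
pose q := (Num.truncn (Num.sqrt beta)).+1.
have q0 : (0 < q)%N by [].
have sq : Num.sqrt beta <= q%:R by rewrite ltW// truncnS_gt.
have q1 : q%:R <= Num.sqrt beta + 1.
  by rewrite /q -natr1 lerD2r; rewrite truncn_le// sqrtr_ge0.
have q0' : 0 < q%:R :> R by rewrite ltr0n.
have bq : beta <= q%:R ^+ 2.
  by rewrite -[beta]sqr_sqrtr// ler_sqr ?nnegrE ?sqrtr_ge0// ltW.
have integ_rho0 : 0 <= integ (rho (e :: es)) by apply: integ_ge0 => t; exact: expR_ge0.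
pose avg (a : R) t := (expR (beta * cos (angdiff e t + a)) +
                 expR (beta * cos (angdiff e t - a))) / 2.
have bavg a : bounded_measurable (avg a).
  apply: bmM _ (bm_cst _); apply: bmD; apply: bm_expR; apply: bmM (bm_cst _) _;
    apply: bm_cos; apply: measurable_funD => //; exact: measurable_phase.
have ge t : expR (beta - 32) / 2 <= \sum_(i < q) avg (i%:R * (2 * pi / q%:R)) t.
  have [i ci] := cos_near_root (angdiff e t) q0.
  rewrite (bigD1 i)//= ler_wpDr//.
    by apply: sumr_ge0 => j _; rewrite divr_ge0// addr_ge0// expR_ge0.
  rewrite /avg ler_pM2r ?invr_gt0// ler_wpDl ?expR_ge0// ler_expR.
  apply: le_trans (ler_wpM2l beta0 ci).
  rewrite mulrBr mulr1 lerD2l lerN2 mulrCA ler_piMr// ler_pdivrMr ?exprn_gt0//.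
  by rewrite mul1r.
have sumle : \sum_(i < q) integ (fun t => rho es t * avg (i%:R * (2 * pi / q%:R)) t) <=
    q%:R * integ (rho (e :: es)).
  rewrite -[leRHS](_ : \sum_(i < q) integ (rho (e :: es)) = _); last first.
    by rewrite sumr_const card_ord mulr_natl.
  by apply: ler_sum => i _; exact: rotation_le.
have bp i : bounded_measurable (fun t => rho es t * avg (i%:R * (2 * pi / q%:R)) t).
  exact: bmM (bm_density _ _ _) (bavg _).
have : expR (beta - 32) / 2 * integ (rho es) <= q%:R * integ (rho (e :: es)).
  apply: le_trans sumle; rewrite -(integ_sum (mu_fin mc))//.
  rewrite -(integZl (mu_fin mc))//; last exact: bm_density.
  apply: (le_integ (mu_fin mc)).
  - exact: bmM (bm_cst _) (bm_density _ _ _).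
  - by apply: bm_sum => i.
  by move=> t; rewrite -mulr_sumr mulrC ler_wpM2l ?expR_ge0.
rewrite expRB => H.
have {}H : expR beta * integ (rho es) <= 2 * expR 32 * (q%:R * integ (rho (e :: es))).
  rewrite -ler_pdivrMl ?mulr_gt0 ?expR_gt0//; apply: le_trans H.
  by rewrite le_eqVlt; apply/orP; left; apply/eqP; field; rewrite gt_eqF ?expR_gt0.
apply: le_trans H _; by rewrite mulrA ler_wpM2r// ler_wpM2l// mulr_ge0// expR_ge0.
Qed.

Definition moment_bound : R := 2 * expR 32 * (Num.sqrt beta + 1).

(** The exponential factor turns the weight of the edge [e] into the constant
    [expR beta], that is, it removes [e] from the model. *)
Lemma exponential_moment es e : e \in es ->
  integ (fun t => rho es t * expR (beta * (1 - cos (angdiff e t)))) <=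
  moment_bound * integ (rho es).
Proof.
move=> ees.
have rhoE : rho es = rho (e :: rem e es).
  apply/funext => t; rewrite /xy_density; congr (expR (_ * _)).
  exact: perm_big (perm_to_rem ees).
rewrite [in leRHS]rhoE; apply: le_trans (remove_edge_le _ _).
rewrite -(integZl (mu_fin mc)); last exact: bm_density.
apply: (le_integ (mu_fin mc)).
- apply: bmM (bm_density _ _ _) _; apply: bm_expR; apply: bmM (bm_cst _) _.
  exact: bmB (bm_cst _) (bm_cosd _ _).
- exact: bmM (bm_cst _) (bm_density _ _ _).
move=> t; rewrite rhoE xy_density_cons mulrAC -expRD.
by rewrite le_eqVlt; apply/orP; left; apply/eqP; congr (expR _ * _); ring.
Qed.

End exponential_moment.

Import Normc.

(** * The complex exponential as a limit of powers *)

Section complex_exponential.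
Context {R : realType}.
Local Notation Re := complex.Re.
Local Notation Im := complex.Im.

Lemma expR_le_quad (a : R) : a <= 2^-1 -> expR a <= 1 + a + 2 * a ^+ 2.
Proof.
move=> a1; have h : 0 < 1 - a by lra.
have := expR_ge1Dx (- a); rewrite expRN => e1.
have : expR a <= (1 - a)^-1 by rewrite -[expR a]invrK lef_pV2 ?posrE ?invr_gt0 ?expR_gt0.
move=> /le_trans; apply.
rewrite -div1r ler_pdivrMr//; nra.
Qed.

Lemma sin_sub_id (b : R) : `|sin b - b| <= `|b| ^+ 3 / 2.
Proof.
wlog b0 : b / 0 <= b.
  move=> H; have [/H//|/ltW b0] := leP 0 b.
  by have := H (- b); rewrite sinN opprK normrN oppr_ge0 addrC distrC; apply.
have [|c /andP[c0 cb]] := @MVT_segment R (fun x => sin x - x) (fun x => cos x - 1) 0 b b0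
    (fun y _ => is_deriveB (is_derive_sin y) (is_derive_id y 1)).
  apply: continuous_subspaceT => x; apply: cvgB; last exact: cvg_id.
  exact: continuous_sin.
rewrite sin0 !subr0 => ->.
rewrite !bnd_simp in c0 cb.
rewrite normrM (ger0_norm b0) exprS mulrC -mulrA ler_wpM2l//.
rewrite distrC ger0_norm ?subr_ge0 ?cos_le1//.
have := cos_ge c; have : c ^+ 2 <= b ^+ 2 by rewrite ler_sqr.
lra.
Qed.

Lemma normc_le (z : R[i]) : normc z <= `|Re z| + `|Im z|.
Proof.
case: z => x y /=; rewrite -[leRHS]ger0_norm ?addr_ge0// -sqrtr_sqr.
rewrite ler_sqrt ?sqr_ge0// -[x ^+ 2]real_normK ?num_real//.
rewrite -[y ^+ 2]real_normK ?num_real//.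
by have := normr_ge0 x; have := normr_ge0 y; nra.
Qed.

Lemma normc_ge (z : R[i]) : `|Re z| <= normc z /\ `|Im z| <= normc z.
Proof.
case: z => x y /=; split; rewrite -sqrtr_sqr ler_sqrt ?addr_ge0 ?sqr_ge0//.
  by rewrite lerDl sqr_ge0.
by rewrite lerDr sqr_ge0.
Qed.

Lemma normc_real (x : R) : normc (x%:C)%C = `|x|.
Proof. by rewrite /= expr0n addr0 sqrtr_sqr. Qed.

Lemma normc_expi (x : R) : normc (expi x) = 1.
Proof. by rewrite /= cos2Dsin2 sqrtr1. Qed.

Lemma normc_subX (a b : R[i]) (M : R) k : 1 <= M -> normc a <= M -> normc b <= M ->
  normc (a ^+ k - b ^+ k) <= k%:R * normc (a - b) * M ^+ k.
Proof.
move=> M1 aM bM; have n0 (z : R[i]) : 0 <= normc z by case: z => x y; exact: sqrtr_ge0.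
have bX j : normc (b ^+ j) <= M ^+ j.
  elim: j => [|j IH]; first by rewrite !expr0 normc1.
  by rewrite !exprS normcM ler_pM.
elim: k => [|k IH]; first by rewrite !expr0 subrr normc0 !mul0r.
have -> : a ^+ k.+1 - b ^+ k.+1 = a * (a ^+ k - b ^+ k) + (a - b) * b ^+ k.
  by rewrite !exprS; ring.
apply: le_trans (le_normcD _ _) _; rewrite !normcM.
have -> : k.+1%:R * normc (a - b) * M ^+ k.+1 =
    M * (k%:R * normc (a - b) * M ^+ k) + normc (a - b) * M ^+ k.+1.
  by rewrite exprS -natr1; ring.
apply: lerD; first by apply: ler_pM.
apply: ler_wpM2l => //; apply: le_trans (bX k) _.
by rewrite exprS ler_peMl// exprn_ge0// (le_trans ler01).
Qed.

Lemma expi_natmul (y : R) k : expi (y / k.+1%:R) ^+ k.+1 = expi y.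
Proof.
have E j x : expi x ^+ j = expi (j%:R * x) :> R[i].
  elim: j => [|j IH]; first by rewrite mul0r expi0.
  by rewrite exprS IH -expiD -natr1; congr expi; ring.
by rewrite E mulrCA divff ?mulr1// pnatr_eq0.
Qed.

Lemma complex_exp_first_order (a b r : R) : r <= 2^-1 -> `|a| <= r -> `|b| <= r ->
  normc (1 + Complex a b - (expR a)%:C%C * expi b) <= 7 * r ^+ 2.
Proof.
move=> r1 ar br; have r0 : 0 <= r := le_trans (normr_ge0 _) ar.
have a2 : a ^+ 2 <= r ^+ 2 by rewrite -real_normK ?num_real// ler_sqr ?nnegrE.
have b2 : b ^+ 2 <= r ^+ 2 by rewrite -real_normK ?num_real// ler_sqr ?nnegrE.
have ar' := ar; rewrite ler_norml in ar'; case/andP: ar' => aN aP.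
have e1 := expR_ge1Dx a.
have e2 : expR a <= 1 + a + 2 * a ^+ 2 by apply: expR_le_quad; lra.
have e3 : expR a <= 2 by nra.
have c1 := cos_ge b; have c2 := cos_le1 b.
have s1 : `|sin b - b| <= r ^+ 2 / 4.
  apply: le_trans (sin_sub_id b) _; rewrite exprS real_normK ?num_real//.
  have : `|b| * b ^+ 2 <= 2^-1 * r ^+ 2 by rewrite ler_pM ?sqr_ge0//; lra.
  by lra.
apply: le_trans (normc_le _) _; rewrite cReD cImD /= !mul0r !subr0.
have -> : 7 * r ^+ 2 = 3 * r ^+ 2 + 4 * r ^+ 2 by ring.
have e0 := expR_ge0 a.
apply: lerD.
  have h : expR a * (1 - cos b) <= 2 * (b ^+ 2 / 2) by rewrite ler_pM//; lra.
  have h0 : 0 <= expR a * (1 - cos b) by rewrite mulr_ge0//; lra.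
  have -> : 1 + a - expR a * cos b = (1 + a - expR a) + expR a * (1 - cos b) by ring.
  by rewrite ler_norml; apply/andP; split; lra.
rewrite add0r addr0 -normrN opprB.
have -> : expR a * sin b - b = expR a * (sin b - b) + (expR a - 1) * b by ring.
apply: le_trans (ler_normD _ _) _; rewrite !normrM (ger0_norm e0).
have h1 : expR a * `|sin b - b| <= 2 * (r ^+ 2 / 4) by rewrite ler_pM.
have h2 : `|expR a - 1| <= 2 * r by rewrite ler_norml; apply/andP; split; nra.
have h3 : `|expR a - 1| * `|b| <= (2 * r) * r by rewrite ler_pM.
by nra.
Qed.

(** This form of the exponential suits formal Fourier polynomials, since powers
    keep their weights nonnegative. *)
Lemma complex_exp_limit (x y : R) :
  ccvg (fun k => (1 + (k.+1%:R^-1)%:C%C * Complex x y) ^+ k.+1)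
       ((expR x)%:C%C * expi y).
Proof.
pose B := `|x| + `|y|.
have B0 : 0 <= B by rewrite addr_ge0.
pose u k := (1 + (k.+1%:R^-1)%:C%C * Complex x y) ^+ k.+1 : R[i].
pose C := 7 * B ^+ 2 * expR B.
have uE : \forall k \near \oo, normc (u k - (expR x)%:C%C * expi y) <= C * k.+1%:R^-1.
  have [N _ HN] : \forall k \near \oo, 2 * B <= k%:R :> R by exact: nbhs_infty_ger.
  exists N => // k /HN /= Bk.
  have k0 : 0 < k.+1%:R :> R by rewrite ltr0n.
  have r0 : B / k.+1%:R <= 2^-1.
    by rewrite ler_pdivrMr// -[k.+1%:R]natr1; lra.
  have -> : (expR x)%:C%C * expi y =
      ((expR (x / k.+1%:R))%:C%C * expi (y / k.+1%:R)) ^+ k.+1.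
    rewrite exprMn expi_natmul -rmorphXn /= -expRM_natl mulrCA divff ?mulr1//.
  rewrite /u.
  have -> : (k.+1%:R^-1)%:C%C * Complex x y = Complex (x / k.+1%:R) (y / k.+1%:R) :> R[i].
    apply/eqP; rewrite eq_complex cReM cImM /=.
    by apply/andP; split; apply/eqP; ring.
  have xr : `|x / k.+1%:R| <= B / k.+1%:R.
    by rewrite normrM normfV (gtr0_norm k0) ler_pM2r ?invr_gt0// lerDl.
  have yr : `|y / k.+1%:R| <= B / k.+1%:R.
    by rewrite normrM normfV (gtr0_norm k0) ler_pM2r ?invr_gt0// lerDr.
  have M1 : 1 <= expR (B / k.+1%:R).
    by apply: le_trans (expR_ge1Dx _); rewrite lerDl divr_ge0// ltW.
  apply: le_trans (normc_subX _ M1 _ _) _.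
  - apply: le_trans (le_normcD _ _) _; rewrite normc1.
    apply: le_trans _ (expR_ge1Dx _); rewrite lerD2l.
    apply: le_trans (normc_le _) _ => /=.
    by rewrite !normrM normfV (gtr0_norm k0) -mulrDl.
  - rewrite normcM normc_expi mulr1 normc_real ger0_norm ?expR_ge0// ler_expR.
    exact: le_trans (ler_norm _) xr.
  rewrite -expRM_natl mulrCA divff ?mulr1 ?gt_eqF//.
  rewrite /C [leRHS]mulrAC ler_wpM2r ?expR_ge0//.
  rewrite [leRHS](_ : _ = k.+1%:R * (7 * (B / k.+1%:R) ^+ 2)); last first.
    by rewrite expr_div_n; field; rewrite gt_eqF.
  by apply: ler_wpM2l; [exact: ltW|exact: complex_exp_first_order].
have C0 : C * k.+1%:R^-1 @[k --> \oo] --> 0.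
  by rewrite -[X in _ --> X](mulr0 C); apply: cvgM; [exact: cvg_cst|exact: cvg_harmonic].
split; apply/cvgrPdist_le => e e0; move/cvgrPdist_le : C0 => /(_ e e0);
  apply: filterS2 uE => k; rewrite sub0r normrN => uk Ck.
- rewrite distrC; have [h _] := normc_ge (u k - (expR x)%:C%C * expi y).
  move: h; rewrite cReD; case: ((expR x)%:C%C * expi y) uk => a b uk /= h.
  by apply: le_trans h _; apply: le_trans uk _; apply: le_trans _ Ck; exact: ler_norm.
- rewrite distrC; have [_ h] := normc_ge (u k - (expR x)%:C%C * expi y).
  move: h; rewrite cImD; case: ((expR x)%:C%C * expi y) uk => a b uk /= h.
  by apply: le_trans h _; apply: le_trans uk _; apply: le_trans _ Ck; exact: ler_norm.
Qed.

End complex_exponential.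

(** * Complex shift of the angles *)

Section complex_shift.
Context {R : realType} {n : nat}.
Local Notation T := (measurableTypeR R).
Local Notation K := {ffun 'I_n -> int}.
Local Notation Re := complex.Re.
Variables (m : 'I_n -> {sigma_finite_measure set T -> \bar R})
  (c : 'I_n -> int -> R).
Hypothesis mc : forall i, trigonometric_moments (m i) (c i).
Variables (I : Type) (kap : I -> K) (beta : R).
Hypothesis beta0 : 0 <= beta.

Local Notation integ := (integ (tuple_product m)).
Local Notation angdiff := (angdiff kap).
Local Notation rho := (xy_density kap beta).
Implicit Types (es : seq I) (t : n.-tuple T) (psi : 'I_n -> R).

Definition gradient psi (k : K) : R := \sum_(i < n) (k i)%:~R * psi i.

(** The factor that the mode [k] receives when each angle moves by i times
    [psi]. *)
Definition shift_charge psi (z : R) (k : K) : R := expR (- gradient psi k).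

Lemma gradientD psi k k' : gradient psi (k + k') = gradient psi k + gradient psi k'.
Proof.
by rewrite /gradient -big_split; apply: eq_bigr => i _; rewrite ffunE intrD mulrDl.
Qed.

Lemma gradientN psi k : gradient psi (- k) = - gradient psi k.
Proof.
by rewrite /gradient -sumrN; apply: eq_bigr => i _; rewrite ffunE intrN mulNr.
Qed.

Lemma multiplicative_shift psi : multiplicative_charge (cplx (shift_charge psi)).
Proof.
split=> [|z z' k k']; rewrite /cplx /shift_charge.
  by rewrite /gradient big1 ?oppr0 ?expR0// => i _; rewrite ffunE mul0r.
by rewrite gradientD opprD expRD rmorphM.
Qed.

Definition coshr (x : R) := (expR x + expR (- x)) / 2.
Definition sinhr (x : R) := (expR x - expR (- x)) / 2.

Lemma fval_shift_cos psi k t : fval (cplx (shift_charge psi)) (fcos k) t =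
  Complex (coshr (gradient psi k) * cos (phase k t))
          (- (sinhr (gradient psi k) * sin (phase k t))).
Proof.
rewrite /fval /cplx /shift_charge !big_cons big_nil /= phaseN gradientN opprK.
rewrite /expi cosN sinN /coshr /sinhr.
apply/eqP; rewrite eq_complex !(cReD, cImD, cReM, cImM) /=; apply/andP.
by split; apply/eqP; field.
Qed.

Definition shifted_energy psi es t :=
  \sum_(e <- es) beta * coshr (gradient psi (kap e)) * cos (angdiff e t).
Definition shifted_phase psi es t :=
  \sum_(e <- es) beta * sinhr (gradient psi (kap e)) * sin (angdiff e t).

Let factor (M : nat) (k : K) : fpoly R n :=
  fpow ((1, 0, 0) :: fscale (M.+1%:R^-1 * beta) 1 (fcos k)) M.+1.
Let approx es M := fprod [seq factor M (kap e) | e <- es].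

Let approx_pos es M : fpos (approx es M).
Proof.
apply: fpos_prod; apply/allP => l.
elim: es => //= e es IH; rewrite inE => /orP[/eqP ->|/IH//].
apply: fpos_pow; rewrite /fpos /= ler01 /=.
by rewrite !mulr_ge0 ?invr_ge0 ?ler0n.
Qed.

Let approx_cvg psi es t : ccvg (fun M => fval (cplx (shift_charge psi)) (approx es M) t)
  ((expR (shifted_energy psi es t))%:C%C * expi (- shifted_phase psi es t)).
Proof.
have gM := multiplicative_shift psi.
elim: es => [|e es IH].
  rewrite /shifted_energy /shifted_phase !big_nil oppr0 expR0 expi0 mulr1.
  by apply: ccvg_const => M; rewrite /approx /= fval_one//; have [] := gM.
pose a := beta * coshr (gradient psi (kap e)) * cos (angdiff e t).
pose b := beta * sinhr (gradient psi (kap e)) * sin (angdiff e t).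
have -> : (expR (shifted_energy psi (e :: es) t))%:C%C *
    expi (- shifted_phase psi (e :: es) t) = ((expR a)%:C%C * expi (- b)) *
    ((expR (shifted_energy psi es t))%:C%C * expi (- shifted_phase psi es t)).
  rewrite {1}/shifted_energy {1}/shifted_phase !big_cons opprD expRD expiD.
  by rewrite [X in X * _ = _]rmorphM /=; ring.
apply: ccvg_eq; first by move=> M; rewrite /approx /= fval_mul//; reflexivity.
apply: ccvgM IH; apply: ccvg_eq (complex_exp_limit a (- b)) => M.
rewrite /factor fval_pow//; congr (_ ^+ _).
rewrite fval_cons fval_scale (_ : (fun y k => _) = cplx (shift_charge psi)); last first.
  by apply/funext => y; apply/funext => k; rewrite mul1r.
rewrite /=; have [g1 _] := gM; rewrite g1 phase0 expi0 !mulr1; congr (_ + _).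
rewrite fval_shift_cos rmorphM -mulrA; congr (_ * _).
apply/eqP; rewrite eq_complex cReM cImM /= /a /b /angdiff.
by apply/andP; split; apply/eqP; ring.
Qed.

(** A mode with nonzero mean only involves sites where [psi] vanishes, hence it
    does not feel the shift of the angles by i times [psi]. *)
Lemma complex_shift psi es :
  (forall i k, psi i != 0 -> k != 0 -> c i k = 0) ->
  integ (fun t => expR (shifted_energy psi es t) * cos (shifted_phase psi es t)) =
    integ (rho es) /\
  integ (fun t => expR (shifted_energy psi es t) * sin (shifted_phase psi es t)) = 0.
Proof.
move=> psic.
have gge psi' : forall z k, 0 <= shift_charge psi' z k by move=> *; exact: expR_ge0.
have [b1 b2 c1 c2] := fourier_limit mc (gge psi) (approx_pos es) (approx_cvg psi es).
have [_ _ d1 _] := fourier_limit mc (gge (fun=> 0)) (approx_pos es) (approx_cvg (fun=> 0) es).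
split.
- have E : integ (fun t => expR (shifted_energy psi es t) * cos (shifted_phase psi es t)) =
     integ (fun t => Re ((expR (shifted_energy psi es t))%:C%C * expi (- shifted_phase psi es t))).
    by congr integ; apply/funext => t; rewrite cReM /= cosN mul0r subr0.
  have E' : integ (rho es) =
     integ (fun t => Re ((expR (shifted_energy (fun=> 0) es t))%:C%C *
        expi (- shifted_phase (fun=> 0) es t))).
    congr integ; apply/funext => t; rewrite cReM /= cosN mul0r subr0.
    have g0 k : gradient (fun=> 0) k = 0 by rewrite /gradient big1// => i _; rewrite mulr0.
    rewrite /shifted_phase big1 => [|e _]; last by rewrite g0 /sinhr oppr0 subrr !(mul0r, mulr0).
    rewrite cos0 mulr1 /xy_density mulr_sumr; congr expR; apply: eq_bigr => e _.
    rewrite g0 /coshr oppr0 expR0.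
    have -> : (1 + 1) / 2 = 1 :> R by field.
    by rewrite mulr1.
  rewrite E E'; apply: (cvg_unique _ c1); first exact: Rhausdorff.
  apply: cvg_trans d1; apply: near_eq_cvg; apply: nearW => M.
  rewrite !(integ_Re_fval mc); apply: eq_bigr => x _.
  have [->|k0] := eqVneq (fcoef c x.2) 0; first by rewrite !mulr0.
  rewrite /shift_charge; congr (_ * expR (- _) * _).
  apply: eq_bigr => i _; rewrite mulr0; apply/esym/eqP; rewrite mulf_eq0 intr_eq0.
  apply/negPn/negP; rewrite negb_or => /andP[ki pi]; move/negP: k0; apply.
  by rewrite /fcoef (bigD1 i)//= (psic _ _ pi ki) mul0r.
- apply/eqP; rewrite -oppr_eq0; apply/eqP; rewrite -[RHS]c2 -mulN1r.
  have bs : bounded_measurable (fun t =>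
      expR (shifted_energy psi es t) * sin (shifted_phase psi es t)).
    apply: bm_ext (bmN b2) => t.
    by rewrite cImM /= sinN mul0r addr0 mulrN opprK.
  rewrite -(integZl (mu_fin mc))//; congr integ; apply/funext => t.
  by rewrite cImM /= sinN mul0r addr0 mulN1r mulrN.
Qed.

End complex_shift.

(** * Charlier polynomials *)

Section charlier.
Context {R : realType}.
Variable beta : R.
Hypothesis beta0 : 0 < beta.
Local Notation alpha := (exp_coef beta).

(** Charlier polynomials: exp_coef k * charlier j k is the k-th coefficient of
    (1 - y) ^+ j * expR (beta * y). *)
Fixpoint charlier (j k : nat) : R :=
  match j with
  | 0 => 1
  | j'.+1 => charlier j' k - k%:R / beta * charlier j' k.-1
  end.

Lemma charlier_series_cvg j (y : R) :
  \sum_(k < M) alpha k * charlier j k * y ^+ k @[M --> \oo] -->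
  expR (beta * y) * (1 - y) ^+ j.
Proof.
elim: j => [|j IH].
  rewrite expr0 mulr1; under eq_fun do under eq_bigr do rewrite mulr1.
  exact: exp_series_cvg.
rewrite -cvg_shiftS; have -> : expR (beta * y) * (1 - y) ^+ j.+1 =
  expR (beta * y) * (1 - y) ^+ j - y * (expR (beta * y) * (1 - y) ^+ j).
  by rewrite exprS; ring.
rewrite [X in X @ _](_ : _ = fun M => \sum_(k < M.+1) alpha k * charlier j k * y ^+ k -
   y * \sum_(k < M) alpha k * charlier j k * y ^+ k); last first.
  apply/funext => M; rewrite mulr_sumr [LHS]big_ord_recl [X in X - _]big_ord_recl /=.
  rewrite mul0r mul0r subr0 -addrA -sumrB; congr (_ + _); apply: eq_bigr => k _ /=.
  rewrite mulrBr mulrBl; congr (_ - _).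
  have := exp_coefS beta k; rewrite exprS => E.
  have -> : alpha k.+1 * (k.+1%:R / beta * charlier j k) =
      alpha k.+1 * k.+1%:R / beta * charlier j k by ring.
  by rewrite E [beta * _]mulrC mulfK ?gt_eqF//; ring.
apply: cvgB; first by move: IH; rewrite -cvg_shiftS.
by apply: cvgM => //; exact: cvg_cst.
Qed.

Lemma charlier_step j k :
  charlier j.+1 k - charlier j.+1 k.+1 = j.+1%:R / beta * charlier j k.
Proof.
elim: j k => [|j IH] k; first by rewrite /= -natr1; ring.
have E i : charlier i.+1 k.+1 = charlier i k.+1 - k.+1%:R / beta * charlier i k by [].
rewrite [charlier j.+2 k.+1]E.
have -> : charlier j.+2 k = charlier j.+1 k - k%:R / beta * charlier j.+1 k.-1 by [].
have F : charlier j.+1 k = charlier j k - k%:R / beta * charlier j k.-1 by [].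
have G : k%:R * (charlier j.+1 k.-1 - charlier j.+1 k) =
    k%:R * (j.+1%:R / beta * charlier j k.-1).
  by case: k {E F} => [|k]; [rewrite !mul0r|rewrite IH].
have -> : charlier j.+1 k - k%:R / beta * charlier j.+1 k.-1 -
     (charlier j.+1 k.+1 - k.+1%:R / beta * charlier j.+1 k) =
   (charlier j.+1 k - charlier j.+1 k.+1) -
   beta^-1 * (k%:R * (charlier j.+1 k.-1 - charlier j.+1 k)) + beta^-1 * charlier j.+1 k.
  by rewrite -[k.+1%:R]natr1; ring.
rewrite IH G (_ : _ - _ = j.+1%:R / beta * charlier j.+1 k); last by rewrite F; ring.
by rewrite -[j.+2%:R]natr1; ring.
Qed.

Lemma charlier_bound j k : `|charlier j k| <= (1 + k%:R / beta) ^+ j.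
Proof.
have k0 (i : nat) : 0 <= i%:R / beta :> R by rewrite divr_ge0// ltW.
elim: j k => [|j IH] k; first by rewrite expr0 normr1.
rewrite /= exprS mulrDl mul1r; apply: le_trans (ler_normB _ _) _.
rewrite lerD// normrM ger0_norm// ler_wpM2l//; apply: le_trans (IH _) _.
by rewrite lerXn2r ?nnegrE ?addr_ge0// lerD2l ler_pM2r ?invr_gt0// ler_nat leq_pred.
Qed.

(** The boundary term of the summation by parts in [charlier_norm_cvg]. *)
Lemma exp_coef_charlier_cvg0 i j :
  alpha M * charlier i M * charlier j M @[M --> \oo] --> 0.
Proof.
pose p := (i + j)%N.
have bd k : `|alpha k * charlier i k * charlier j k| <=
    p.+1`!%:R * expR 1 * exp_coeff (beta * expR (beta^-1)) k.
  rewrite normrM [X in X * _]normrM -mulrA (ger0_norm (exp_coef_ge0 (ltW beta0) k)).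
  have x1 : 1 <= 1 + k%:R / beta by rewrite lerDl divr_ge0// ltW.
  have x0 : 0 <= 1 + k%:R / beta := le_trans ler01 x1.
  have h : `|charlier i k| * `|charlier j k| <= p.+1`!%:R * expR (1 + k%:R / beta).
    apply: (@le_trans _ _ ((1 + k%:R / beta) ^+ p)).
      by rewrite exprD ler_pM// charlier_bound.
    apply: (@le_trans _ _ ((1 + k%:R / beta) ^+ p.+1)).
      by rewrite exprS ler_peMl// exprn_ge0.
    rewrite -ler_pdivrMl ?ltr0n ?fact_gt0// mulrC.
    by apply: le_trans (expR_ge1Dxn p x0); rewrite lerDr.
  apply: le_trans (ler_wpM2l (exp_coef_ge0 (ltW beta0) k) h) _.
  rewrite /exp_coef /exp_coeff /= exprMn -expRM_natl expRD.
  by rewrite le_eqVlt; apply/orP; left; apply/eqP; ring.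
have c0 : p.+1`!%:R * expR 1 * exp_coeff (beta * expR (beta^-1)) k @[k --> \oo] --> (0 : R).
  rewrite -(mulr0 (p.+1`!%:R * expR 1)); apply: cvgM; first exact: cvg_cst.
  by apply: cvg_series_cvg_0; exact: is_cvg_series_exp_coeff.
apply/cvgrPdist_le => e e0; move/cvgrPdist_le : c0 => /(_ e e0).
apply: filterS => k; rewrite !sub0r !normrN => H.
by apply: le_trans (bd k) _; apply: le_trans H; exact: ler_norm.
Qed.

(** The squared norm for Poisson weights. By [charlier_step], summation by parts
    lowers the degree [j]. *)
Lemma charlier_norm_cvg j : \sum_(k < M) alpha k * charlier j k ^+ 2 @[M --> \oo] -->
  expR beta * (j`!%:R / beta ^+ j).
Proof.
elim: j => [|j IH].
  have := @exp_series_cvg R beta 1; rewrite mulr1 expr0 divr1 mulr1.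
  apply: cvg_trans; apply: near_eq_cvg.
  by apply: nearW => M; apply: eq_bigr => k _; rewrite /= !expr1n.
rewrite -cvg_shiftS.
rewrite [X in X @ _](_ : _ = fun M => j.+1%:R / beta *
   (\sum_(k < M) alpha k * charlier j k ^+ 2) +
   alpha M * charlier j M * charlier j.+1 M); last first.
  apply/funext => M; rewrite mulr_sumr.
  have -> : \sum_(k < M) j.+1%:R / beta * (alpha k * charlier j k ^+ 2) =
     \sum_(k < M) alpha k * charlier j k * charlier j.+1 k -
     \sum_(k < M) alpha k * charlier j k * charlier j.+1 k.+1.
    rewrite -sumrB; apply: eq_bigr => k _.
    by rewrite -mulrBr charlier_step; ring.
  rewrite addrAC.
  have <- : \sum_(k < M.+1) alpha k * charlier j k * charlier j.+1 k =
      \sum_(k < M) alpha k * charlier j k * charlier j.+1 k +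
      alpha M * charlier j M * charlier j.+1 M by rewrite big_ord_recr.
  transitivity (\sum_(k < M.+1) (alpha k * charlier j k * charlier j.+1 k -
      alpha k * (k%:R / beta * charlier j k.-1) * charlier j.+1 k)).
    by apply: eq_bigr => k _; rewrite expr2 {1}/charlier -/charlier; ring.
  rewrite sumrB; congr (_ - _).
  rewrite big_ord_recl /= !mul0r mulr0 mul0r add0r; apply: eq_bigr => k _ /=.
  have := exp_coefS beta k => E.
  have -> : alpha k.+1 * (k.+1%:R / beta * charlier j k) =
      alpha k.+1 * k.+1%:R / beta * charlier j k by ring.
  by rewrite E [beta * _]mulrC mulfK ?gt_eqF.
have -> : expR beta * (j.+1`!%:R / beta ^+ j.+1) =
    j.+1%:R / beta * (expR beta * (j`!%:R / beta ^+ j)) + 0.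
  by rewrite factS natrM exprS invfM; ring.
apply: cvgD; last exact: exp_coef_charlier_cvg0.
by apply: cvgM => //; exact: cvg_cst.
Qed.

Lemma charlier_norm_le j (M : nat) :
  \sum_(k < M) alpha k * charlier j k ^+ 2 <= expR beta * (j`!%:R / beta ^+ j).
Proof.
rewrite -(cvg_lim _ (@charlier_norm_cvg j))//.
apply: (nondecreasing_cvgn_le _ (cvgP _ (@charlier_norm_cvg j))).
apply/nondecreasing_seqP => k; rewrite big_ord_recr /= lerDl.
by rewrite mulr_ge0 ?exp_coef_ge0 ?sqr_ge0// ltW.
Qed.

(** The charges under which [charge1] multiplies the weight of an edge by
    [sin x * (1 - cos x) ^+ j] (see [charlier_shift_cvg]). *)
Definition charlier_shift j (k : nat) : R :=
  if k is k'.+1 then charlier j k' / beta else 0.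

Lemma charlier_shift_cvg j x :
  (\sum_(k < M) alpha k * charlier_shift j k * (k%:R * cos x ^+ k.-1)) * sin x
     @[M --> \oo] --> expR (beta * cos x) * (sin x * (1 - cos x) ^+ j).
Proof.
rewrite -cvg_shiftS mulrCA mulrC; apply: cvgM; last exact: cvg_cst.
have := @charlier_series_cvg j (cos x).
apply: cvg_trans; apply: near_eq_cvg; apply: nearW => M.
rewrite big_ord_recl /= !mulr0 mul0r add0r; apply: eq_bigr => k _ /=.
have E := exp_coefS beta k.
have -> : alpha k.+1 * (charlier j k / beta) * (k.+1%:R * cos x ^+ k) =
      alpha k.+1 * k.+1%:R / beta * (charlier j k * cos x ^+ k) by ring.
by rewrite E [beta * _]mulrC mulfK ?gt_eqF// mulrA.
Qed.

Lemma charlier_shift_le j (M : nat) :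
  \sum_(k < M) alpha k * charlier_shift j k ^+ 2 * k%:R <=
  beta^-1 * (expR beta * (j`!%:R / beta ^+ j)).
Proof.
case: M => [|M].
  by rewrite big_ord0 !mulr_ge0 ?invr_ge0 ?exprn_ge0 ?expR_ge0// ltW.
rewrite big_ord_recl /= mulr0 add0r.
apply: le_trans (ler_wpM2l _ (charlier_norm_le j M)); last by rewrite invr_ge0 ltW.
rewrite mulr_sumr le_eqVlt; apply/orP; left; apply/eqP; apply: eq_bigr => k _ /=.
have E := exp_coefS beta k; rewrite /bump /=.
have -> : alpha k.+1 * (charlier j k / beta) ^+ 2 * k.+1%:R =
      alpha k.+1 * k.+1%:R * (charlier j k / beta) ^+ 2 by ring.
by rewrite E; field; rewrite gt_eqF.
Qed.

End charlier.

(** * Expansion of an angle in powers of its versine *)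

Section angle_expansion.
Context {R : realType}.
Implicit Types x : R.

(** Coefficients of the expansion x = sin x * \sum_j c_j (1 - cos x) ^+ j,
    that is c_j = j! / (2 j + 1)!!. *)
Fixpoint angle_coef (j : nat) : R :=
  if j is j'.+1 then angle_coef j' * (j'.+1%:R / (2 * j'.+1%:R + 1)) else 1.

Definition angle_poly (M : nat) x : R :=
  sin x * \sum_(j < M.+1) angle_coef j * (1 - cos x) ^+ j.

Lemma angle_coef_ge0 j : 0 <= angle_coef j.
Proof. by elim: j => //= j IH; rewrite mulr_ge0// divr_ge0// addr_ge0// mulr_ge0. Qed.

Lemma angle_coef_le j : angle_coef j <= 2^-1 ^+ j.
Proof.
elim: j => [|j IH]; first by rewrite expr0.
rewrite /= exprSr ler_pM ?angle_coef_ge0 ?divr_ge0 ?addr_ge0 ?mulr_ge0//.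
have j0 : 0 <= j.+1%:R :> R by [].
by rewrite ler_pdivrMr; lra.
Qed.

Lemma is_derive_angle_term j x : is_derive x (1 : R)
  (fun x => sin x * (1 - cos x) ^+ j)
  ((2 * j%:R + 1) * (1 - cos x) ^+ j - j.+1%:R * (1 - cos x) ^+ j.+1).
Proof.
have dv : is_derive x (1 : R) (fun x : R => 1 - cos x) (sin x).
  have := is_deriveB (is_derive_cst (1 : R) x 1) (is_derive_cos x).
  by rewrite sub0r opprK.
have dX := is_deriveX j dv.
rewrite (_ : (fun x => _) = sin * (fun x : R => 1 - cos x) ^+ j); last first.
  by apply/funext => y; rewrite mulrfctE exprfctE.
have dM := is_deriveM (is_derive_sin x) dX.
apply: (is_derive_eq dM); rewrite exprfctE /GRing.scale /=.
have s2 : sin x * sin x = (1 - cos x) * (1 + cos x).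
  by rewrite -expr2 sin2cos2; ring.
case: j {dX dM} => [|j] /=; first by rewrite !expr0; ring.
have -> : sin x * (j.+1%:R * (1 - cos x) ^+ j * sin x) =
    j.+1%:R * (1 - cos x) ^+ j * (sin x * sin x) by ring.
by rewrite s2 !exprS -[j.+2%:R]natr1; ring.
Qed.

Lemma is_derive_angle_poly M x : is_derive x (1 : R) (angle_poly M)
  (1 - M.+1%:R * angle_coef M * (1 - cos x) ^+ M.+1).
Proof.
elim: M => [|M IH].
  have := is_derive_angle_term 0 x.
  rewrite (_ : angle_poly 0 = fun x => sin x * (1 - cos x) ^+ 0); last first.
    by apply/funext => y; rewrite /angle_poly big_ord1 mul1r.
  by move=> /is_derive_eq; apply; rewrite /= expr0; ring.
have dz := is_deriveZ (angle_coef M.+1) (is_derive_angle_term M.+1 x).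
rewrite (_ : angle_poly M.+1 = angle_poly M +
    angle_coef M.+1 *: (fun x => sin x * (1 - cos x) ^+ M.+1)); last first.
  apply/funext => y; rewrite /angle_poly big_ord_recr /= mulrDr addrfctE scalrfctE.
  by rewrite /GRing.scale /=; ring.
apply: (is_derive_eq (is_deriveD IH dz)); rewrite /GRing.scale /=.
have h0 : 2 * M.+1%:R + 1 != 0 :> R by rewrite gt_eqF// ltr_pwDr.
rewrite -[M.+2%:R]natr1; move: (M.+1%:R : R) h0 => a h0.
set v := 1 - cos x; rewrite [v ^+ M.+2]exprS; move: (v ^+ M.+1) => w.
by field.
Qed.

(** The derivative of the error is a multiple of a single power of the versine,
    which is monotone on [0, pi]; the mean value theorem and [angle_coef_le]
    conclude. *)
Lemma angle_poly_error M x : - pi <= x <= pi ->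
  `|x - angle_poly M x| <= 2 * pi * M.+1%:R * ((1 - cos x) / 2) ^+ M.+1.
Proof.
wlog x0 : x / 0 <= x.
  move=> H /andP[xN xP]; have [x0|/ltW x0] := leP 0 x; first by apply: H; rewrite ?x0 ?xN.
  have := H (- x); rewrite cosN oppr_ge0 => /(_ x0).
  rewrite /angle_poly sinN cosN mulNr -opprD normrN; apply.
  by rewrite lerN2 xP lerNl xN.
move=> /andP[_ xpi].
pose F y := y - angle_poly M y.
pose f (y : R) := M.+1%:R * angle_coef M * (1 - cos y) ^+ M.+1.
have dF y : is_derive y (1 : R) F (f y).
  apply: (is_derive_eq (is_deriveB (is_derive_id y 1) (is_derive_angle_poly M y))).
  by rewrite /f; ring.
have [|c cx] := @MVT_segment R F f 0 x x0 (fun y _ => dF y).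
  apply: continuous_subspaceT => y.
  by apply/differentiable_continuous/derivable1_diffP; have [] := dF y.
rewrite {1 2}/F /angle_poly sin0 mul0r !subr0 -/(angle_poly M x) => ->.
move: cx; rewrite in_itv /= => /andP[c0 cx].
have v0 (y : R) : 0 <= 1 - cos y by rewrite subr_ge0 cos_le1.
have vc : 1 - cos c <= 1 - cos x.
  rewrite lerD2l lerN2; move: cx; rewrite le_eqVlt => /predU1P[->//|cx].
  by apply/ltW; rewrite ltr_cos// in_itv/= ?c0 ?x0 ?xpi// (le_trans (ltW cx)).
rewrite /f ger0_norm ?mulr_ge0 ?exprn_ge0 ?angle_coef_ge0//.
have hM : angle_coef M * (1 - cos c) ^+ M.+1 <= 2 * ((1 - cos x) / 2) ^+ M.+1.
  apply: (@le_trans _ _ (2^-1 ^+ M * (1 - cos x) ^+ M.+1)).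
    by rewrite ler_pM ?angle_coef_ge0 ?exprn_ge0 ?angle_coef_le// lerXn2r ?nnegrE.
  rewrite exprMn [2^-1 ^+ M.+1]exprS le_eqVlt; apply/orP; left; apply/eqP.
  by move: (_ ^+ M.+1) (2^-1 ^+ M) => a b; field.
rewrite (_ : _ * x = x * (M.+1%:R * (angle_coef M * (1 - cos c) ^+ M.+1))); last by ring.
have -> : 2 * pi * M.+1%:R * ((1 - cos x) / 2) ^+ M.+1 =
   pi * (M.+1%:R * (2 * ((1 - cos x) / 2) ^+ M.+1)) by ring.
apply: ler_pM => //; last by apply: ler_wpM2l.
by rewrite !mulr_ge0 ?exprn_ge0 ?angle_coef_ge0.
Qed.

(** From [w <= expR (w - 1)]. The exponential is integrable with the help of
    [exponential_moment] as long as [k <= 2 * beta], and the prefactor is the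
    gain. *)
Lemma half_versine_pow (x : R) k : ((1 - cos x) / 2) ^+ k <=
  expR (- k%:R) * expR (k%:R * ((1 - cos x) / 2)).
Proof.
set w := (1 - cos x) / 2.
have w0 : 0 <= w by rewrite divr_ge0// subr_ge0 cos_le1.
rewrite -expRD (_ : - k%:R + k%:R * w = k%:R * (w - 1)); last by ring.
rewrite expRM_natl lerXn2r ?nnegrE ?expR_ge0//.
by apply: le_trans (expR_ge1Dx _); rewrite addrC subrK.
Qed.

End angle_expansion.

(** * Lipschitz, hyperbolic and convexity bounds *)

Section hyperbolic_bounds.
Context {R : realType}.
Implicit Types x : R.

Lemma cos_lipschitz (a b : R) : `|cos a - cos b| <= `|a - b|.
Proof.
pose m := (a + b) / 2; pose h := (a - b) / 2.
have -> : cos a = cos (m + h) by congr cos; rewrite /m /h; field.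
have -> : cos b = cos (m - h) by congr cos; rewrite /m /h; field.
have -> : a - b = 2 * h by rewrite /h; field.
rewrite cosD cosB (_ : _ - _ = - (2 * (sin m * sin h))); last by ring.
rewrite normrN 3!normrM; apply: ler_wpM2l => //.
rewrite -[leRHS]mul1r; apply: ler_pM => //; first exact: sin_max.
exact: ler_norm_sin.
Qed.

Lemma sin_lipschitz (a b : R) : `|sin a - sin b| <= `|a - b|.
Proof.
rewrite -(cosBpihalf a) -(cosBpihalf b); apply: le_trans (cos_lipschitz _ _) _.
by rewrite opprB addrA subrK lexx.
Qed.

Lemma coshr_ge1 x : 1 <= coshr x.
Proof.
have := expR_ge1Dx x; have := expR_ge1Dx (- x).
by rewrite /coshr ler_pdivlMr//; lra.
Qed.

Lemma coshr_le x : `|x| <= 2^-1 -> coshr x - 1 <= 2 * x ^+ 2.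
Proof.
rewrite ler_norml => /andP[x1 x2]; rewrite /coshr.
have h1 : expR x <= 1 + x + 2 * x ^+ 2 by apply: expR_le_quad.
have h2 : expR (- x) <= 1 + - x + 2 * (- x) ^+ 2 by apply: expR_le_quad; lra.
by rewrite sqrrN in h2; lra.
Qed.

Lemma is_derive_expRN x : is_derive x (1 : R) (fun y : R => expR (- y)) (- expR (- x)).
Proof.
have dN : is_derive x (1 : R) (fun y : R => - y) (- 1).
  exact: is_deriveN.
have := @is_derive1_comp _ expR (fun y : R => - y) _ _ _ (is_derive_expR (- x)) dN.
by rewrite mulrN1.
Qed.

Lemma is_derive_sinhr x : is_derive x (1 : R) sinhr (coshr x).
Proof.
have := is_deriveZ 2^-1 (is_deriveB (is_derive_expR x) (is_derive_expRN x)).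
rewrite (_ : 2^-1 \*: _ = sinhr); last first.
  by apply/funext => y; rewrite /= /sinhr /GRing.scale /= mulrC.
move=> H; apply: (is_derive_eq H).
by rewrite /coshr opprK /GRing.scale /= mulrC.
Qed.

Lemma is_derive_coshr x : is_derive x (1 : R) coshr (sinhr x).
Proof.
have := is_deriveZ 2^-1 (is_deriveD (is_derive_expR x) (is_derive_expRN x)).
rewrite (_ : 2^-1 \*: _ = coshr); last first.
  by apply/funext => y; rewrite /= /coshr /GRing.scale /= mulrC.
move=> H; apply: (is_derive_eq H).
by rewrite /sinhr /GRing.scale /= mulrC.
Qed.

Lemma sinhrN x : sinhr (- x) = - sinhr x.
Proof. by rewrite /sinhr opprK; ring. Qed.

Lemma coshrN x : coshr (- x) = coshr x.
Proof. by rewrite /coshr opprK addrC. Qed.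

Let continuous_of_derive (f df : R -> R) :
  (forall y : R, is_derive y (1 : R) f (df y)) -> continuous f.
Proof.
by move=> dF y; apply/differentiable_continuous/derivable1_diffP; have [] := dF y.
Qed.

Lemma sinhr_sub_id x : `|x| <= 2^-1 -> `|sinhr x - x| <= 2 * `|x| ^+ 3.
Proof.
wlog x0 : x / 0 <= x.
  move=> H; have [/H//|/ltW x0 xb] := leP 0 x.
  have := H (- x); rewrite sinhrN -opprD !normrN oppr_ge0; exact.
move=> xb; pose F (y : R) := sinhr y - y.
have dF (y : R) : is_derive y (1 : R) F (coshr y - 1).
  exact: is_deriveB (is_derive_sinhr y) (is_derive_id y 1).
have [|c cx] := @MVT_segment R F (fun y => coshr y - 1) 0 x x0 (fun y _ => dF y).
  by apply: continuous_subspaceT; exact: continuous_of_derive dF.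
have -> : F x - F 0 = sinhr x - x by rewrite /F /sinhr oppr0; ring.
rewrite subr0 => ->; move: cx xb; rewrite in_itv/= (ger0_norm x0) => /andP[c0 cx] xb.
have ch := @coshr_le c; rewrite (ger0_norm c0) in ch.
have {}ch := ch (le_trans cx xb).
rewrite ger0_norm ?mulr_ge0 ?subr_ge0 ?coshr_ge1//.
rewrite [x ^+ 3]exprSr mulrA ler_wpM2r//; apply: le_trans ch _.
by rewrite ler_pM2l// ler_sqr.
Qed.

Lemma coshr_sub_quad x : `|x| <= 2^-1 -> `|coshr x - 1 - x ^+ 2 / 2| <= `|x| ^+ 3.
Proof.
wlog x0 : x / 0 <= x.
  move=> H; have [/H//|/ltW x0 xb] := leP 0 x.
  have := H (- x); rewrite coshrN sqrrN !normrN oppr_ge0; exact.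
move=> xb; pose F (y : R) := coshr y - 1 - y ^+ 2 / 2.
have dF (y : R) : is_derive y (1 : R) F (sinhr y - y).
  have d1 := is_deriveB (is_deriveB (is_derive_coshr y) (is_derive_cst (1 : R) y 1))
    (is_deriveZ 2^-1 (is_deriveX 2 (is_derive_id y (1 : R)))).
  rewrite (_ : F = coshr - cst 1 - 2^-1 \*: (id ^+ 2)); last first.
    apply/funext => z; rewrite /F !(addrfctE, opprfctE, exprfctE) /=.
    by rewrite /GRing.scale /= [z ^+ 2 / 2]mulrC.
  apply: (is_derive_eq d1); rewrite /GRing.scale /= expr1.
  by rewrite subr0; field.
have [|c cx] := @MVT_segment R F (fun y => sinhr y - y) 0 x x0 (fun y _ => dF y).
  by apply: continuous_subspaceT; exact: continuous_of_derive dF.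
have -> : F x - F 0 = coshr x - 1 - x ^+ 2 / 2.
  by rewrite /F /coshr oppr0 expR0 expr0n /=; field.
rewrite subr0 => ->; move: cx xb; rewrite in_itv/= (ger0_norm x0) => /andP[c0 cx] xb.
have sh := @sinhr_sub_id c; rewrite (ger0_norm c0) in sh.
have {}sh := sh (le_trans cx xb).
rewrite normrM (ger0_norm x0) [x ^+ 3]exprSr ler_wpM2r//; apply: le_trans sh _.
have c3 : c ^+ 3 <= x ^+ 3 by rewrite lerXn2r ?nnegrE.
have x3 : x ^+ 3 <= x ^+ 2 * 2^-1 by rewrite exprSr ler_wpM2l ?sqr_ge0.
lra.
Qed.

Lemma expRN_ge (x : R) : 0 <= x -> 0 <= 1 - expR (- x) <= x.
Proof.
move=> x0; have := expR_ge1Dx (- x).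
have : expR (- x) <= 1 by rewrite expR_le1 oppr_le0.
by move=> ? ?; apply/andP; split; lra.
Qed.

Lemma weighted_cauchy_schwarz (M : nat) (w S : nat -> R) :
  (forall j, 0 <= w j) ->
  (\sum_(j < M) w j * S j) ^+ 2 <= (\sum_(j < M) w j) * \sum_(j < M) w j * S j ^+ 2.
Proof.
move=> w0; elim: M => [|M IH]; first by rewrite !big_ord0 expr0n mul0r.
rewrite !big_ord_recr /=.
have : 0 <= \sum_(j < M) w j by exact: sumr_ge0.
have : 0 <= \sum_(j < M) w j * S j ^+ 2.
  by apply: sumr_ge0 => j _; rewrite mulr_ge0 ?sqr_ge0.
move: IH (w0 M) (S M); move: (\sum_(j < M) w j * S j) (\sum_(j < M) w j) (\sum_(j < M) w j * S j ^+ 2).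
move=> A W B AB wM s B0 W0.
have h : 2 * (A * s) <= W * s ^+ 2 + B.
  move: W0; rewrite le_eqVlt => /predU1P[W0|W0].
    have A0 : A = 0.
      by apply/eqP; rewrite -sqrf_eq0 eq_le sqr_ge0 andbT (le_trans AB)// -W0 mul0r.
    by rewrite A0 -W0 !mul0r mulr0 add0r.
  rewrite -(ler_pM2l W0); have := sqr_ge0 (W * s - A); nra.
have : (w M) * (2 * (A * s)) <= (w M) * (W * s ^+ 2 + B) by rewrite ler_wpM2l.
by nra.
Qed.

End hyperbolic_bounds.

(** * Moments of the versines *)

Section weighted_integrals.
Context {R : realType} {n : nat}.
Local Notation T := (measurableTypeR R).
Local Notation K := {ffun 'I_n -> int}.
Variables (m : 'I_n -> {sigma_finite_measure set T -> \bar R})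
  (c : 'I_n -> int -> R).
Hypothesis mc : forall i, trigonometric_moments (m i) (c i).
Variables (I : eqType) (kap : I -> K) (beta : R) (es : seq I).
Hypothesis beta0 : 0 < beta.

Local Notation integ := (integ (tuple_product m)).
Local Notation angdiff := (angdiff kap).
Local Notation rho := (xy_density kap beta es).
Implicit Types (t : n.-tuple T) (F G : n.-tuple T -> R).

Definition xy_integral F := integ (fun t => rho t * F t).
Local Notation W := xy_integral.
Definition xy_mass := integ rho.
Local Notation Z := xy_mass.
Local Notation G0 := (moment_bound beta).

Let bmr F : bounded_measurable F -> bounded_measurable (fun t => rho t * F t).
Proof. exact: bmM (bm_density _ _ _). Qed.

Lemma xy_mass_ge0 : 0 <= Z.
Proof. by apply: integ_ge0 => t; exact: expR_ge0. Qed.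

Lemma moment_bound_ge0 : 0 <= G0.
Proof. by rewrite /moment_bound mulr_ge0 ?addr_ge0 ?mulr_ge0 ?expR_ge0 ?sqrtr_ge0. Qed.

Lemma xy_integral_le F G : bounded_measurable F -> bounded_measurable G ->
  (forall t, F t <= G t) -> W F <= W G.
Proof.
move=> bF bG FG; apply: (le_integ (mu_fin mc) (bmr bF) (bmr bG)) => t.
by rewrite ler_wpM2l// expR_ge0.
Qed.

Lemma xy_integralZ a F : bounded_measurable F -> W (fun t => a * F t) = a * W F.
Proof.
move=> bF; rewrite /W -(integZl (mu_fin mc))//; last exact: bmr.
by congr integ; apply/funext => t; ring.
Qed.

Lemma xy_integralD F G : bounded_measurable F -> bounded_measurable G ->
  W (fun t => F t + G t) = W F + W G.
Proof.
move=> bF bG; rewrite /W -(integD (mu_fin mc) (bmr bF) (bmr bG)).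
by congr integ; apply/funext => t; ring.
Qed.

Lemma xy_integralB F G : bounded_measurable F -> bounded_measurable G ->
  W (fun t => F t - G t) = W F - W G.
Proof.
move=> bF bG; rewrite /W -(integB (mu_fin mc) (bmr bF) (bmr bG)).
by congr integ; apply/funext => t; ring.
Qed.

Lemma xy_integral_sum (J : Type) (r : seq J) (F : J -> n.-tuple T -> R) :
  (forall j, bounded_measurable (F j)) ->
  W (fun t => \sum_(j <- r) F j t) = \sum_(j <- r) W (F j).
Proof.
move=> bF; rewrite /W -(integ_sum (mu_fin mc)); last by move=> j; exact: bmr.
by congr integ; apply/funext => t; rewrite mulr_sumr.
Qed.

Lemma xy_integral_cst a : W (fun=> a) = a * Z.
Proof.
rewrite /Z -(integZl (mu_fin mc)); last exact: bm_density.
by congr integ; apply/funext => t; rewrite mulrC.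
Qed.

Lemma xy_integral_ge0 F : (forall t, 0 <= F t) -> 0 <= W F.
Proof. by move=> F0; apply: integ_ge0 => t; rewrite mulr_ge0// expR_ge0. Qed.

Lemma xy_integral_norm F : bounded_measurable F -> `|W F| <= W (fun t => `|F t|).
Proof.
move=> bF; apply: le_trans (ler_norm_integ (mu_fin mc) (bmr bF)) _.
rewrite le_eqVlt; apply/orP; left; apply/eqP; congr integ; apply/funext => t.
by rewrite normrM ger0_norm// expR_ge0.
Qed.

Definition versine e t := 1 - cos (angdiff e t).

Lemma versine_ge0 e t : 0 <= versine e t.
Proof. by rewrite subr_ge0 cos_le1. Qed.

Lemma bm_versine e : bounded_measurable (versine e).
Proof. exact: bmB (bm_cst _) (bm_cosd _ _). Qed.

Lemma pow_le_exp (x : R) k : 0 <= x -> x ^+ k <= k`!%:R * expR x.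
Proof.
move=> x0; case: k => [|k].
  by rewrite expr0 mul1r; apply: le_trans (expR_ge1Dx _); rewrite lerDl.
rewrite mulrC -ler_pdivrMr ?ltr0n ?fact_gt0//.
by apply: le_trans (expR_ge1Dxn k x0); rewrite lerDr.
Qed.

Lemma bm_exp_versine e : bounded_measurable (fun t => expR (beta * versine e t)).
Proof. by apply: bm_expR; apply: bmM (bm_cst _) (bm_versine e). Qed.

Lemma exp_versine_le e : e \in es -> W (fun t => expR (beta * versine e t)) <= G0 * Z.
Proof. by move=> ees; exact: (exponential_moment mc kap (ltW beta0) ees). Qed.

Lemma versine_moment e k : e \in es ->
  W (fun t => versine e t ^+ k) <= k`!%:R / beta ^+ k * (G0 * Z).
Proof.
move=> ees; apply: le_trans (ler_wpM2l _ (exp_versine_le ees)); last first.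
  by rewrite divr_ge0// exprn_ge0// ltW.
rewrite -xy_integralZ; last exact: bm_exp_versine.
apply: xy_integral_le.
- exact: bmX (bm_versine e).
- exact: bmM (bm_cst _) (bm_exp_versine e).
move=> t; rewrite mulrAC ler_pdivlMr ?exprn_gt0// -exprMn [_ * beta]mulrC.
by apply: pow_le_exp; rewrite mulr_ge0 ?versine_ge0// ltW.
Qed.

Variable s : I -> R.
Let Q := \sum_(e <- es) s e ^+ 2.

Definition power_sum j t :=
  \sum_(e <- es) s e * (sin (angdiff e t) * versine e t ^+ j).

Let bm_term j e : bounded_measurable (fun t => sin (angdiff e t) * versine e t ^+ j).
Proof. by apply: bmM; [exact: bm_sind|exact: bmX (bm_versine e)]. Qed.

Lemma bm_power_sum j : bounded_measurable (power_sum j).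
Proof. by apply: bm_sum => e; apply: bmM (bm_cst _) (bm_term j e). Qed.

Lemma fact_div_le3 i : (i.+3)%:R <= beta -> i.+3`!%:R / beta ^+ i.+3 <= 6 / beta ^+ 3.
Proof.
elim: i => [//|i IH] ib.
have {}IH := IH (le_trans _ ib); apply: le_trans (IH _); last by rewrite ler_nat.
rewrite [beta ^+ i.+4]exprS factS natrM -[leRHS]mul1r invfM mulrACA.
apply: ler_wpM2r; last by rewrite ler_pdivrMr// mul1r.
by rewrite divr_ge0// exprn_ge0// ltW.
Qed.

Lemma fact_div_le1 j : (j.+1)%:R <= beta -> j.+1`!%:R / beta ^+ j.+1 <= beta^-1.
Proof.
elim: j => [|j IH] jb; first by rewrite expr1 mul1r.
have {}IH := IH (le_trans _ jb); apply: le_trans (IH _); last by rewrite ler_nat.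
rewrite [beta ^+ j.+2]exprS factS natrM -[leRHS]mul1r invfM mulrACA.
apply: ler_wpM2r; last by rewrite ler_pdivrMr// mul1r.
by rewrite divr_ge0// exprn_ge0// ltW.
Qed.

(** [sum_square_le] with the Charlier charges. The bound on [j] keeps [j`! / beta ^+ j]
    decreasing in [j], so that both diagonal terms are at most of the order of
    [beta ^- 2] times the exponential moment. *)
Lemma power_sum_square j : (0 < j)%N -> (2 * j).+1%:R <= beta ->
  W (fun t => power_sum j t ^+ 2) <= 6 / beta ^+ 2 * Q * (G0 * Z).
Proof.
case: j => // j _ jb.
have GZ0 : 0 <= G0 * Z by rewrite mulr_ge0 ?moment_bound_ge0 ?xy_mass_ge0.
have beta3 : 3 <= beta by apply: le_trans jb; rewrite ler_nat; lia.
pose f (x : R) := sin x * (1 - cos x) ^+ j.+1.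
pose h := beta^-1 * (expR beta * (j.+1`!%:R / beta ^+ j.+1)).
have := @sum_square_le _ _ _ _ mc _ kap _ (ltW beta0) es s _ _ _ (bm_term j.+1)
  (@charlier_shift_cvg R beta beta0 j.+1) (charlier_shift_le beta0 j.+1).
rewrite -/h => H; apply: le_trans H _.
pose D0 e t := (sin (angdiff e t) * versine e t ^+ j.+1) ^+ 2 +
    h * expR (- (beta * cos (angdiff e t))).
have bD e : bounded_measurable (D0 e).
  apply: bmD; first exact: bmX (bm_term _ _).
  apply: bmM (bm_cst _) _; apply: bm_expR; apply: bmN.
  exact: bmM (bm_cst _) (bm_cosd _ _).
rewrite (_ : integ _ = W (fun t => \sum_(e <- es) s e ^+ 2 * D0 e t))//.
rewrite xy_integral_sum; last by move=> e; exact: bmM (bm_cst _) (bD e).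
rewrite /Q mulr_sumr mulr_suml big_seq [leRHS]big_seq; apply: ler_sum => e ees.
rewrite xy_integralZ//.
rewrite [leRHS](_ : _ = s e ^+ 2 * (6 / beta ^+ 2 * (G0 * Z))); last by ring.
rewrite ler_wpM2l ?sqr_ge0//.
rewrite /D0; have hE t : h * expR (- (beta * cos (angdiff e t))) =
    j.+1`!%:R / beta ^+ j.+1 / beta * expR (beta * versine e t).
  rewrite /h /versine mulrBr mulr1 expRD; ring.
under [X in W X]eq_fun do rewrite hE.
rewrite xy_integralD; last 2 first.
- exact: bmX (bm_term _ _).
- exact: bmM (bm_cst _) (bm_exp_versine e).
rewrite xy_integralZ; last exact: bm_exp_versine.
have h1 : W (fun t => (sin (angdiff e t) * versine e t ^+ j.+1) ^+ 2) <=
    2 * (6 / beta ^+ 3 * (G0 * Z)).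
  apply: (@le_trans _ _ (2 * W (fun t => versine e t ^+ (j.*2).+3))).
    rewrite -xy_integralZ; last exact: bmX (bm_versine e).
    apply: xy_integral_le.
    - exact: bmX (bm_term _ _).
    - exact: bmM (bm_cst _) (bmX _ (bm_versine e)).
    move=> t; rewrite exprMn sin2cos2 -exprM.
    have -> : 1 - cos (angdiff e t) ^+ 2 = versine e t * (1 + cos (angdiff e t)).
      by rewrite /versine; ring.
    have -> : versine e t ^+ (j.*2).+3 = versine e t * versine e t ^+ (j.+1 * 2).
      by rewrite -exprS; congr (_ ^+ _); lia.
    have : 0 <= versine e t ^+ (j.+1 * 2) by rewrite exprn_ge0 ?versine_ge0.
    move: (versine_ge0 e t) (cos_le1 (angdiff e t)).
    move: (versine e t) (versine e t ^+ _) (cos _) => v w x v0 x1 w0.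
    have : 0 <= v * w * (1 - x) by rewrite !mulr_ge0// subr_ge0.
    by lra.
  rewrite ler_wpM2l//; apply: le_trans (versine_moment _ ees) _.
  by rewrite ler_wpM2r// fact_div_le3//; apply: le_trans jb; rewrite ler_nat; lia.
have h2 : j.+1`!%:R / beta ^+ j.+1 / beta * W (fun t => expR (beta * versine e t)) <=
    beta^-1 / beta * (G0 * Z).
  have b0 := ltW beta0; apply: ler_pM.
  - by rewrite !divr_ge0// exprn_ge0.
  - by apply: xy_integral_ge0 => t; exact: expR_ge0.
  - rewrite ler_wpM2r ?invr_ge0// fact_div_le1//.
    by apply: le_trans jb; rewrite ler_nat; lia.
  - exact: exp_versine_le.
apply: le_trans (lerD h1 h2) _.
have -> : 2 * (6 / beta ^+ 3 * (G0 * Z)) + beta^-1 / beta * (G0 * Z) =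
    (12 / beta + 1) / beta ^+ 2 * (G0 * Z) by field; rewrite gt_eqF.
rewrite ler_wpM2r// ler_wpM2r ?invr_ge0 ?exprn_ge0 ?(ltW beta0)//.
have : 12 / beta <= 4 by rewrite ler_pdivrMr//; lra.
by lra.
Qed.

End weighted_integrals.

(** * From reduced gradients to sines *)

Section reduced_angle_facts.
Context {R : realType}.
Implicit Types x : R.

Lemma reduced_angle_bounds x : - pi <= reduced_angle x <= pi.
Proof.
have [/andP[h1 h2] _] := (reduced_angleP x (reduced_angle x)).2 erefl.
by rewrite h1 ltW.
Qed.

Lemma sin_reduced_angle x : sin (reduced_angle x) = sin x.
Proof.
have [_ [k ->]] := (reduced_angleP x (reduced_angle x)).2 erefl.
exact: sin_periodic.
Qed.

Lemma cos_reduced_angle x : cos (reduced_angle x) = cos x.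
Proof.
have [_ [k ->]] := (reduced_angleP x (reduced_angle x)).2 erefl.
exact: cos_periodic.
Qed.

Lemma measurable_reduced_angle : measurable_fun setT (@reduced_angle R).
Proof.
have mf : measurable_fun setT (fun y : R => (Num.floor y)%:~R : R).
  by apply: nondecreasing_measurable => // x y xy; rewrite ler_int; exact: le_floor.
have mg : measurable_fun setT (fun x : R => (x + pi) / (2 * pi)).
  by apply: measurable_funM => //; apply: measurable_funD.
apply: measurable_funB => //; apply: measurable_funM => //.
exact: (measurableT_comp mf mg).
Qed.

End reduced_angle_facts.

Section linearization.
Context {R : realType} {n : nat}.
Local Notation T := (measurableTypeR R).
Local Notation K := {ffun 'I_n -> int}.
Variables (m : 'I_n -> {sigma_finite_measure set T -> \bar R})
  (c : 'I_n -> int -> R).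
Hypothesis mc : forall i, trigonometric_moments (m i) (c i).
Variables (I : eqType) (kap : I -> K) (beta : R) (es : seq I).
Hypothesis beta0 : 0 < beta.
Variable s : I -> R.

Local Notation integ := (integ (tuple_product m)).
Local Notation angdiff := (angdiff kap).
Local Notation W := (xy_integral m kap beta es).
Local Notation Z := (xy_mass m kap beta es).
Local Notation G0 := (moment_bound beta).
Local Notation versine := (versine kap).
Implicit Types (t : n.-tuple T) (F G : n.-tuple T -> R).

Definition angle_sum t := \sum_(e <- es) s e * reduced_angle (angdiff e t).
Definition sine_sum t := \sum_(e <- es) s e * sin (angdiff e t).
Let Q := \sum_(e <- es) s e ^+ 2.

Lemma bm_angle e : bounded_measurable (fun t => reduced_angle (angdiff e t)).
Proof.
split; last first.
  by exists pi => t; rewrite ler_norml; exact: reduced_angle_bounds.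
exact: (measurableT_comp measurable_reduced_angle (measurable_phase (kap e))).
Qed.

Lemma bm_angle_sum : bounded_measurable angle_sum.
Proof. by apply: bm_sum => e; apply: bmM (bm_cst _) (bm_angle e). Qed.

Lemma bm_sine_sum : bounded_measurable sine_sum.
Proof. by apply: bm_sum => e; apply: bmM (bm_cst _) (bm_sind _ _). Qed.

Definition angle_poly_sum M t := \sum_(e <- es) s e * angle_poly M (angdiff e t).

Lemma bm_angle_poly M e : bounded_measurable (fun t => angle_poly M (angdiff e t)).
Proof.
apply: bmM; first exact: bm_sind.
by apply: bm_sum => j; apply: bmM (bm_cst _) (bmX _ (bm_versine kap e)).
Qed.

Lemma bm_angle_poly_sum M : bounded_measurable (angle_poly_sum M).
Proof. by apply: bm_sum => e; apply: bmM (bm_cst _) (bm_angle_poly M e). Qed.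

Definition truncation_error M : R := 2 * pi * M.+1%:R * expR (- M.+1%:R).

Lemma truncation_error_ge0 M : 0 <= truncation_error M.
Proof. by rewrite /truncation_error !mulr_ge0 ?pi_ge0 ?expR_ge0. Qed.

Lemma angle_poly_sum_error M : M.+1%:R <= 2 * beta ->
  W (fun t => `|angle_sum t - angle_poly_sum M t|) <=
  (\sum_(e <- es) `|s e|) * truncation_error M * (G0 * Z).
Proof.
move=> Mb.
have b0 := ltW beta0.
have te0 := truncation_error_ge0 M.
pose B t := \sum_(e <- es) `|s e| * truncation_error M * expR (beta * versine e t).
have bB e : bounded_measurable (fun t => `|s e| * truncation_error M * expR (beta * versine e t)).
  exact: bmM (bm_cst _) (bm_exp_versine _ _ _).
apply: (@le_trans _ _ (W B)).
  apply: (xy_integral_le mc).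
  - exact: bm_norm (bmB bm_angle_sum (bm_angle_poly_sum M)).
  - exact: bm_sum.
  move=> t; rewrite /angle_sum /angle_poly_sum /B -sumrB.
  apply: le_trans (ler_norm_sum _ _ _) _; apply: ler_sum => e _.
  rewrite -mulrBr normrM -mulrA ler_wpM2l//.
  have := angle_poly_error M (reduced_angle_bounds (angdiff e t)).
  rewrite (_ : angle_poly M (reduced_angle _) = angle_poly M (angdiff e t)); last first.
    by rewrite /angle_poly sin_reduced_angle cos_reduced_angle.
  rewrite cos_reduced_angle.
  move=> /le_trans; apply; rewrite /truncation_error -[leRHS]mulrA.
  rewrite ler_wpM2l ?mulr_ge0 ?pi_ge0//; apply: le_trans (half_versine_pow _ _) _.
  rewrite ler_wpM2l ?expR_ge0// ler_expR.
  have := versine_ge0 kap e t; rewrite /versine => v0.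
  have : M.+1%:R * (1 - cos (angdiff e t)) <= 2 * beta * (1 - cos (angdiff e t)).
    by rewrite ler_wpM2r.
  lra.
rewrite (xy_integral_sum mc)// !mulr_suml big_seq [leRHS]big_seq.
apply: ler_sum => e ees; rewrite (xy_integralZ mc); last exact: bm_exp_versine.
by apply: ler_wpM2l; [rewrite mulr_ge0|exact: (exp_versine_le mc kap beta0 ees)].
Qed.

Lemma angle_poly_sumE M t : angle_poly_sum M t - sine_sum t =
  \sum_(j < M) angle_coef j.+1 * power_sum kap es s j.+1 t.
Proof.
rewrite /angle_poly_sum /sine_sum -sumrB.
transitivity (\sum_(e <- es) \sum_(j < M)
   angle_coef j.+1 * (s e * (sin (angdiff e t) * versine e t ^+ j.+1))).
  apply: eq_bigr => e _; rewrite /angle_poly big_ord_recl /= expr0 !mul1r.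
  rewrite mulrDr mulr1 mulrDr addrC addKr !mulr_sumr; apply: eq_bigr => j _.
  by rewrite /bump /= /versine; ring.
rewrite exchange_big /=; apply: eq_bigr => j _.
by rewrite /power_sum mulr_sumr.
Qed.

Lemma angle_coef_sum_le1 M : \sum_(j < M) angle_coef j.+1 <= 1 :> R.
Proof.
suff : \sum_(j < M) angle_coef j.+1 <= 1 - 2^-1 ^+ M :> R.
  by move=> /le_trans; apply; rewrite gerBl exprn_ge0 ?invr_ge0.
elim: M => [|M IH]; first by rewrite big_ord0 expr0 subrr.
rewrite big_ord_recr; apply: le_trans (lerD IH (angle_coef_le _)) _.
by rewrite !exprS /=; lra.
Qed.

Lemma angle_poly_sum_square M : (2 * M).+1%:R <= beta ->
  W (fun t => (angle_poly_sum M t - sine_sum t) ^+ 2) <=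
  6 / beta ^+ 2 * Q * (G0 * Z).
Proof.
move=> Mb; set B := 6 / beta ^+ 2 * Q * (G0 * Z).
have Q0 : 0 <= Q by apply: sumr_ge0 => e _; exact: sqr_ge0.
have B0 : 0 <= B.
  have GZ0 : 0 <= G0 * Z by rewrite mulr_ge0 ?moment_bound_ge0 ?xy_mass_ge0.
  by rewrite /B mulr_ge0// mulr_ge0// divr_ge0// exprn_ge0// ltW.
have bp j : bounded_measurable (fun t => angle_coef j.+1 * power_sum kap es s j.+1 t ^+ 2).
  exact: bmM (bm_cst _) (bmX _ (bm_power_sum _ _ _ _)).
apply: (@le_trans _ _ (W (fun t => \sum_(j < M) angle_coef j.+1 * power_sum kap es s j.+1 t ^+ 2))).
  apply: (xy_integral_le mc).
  - exact: bmX (bmB (bm_angle_poly_sum M) bm_sine_sum).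
  - by apply: bm_sum => j.
  move=> t; rewrite angle_poly_sumE.
  apply: le_trans (@weighted_cauchy_schwarz R M (fun j => angle_coef j.+1) (fun j => power_sum kap es s j.+1 t) _) _.
    by move=> j; exact: angle_coef_ge0.
  rewrite ler_piMl ?angle_coef_sum_le1//.
  by apply: sumr_ge0 => j _; rewrite mulr_ge0 ?angle_coef_ge0 ?sqr_ge0.
rewrite (xy_integral_sum mc); last by move=> j.
apply: (@le_trans _ _ (\sum_(j < M) angle_coef j.+1 * B)).
  apply: ler_sum => j _; rewrite (xy_integralZ mc); last first.
    exact: bmX (bm_power_sum _ _ _ _).
  rewrite ler_wpM2l ?angle_coef_ge0//; apply: (power_sum_square mc) => //.
  apply: le_trans Mb; rewrite ler_nat; have := ltn_ord j; lia.
by rewrite -mulr_suml ler_piMl// angle_coef_sum_le1.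
Qed.

(** Expand each angle in powers of its versine. The remainder is controlled edge
    by edge; the terms of positive order, being sums over all edges, are
    controlled in mean square, and [kappa + x ^+ 2 / kappa >= `|x|] converts this
    into a mean. *)
Lemma angle_sum_linearization M kappa : (2 * M).+1%:R <= beta -> 0 < kappa ->
  W (fun t => `|angle_sum t - sine_sum t|) <=
  ((\sum_(e <- es) `|s e|) * truncation_error M * G0 +
   kappa + 6 / beta ^+ 2 * Q * G0 / kappa) * Z.
Proof.
move=> Mb k0; have Mb' : M.+1%:R <= 2 * beta.
  have : M.+1%:R <= (2 * M).+1%:R :> R by rewrite ler_nat; lia.
  by move: beta0; lra.
pose D t := angle_poly_sum M t - sine_sum t.
have bD : bounded_measurable D by exact: bmB (bm_angle_poly_sum M) bm_sine_sum.
have b1 : bounded_measurable (fun t => `|angle_sum t - angle_poly_sum M t|).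
  exact: bm_norm (bmB bm_angle_sum (bm_angle_poly_sum M)).
have b2 : bounded_measurable (fun t => kappa^-1 * D t ^+ 2).
  exact: bmM (bm_cst _) (bmX _ bD).
apply: (@le_trans _ _ (W (fun t => `|angle_sum t - angle_poly_sum M t| +
    (kappa + kappa^-1 * D t ^+ 2)))).
  apply: (xy_integral_le mc).
  - exact: bm_norm (bmB bm_angle_sum bm_sine_sum).
  - by apply: bmD => //; apply: bmD => //; exact: bm_cst.
  move=> t; have -> : angle_sum t - sine_sum t = angle_sum t - angle_poly_sum M t + D t.
    by rewrite /D; ring.
  apply: le_trans (ler_normD _ _) _; rewrite lerD2l.
  rewrite -(ler_pM2l k0) mulrDr mulVKf ?gt_eqF// -[D t ^+ 2]real_normK ?num_real//.
  by have := normr_ge0 (D t); move: (`|D t|) => w w0; have := sqr_ge0 (kappa - w); nra.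
rewrite (xy_integralD mc)//; last by apply: bmD => //; exact: bm_cst.
rewrite (xy_integralD mc)//; last exact: bm_cst.
rewrite (xy_integral_cst mc) (xy_integralZ mc); last exact: bmX.
have := angle_poly_sum_error Mb'; have := angle_poly_sum_square Mb => h1 h2.
have := ler_wpM2l (ltW (_ : 0 < kappa^-1)) h1; rewrite invr_gt0 => /(_ k0) h3.
rewrite [leRHS](_ : _ = (\sum_(e <- es) `|s e|) * truncation_error M * (G0 * Z) +
   (kappa * Z + kappa^-1 * (6 / beta ^+ 2 * Q * (G0 * Z)))); last by ring.
by rewrite lerD// lerD2l.
Qed.

End linearization.

(** * The characteristic function at a fixed mesh *)

Section characteristic_function_bound.
Context {R : realType} {n : nat}.
Local Notation T := (measurableTypeR R).
Local Notation K := {ffun 'I_n -> int}.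
Variables (m : 'I_n -> {sigma_finite_measure set T -> \bar R})
  (c : 'I_n -> int -> R).
Hypothesis mc : forall i, trigonometric_moments (m i) (c i).
Variables (I : eqType) (kap : I -> K) (beta : R) (es : seq I).
Hypothesis beta0 : 0 < beta.
Variables (psi : 'I_n -> R) (s : I -> R) (tau : R).
Hypothesis psic : forall i k, psi i != 0 -> k != 0 -> c i k = 0.
Hypothesis spsi : forall e, e \in es -> gradient psi (kap e) = s e.
Hypothesis small : forall e, e \in es -> `|tau * s e / beta| <= 2^-1.

Local Notation integ := (integ (tuple_product m)).
Local Notation angdiff := (angdiff kap).
Local Notation rho := (xy_density kap beta es).
Local Notation W := (xy_integral m kap beta es).
Local Notation Z := (xy_mass m kap beta es).
Local Notation G0 := (moment_bound beta).
Local Notation versine := (versine kap).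
Implicit Types (t : n.-tuple T).

(** After the shift of the angles by i times [psi'], an edge has energy
    [beta * cos (delta + i a)] (for one sign of [a]): this splits into the original
    energy, the constant [Kc], the loss [D] and the phase [Theta]. *)
Let a e := tau * s e / beta.
Let psi' i := tau / beta * psi i.
Let Kc := \sum_(e <- es) beta * (coshr (a e) - 1).
Let Theta t := \sum_(e <- es) beta * sinhr (a e) * sin (angdiff e t).
Let D t := \sum_(e <- es) beta * (coshr (a e) - 1) * versine e t.
Let Q := \sum_(e <- es) s e ^+ 2.
Let Cub := \sum_(e <- es) beta * `|a e| ^+ 3.

Let gradE e : e \in es -> gradient psi' (kap e) = a e.
Proof.
move=> ees; rewrite /gradient /psi' /a -(spsi ees) /gradient mulrAC mulr_sumr.
by apply: eq_bigr => i _; ring.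
Qed.

Let shift_energyE t : expR (shifted_energy kap beta psi' es t) =
  rho t * expR Kc * expR (- D t).
Proof.
have -> : shifted_energy kap beta psi' es t =
    \sum_(e <- es) beta * coshr (a e) * cos (angdiff e t).
  by apply: eq_big_seq => e ees; rewrite gradE.
rewrite /xy_density -!expRD; congr expR; rewrite mulr_sumr /Kc /D -big_split -sumrN -big_split.
by apply: eq_bigr => e _; rewrite /versine /=; ring.
Qed.

Let shift_phaseE t : shifted_phase kap beta psi' es t = Theta t.
Proof. by apply: eq_big_seq => e ees; rewrite gradE. Qed.

Let measurable_Theta : measurable_fun setT Theta.
Proof.
have [//] : bounded_measurable Theta.
by apply: bm_sum => e; apply: bmM (bm_cst _) (bm_sind _ _).
Qed.

Let bm_D : bounded_measurable D.
Proof. by apply: bm_sum => e; apply: bmM (bm_cst _) (bm_versine _ _). Qed.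

Let D_ge0 t : 0 <= D t.
Proof.
apply: sumr_ge0 => e _; apply: mulr_ge0; last exact: versine_ge0.
by apply: mulr_ge0; [exact: ltW|rewrite subr_ge0 coshr_ge1].
Qed.

Let D_mean : W D <= Kc / beta * G0 * Z.
Proof.
rewrite /D (xy_integral_sum mc); last first.
  by move=> e; apply: bmM (bm_cst _) (bm_versine _ _).
rewrite /Kc !mulr_suml big_seq [leRHS]big_seq; apply: ler_sum => e ees.
rewrite (xy_integralZ mc); last exact: bm_versine.
rewrite -mulrA [leRHS](_ : _ = beta * ((coshr (a e) - 1) * (beta^-1 * (G0 * Z)))); last by ring.
apply: ler_wpM2l; first exact: ltW.
apply: ler_wpM2l; first by rewrite subr_ge0 coshr_ge1.
have := versine_moment mc kap beta0 1 ees.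
by have -> : 1`!%:R / beta ^+ 1 = beta^-1 by rewrite expr1 mul1r.
Qed.

(** The shift identity gives the mean of [expR (- D) * h Theta] exactly, and the
    nonnegative [D] has a small mean. *)
Let twist (h : R -> R) (l : R) : (forall x, `|h x| <= 1) ->
  bounded_measurable (fun t => h (Theta t)) ->
  integ (fun t => expR (shifted_energy kap beta psi' es t) * h (Theta t)) = l ->
  `|W (fun t => h (Theta t)) - expR (- Kc) * l| <= Kc / beta * G0 * Z.
Proof.
move=> h1 bh hl.
have bE : bounded_measurable (fun t => expR (- D t)).
  by apply: bm_expR; exact: bmN.
have <- : W (fun t => expR (- D t) * h (Theta t)) = expR (- Kc) * l.
  rewrite -hl -(integZl (mu_fin mc)); last first.
    apply: bm_ext (bmM (bmM (bmM (bm_density _ _ _) (bm_cst (expR Kc))) bE) bh) => t.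
    by rewrite shift_energyE.
  congr integ; apply/funext => t; rewrite shift_energyE.
  have := expRxMexpNx_1 Kc; move: (expR Kc) (expR (- Kc)) => u v uv.
  transitivity ((u * v) * (rho t * (expR (- D t) * h (Theta t)))); last by ring.
  by rewrite uv mul1r.
rewrite -(xy_integralB mc) //; last exact: bmM.
have bdiff : bounded_measurable (fun t => h (Theta t) - expR (- D t) * h (Theta t)).
  by apply: bmB => //; exact: bmM.
apply: le_trans (xy_integral_norm mc _ _ _ bdiff) (le_trans _ D_mean).
apply: (xy_integral_le mc) => //; first exact: bm_norm.
move=> t; rewrite -[X in X - _]mul1r -mulrBl normrM.
have /andP[e0 e1] := expRN_ge (D_ge0 t).
by rewrite ger0_norm// -[leRHS]mulr1 ler_pM.
Qed.

Let Q_scale : \sum_(e <- es) beta * a e ^+ 2 = tau ^+ 2 * Q / beta.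
Proof.
rewrite /Q mulr_sumr mulr_suml; apply: eq_bigr => e _.
by rewrite /a; field; rewrite gt_eqF.
Qed.

Lemma gaussian_exponent : `|Kc - tau ^+ 2 * Q / beta / 2| <= Cub.
Proof.
rewrite -Q_scale mulr_suml /Kc -sumrB; apply: le_trans (ler_norm_sum _ _ _) _.
rewrite /Cub big_seq [leRHS]big_seq; apply: ler_sum => e ees.
rewrite -mulrA -mulrBr normrM (gtr0_norm beta0) ler_wpM2l ?(ltW beta0)//.
exact: coshr_sub_quad (small ees).
Qed.

Let Kc_le : Kc <= 2 * (tau ^+ 2 * Q / beta).
Proof.
rewrite -Q_scale mulr_sumr /Kc big_seq [leRHS]big_seq; apply: ler_sum => e ees.
rewrite mulrCA ler_wpM2l ?(ltW beta0)//.
exact: coshr_le (small ees).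
Qed.

Let Theta_sine t : `|tau * sine_sum kap es s t - Theta t| <= 2 * Cub.
Proof.
rewrite /sine_sum mulr_sumr /Theta -sumrB; apply: le_trans (ler_norm_sum _ _ _) _.
rewrite /Cub mulr_sumr big_seq [leRHS]big_seq; apply: ler_sum => e ees.
have -> : tau * (s e * sin (angdiff e t)) - beta * sinhr (a e) * sin (angdiff e t) =
    beta * (a e - sinhr (a e)) * sin (angdiff e t).
  by rewrite /a; field; rewrite gt_eqF.
rewrite normrM -[leRHS]mulr1 ler_pM ?sin_max// normrM (gtr0_norm beta0) mulrCA.
by rewrite ler_wpM2l ?(ltW beta0)// distrC; exact: sinhr_sub_id (small ees).
Qed.

(** In this order: replacing angles by sines, replacing the [tau * s e] by
    hyperbolic sines, dropping the loss of energy in the shift. *)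
Definition clt_error (M : nat) (kappa : R) : R :=
  `|tau| * ((\sum_(e <- es) `|s e|) * truncation_error M * G0 + kappa +
            6 / beta ^+ 2 * (\sum_(e <- es) s e ^+ 2) * G0 / kappa) +
  2 * (\sum_(e <- es) beta * `|tau * s e / beta| ^+ 3) +
  2 * (tau ^+ 2 * (\sum_(e <- es) s e ^+ 2) / beta) / beta * G0.

Let lipschitz_bound (h : R -> R) (l : R) M kappa : (forall x, `|h x| <= 1) ->
  (forall x y, `|h x - h y| <= `|x - y|) ->
  (forall F : n.-tuple T -> R, measurable_fun setT F ->
     bounded_measurable (fun t => h (F t))) ->
  integ (fun t => expR (shifted_energy kap beta psi' es t) * h (Theta t)) = l ->
  (2 * M).+1%:R <= beta -> 0 < kappa ->
  `|W (fun t => h (tau * angle_sum kap es s t)) - expR (- Kc) * l| <=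
    clt_error M kappa * Z.
Proof.
move=> h1 hL bh hl Mb k0.
have bX := bm_angle_sum kap es s; have bY := bm_sine_sum kap es s.
have bhX : bounded_measurable (fun t => h (tau * angle_sum kap es s t)).
  by apply: bh; apply: measurable_funM => //; have [] := bX.
have bhT : bounded_measurable (fun t => h (Theta t)) by exact: bh.
have bXY : bounded_measurable (fun t => `|angle_sum kap es s t - sine_sum kap es s t|).
  exact: bm_norm (bmB bX bY).
have -> : W (fun t => h (tau * angle_sum kap es s t)) - expR (- Kc) * l =
   W (fun t => h (tau * angle_sum kap es s t) - h (Theta t)) +
   (W (fun t => h (Theta t)) - expR (- Kc) * l).
  by rewrite (xy_integralB mc)//; ring.
apply: le_trans (ler_normD _ _) _.
rewrite /clt_error mulrDl; apply: lerD; last first.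
  apply: le_trans (twist h1 bhT hl) _.
  rewrite ler_wpM2r ?xy_mass_ge0// ler_wpM2r ?moment_bound_ge0//.
  by rewrite ler_wpM2r// invr_ge0 ltW.
apply: le_trans (xy_integral_norm mc _ _ _ (bmB bhX bhT)) _.
apply: (@le_trans _ _ (W (fun t => `|tau| * `|angle_sum kap es s t - sine_sum kap es s t|
    + 2 * Cub))).
  apply: (xy_integral_le mc).
  - exact: bm_norm (bmB bhX bhT).
  - by apply: bmD _ (bm_cst _); exact: bmM (bm_cst _) bXY.
  move=> t; apply: le_trans (hL _ _) _.
  have -> : tau * angle_sum kap es s t - Theta t =
    tau * (angle_sum kap es s t - sine_sum kap es s t) +
    (tau * sine_sum kap es s t - Theta t) by ring.
  by apply: le_trans (ler_normD _ _) _; rewrite normrM lerD2l.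
rewrite (xy_integralD mc); [|exact: bmM (bm_cst _) bXY|exact: bm_cst].
rewrite (xy_integral_cst mc) (xy_integralZ mc)// [leRHS]mulrDl lerD2r -[leRHS]mulrA.
rewrite ler_wpM2l//; exact: (angle_sum_linearization mc kap es beta0 s Mb k0).
Qed.

Lemma characteristic_bound M kappa : (2 * M).+1%:R <= beta -> 0 < kappa ->
  `|W (fun t => cos (tau * angle_sum kap es s t)) - expR (- Kc) * Z| <=
    clt_error M kappa * Z /\
  `|W (fun t => sin (tau * angle_sum kap es s t))| <= clt_error M kappa * Z.
Proof.
move=> Mb k0.
have psi'c i k : psi' i != 0 -> k != 0 -> c i k = 0.
  by rewrite mulf_eq0 negb_or => /andP[_]; exact: psic.
have [c1 c2] := complex_shift mc kap (ltW beta0) es psi'c.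
have cE : integ (fun t => expR (shifted_energy kap beta psi' es t) * cos (Theta t)) = Z.
  by rewrite -[RHS]c1; congr integ; apply/funext => t; rewrite shift_phaseE.
have sE : integ (fun t => expR (shifted_energy kap beta psi' es t) * sin (Theta t)) = 0.
  by rewrite -[RHS]c2; congr integ; apply/funext => t; rewrite shift_phaseE.
split.
  apply: lipschitz_bound cE Mb k0; [exact: cos_max|exact: cos_lipschitz|].
  by move=> F mF; exact: bm_cos.
have := lipschitz_bound _ _ _ sE Mb k0; rewrite mulr0 subr0; apply.
- exact: sin_max.
- exact: sin_lipschitz.
- by move=> F mF; exact: bm_sin.
Qed.

End characteristic_function_bound.

(** * Integration against a density *)

Section density.
Context {d} {T : measurableType d} {R : realType}.
Variables (mu : {sigma_finite_measure set T -> \bar R})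
  (nu : {finite_measure set T -> \bar R}) (rho : T -> R).
Hypothesis mufin : (mu setT < +oo)%E.
Hypothesis brho : bounded_measurable rho.
Hypothesis nuE : forall A, measurable A -> nu A = (\int[mu]_(x in A) (rho x)%:E)%E.

(** The change of variables for the Radon-Nikodym derivative, with which [rho]
    agrees almost everywhere. *)
Lemma integral_density (h : T -> R) : bounded_measurable h ->
  integ nu h = integ mu (fun x => rho x * h x).
Proof.
move=> bh.
have numu : nu `<< mu.
  apply/null_content_dominatesP => A mA A0; rewrite nuE//.
  apply: null_set_integral => //.
  by apply: measurable_funTS; apply/measurable_EFinP; have [] := brho.
have nufin : (nu setT < +oo)%E.
  by rewrite -ge0_fin_numE// fin_num_measure.
have ih : nu.-integrable setT (EFin \o h) by exact: bm_integrable.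
have irho : mu.-integrable setT (EFin \o rho) by exact: bm_integrable.
pose RN := Radon_Nikodym (charge_of_finite_measure nu) mu.
have iRN : mu.-integrable setT RN by apply: Radon_Nikodym_integrable.
have aeRN : ae_eq mu setT RN (EFin \o rho).
  apply: integral_ae_eq => //.
    by apply/measurable_EFinP; have [] := brho.
  move=> E _ mE.
  have := @Radon_Nikodym_integral _ _ _ (charge_of_finite_measure nu) mu E numu mE.
  by rewrite /RN => <-; exact: nuE.
apply/EFin_inj; rewrite -(integE nufin bh) -(integE mufin (bmM brho bh)).
rewrite -(Radon_Nikodym_change_of_variables numu measurableT ih).
apply: ae_eq_integral => //.
- apply: emeasurable_funM; first by apply/measurable_EFinP; have [] := bh.
  exact: measurable_int iRN.
- by apply/measurable_EFinP; have [] := bmM brho bh.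
case: aeRN => N [mN N0 sN]; exists N; split => // x /= H; apply: sN => /= E.
by apply: H => _; have := E Logic.I; rewrite /RN /= => ->; rewrite EFinM muleC.
Qed.

End density.

(** * The lattice model *)

Section lattice_model.
Context {R : realType} {d : nat}.
Local Notation T := (measurableTypeR R).
Variables (D : set 'rV[R]_d) (eps beta : R).
Local Notation V := (sites D eps).
Local Notation n := (size V).
Local Notation E := (edges D eps).

Definition site (i : 'I_n) : 'rV[int]_d := tnth (in_tuple V) i.

Definition site_coef (i : 'I_n) (k : int) : R :=
  if site i \in boundary_sites D eps then 1 else if k == 0 then 2 * pi else 0.

Definition lattice_measure : 'I_n -> {sigma_finite_measure set T -> \bar R} :=
  fun i => site_measure D eps (site i).

Lemma lattice_moments i : trigonometric_moments (lattice_measure i) (site_coef i).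
Proof.
rewrite /lattice_measure /site_measure /site_coef; case: ifP => _ /=.
  exact: dirac0_moments.
exact: arc_moments.
Qed.

Definition edge_char (e : 'rV[int]_d * 'rV[int]_d) : {ffun 'I_n -> int} :=
  [ffun i => (site i == e.2)%:Z - (site i == e.1)%:Z].

Lemma angle_site (th : config D eps) k : k \in V ->
  angle th k = \sum_(i < n) (site i == k)%:R * tnth th i.
Proof.
move=> kV; have iV : (index k V < n)%N by rewrite index_mem.
rewrite (bigD1 (Ordinal iV))//= big1 ?addr0 => [|i /negP ik].
  rewrite /site (tnth_nth k) /= nth_index// eqxx mul1r /angle.
  by rewrite (tnth_nth 0).
case: eqP => [sik|]; last by rewrite mul0r.
exfalso; apply: ik; apply/eqP/val_inj => /=.
by rewrite -sik /site (tnth_nth k) /= index_uniq//; exact: enum_fset_uniq.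
Qed.

Lemma edge_sites e : e \in E -> e.1 \in V /\ e.2 \in V.
Proof. by rewrite !inE /= => /andP[/andP[]]. Qed.

Lemma angdiff_edge e (th : config D eps) : e \in E ->
  angdiff edge_char e th = angle th e.2 - angle th e.1.
Proof.
move=> /edge_sites[e1 e2]; rewrite !angle_site// /angdiff /phase -sumrB.
by apply: eq_bigr => i _; rewrite ffunE intrB mulrBl; congr (_ * _ - _ * _);
  case: (_ == _).
Qed.

Lemma gradient_edge (psi : 'rV[int]_d -> R) e : e \in E ->
  gradient (fun i => psi (site i)) (edge_char e) = psi e.2 - psi e.1.
Proof.
have G k : k \in V -> \sum_(i < n) (site i == k)%:R * psi (site i) = psi k.
  move=> kV; have iV : (index k V < n)%N by rewrite index_mem.
  have si : site (Ordinal iV) = k by rewrite /site (tnth_nth k) /= nth_index.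
  rewrite (bigD1 (Ordinal iV))//= big1 ?addr0 => [|i /negP ik].
    by rewrite si eqxx mul1r.
  case: eqP => [sik|]; last by rewrite mul0r.
  exfalso; apply: ik; apply/eqP/val_inj => /=.
  by rewrite -sik /site (tnth_nth k) /= index_uniq//; exact: enum_fset_uniq.
move=> /edge_sites[e1 e2]; rewrite -(G _ e1) -(G _ e2) /gradient -sumrB.
by apply: eq_bigr => i _; rewrite ffunE intrB mulrBl; congr (_ * _ - _ * _);
  case: (_ == _).
Qed.

Local Notation W := (xy_integral lattice_measure edge_char beta E).
Local Notation Z := (xy_mass lattice_measure edge_char beta E).

Lemma xy_densityE (th : config D eps) :
  xy_density edge_char beta E th = expR (beta * cos_sum th).
Proof.
rewrite /xy_density /cos_sum; congr (expR (_ * _)); apply: eq_big_seq => e eE.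
by rewrite angdiff_edge// -cosN opprB.
Qed.

Let bdens : bounded_measurable (fun th : config D eps => expR (beta * cos_sum th)).
Proof. by apply: bm_ext (bm_density edge_char beta E) => th; exact: xy_densityE. Qed.

Lemma partition_functionE : partition_function D beta eps = Z%:E.
Proof.
rewrite /partition_function /gibbs_weight.
rewrite (integE (mu_fin lattice_moments) bdens); congr EFin.
by congr integ; apply/funext => th; rewrite xy_densityE.
Qed.

Lemma xy_mass_gt0 : 0 < Z.
Proof.
have /andP[] := partition_function_bounds D beta eps.
by rewrite partition_functionE lte_fin.
Qed.

Lemma expectation_gibbs (disp : measure_display) (Omega : measurableType disp)
    (P : probability Omega R) (theta : {RV P >-> config D eps})
    (h : config D eps -> R) :
  (forall A, measurable A -> distribution P theta A = gibbs D beta eps A) ->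
  bounded_measurable h ->
  fine ('E_P[fun w => h (theta w)])%E = W h / Z.
Proof.
move=> thetaE bh.
pose rho (th : config D eps) := Z^-1 * expR (beta * cos_sum th).
have brho : bounded_measurable rho by exact: bmM (bm_cst _) bdens.
have nuE A : measurable A -> distribution P theta A =
    (\int[reference_measure D eps]_(x in A) (rho x)%:E)%E.
  move=> mA; rewrite thetaE// /gibbs partition_functionE /= /gibbs_weight.
  rewrite -integralZl//; apply: integrableS (bm_integrable (mu_fin lattice_moments) bdens) => //.
have := integral_density (mu_fin lattice_moments) brho nuE bh.
have [mh [K hK]] := bh.
rewrite /integ /Rintegral integral_distribution; last 2 first.
- exact/measurable_EFinP.
- have bhth : bounded_measurable (h \o theta).
    by split; [exact: measurableT_comp|exists K => w; exact: hK].
  have Pfin : (P setT < +oo)%E by rewrite probability_setT ltry.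
  exact: bm_integrable Pfin _ bhth.
rewrite unlock => ->.
rewrite -/(Rintegral _ _ _) -/(integ _ _) /W mulrC.
rewrite -(integZl (mu_fin lattice_moments)); last exact: bmM (bm_density _ _ _) bh.
by congr integ; apply/funext => th; rewrite /rho xy_densityE; ring.
Qed.

Lemma pairingE (f : 'rV[R]_d -> R) (th : config D eps) :
  pairing D beta eps f th = angle_sum edge_char E (fun e => eps `^ (d%:R / 2 - 1) *
    Num.sqrt beta * (f (vertex eps e.2) - f (vertex eps e.1))) th.
Proof.
rewrite /pairing /angle_sum mulr_sumr; apply: eq_big_seq => e eE.
by rewrite angdiff_edge// /reduced_gradient; ring.
Qed.

End lattice_model.

(** * Test functions *)

Section test_functions.
Context {R : realType} {d : nat}.
Variables (D : set 'rV[R]_d) (f : 'rV[R]_d -> R).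
Hypothesis oD : open D.
Hypothesis tf : test_function D f.
Local Notation supp := (closure [set x | f x != 0]).

(** The compact support is at positive distance from the complement of [D]. *)
Lemma test_function_margin : exists2 delta : R, 0 < delta &
  forall x y, f x != 0 -> `|x - y| < delta -> D y.
Proof.
have [_ cK KD] := tf.
pose P (r : R) (x : 'rV[R]_d) := forall y, `|x - y| < r -> D y.
have /compact_near_coveringP cov := cK.
have : \forall r \near (0 : R)^'+, supp `<=` P r.
  apply: cov => x /KD Dx.
  have [r /= r0 rD] : exists2 r : R, 0 < r & forall y, `|x - y| < r -> D y.
    by have /nbhs_ballP[r r0 rD] := open_nbhs_nbhs (conj oD Dx);
      exists r => // y xy; apply: rD; rewrite -ball_normE.
  have r2 : 0 < r / 2 by rewrite divr_gt0.
  exists (ball x (r / 2), [set e | e < r / 2]).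
    by split; [exact: nbhsx_ballx|exact: nbhs_right_lt].
  move=> [x' e] /= [xx' er] y x'y; apply: rD.
  rewrite -ball_normE /= in xx'.
  have -> : x - y = (x - x') + (x' - y) by rewrite addrA subrK.
  rewrite (le_lt_trans (ler_normD _ _))// [ltRHS]splitr ltrD//.
  exact: lt_trans x'y er.
move=> [r /= r0 H]; exists (r / 2); first by rewrite divr_gt0.
have r2 : 0 < r / 2 by rewrite divr_gt0.
have Pr : supp `<=` P (r / 2).
  apply: H => //=; rewrite sub0r normrN gtr0_norm//.
  by rewrite ltr_pdivrMr// ltr_pMr// ltr1n.
by move=> x y fx xy; apply: (Pr x) => //; exact: subset_closure.
Qed.

Lemma delta_norm (i : 'I_d) : `|delta_mx 0 i : 'rV[R]_d| = 1.
Proof.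
apply/eqP; rewrite eq_le; apply/andP; split.
  rewrite [leLHS]mx_normrE; apply/bigmax_leP; split => // -[a b] _ /=.
  by rewrite mxE; case: (_ && _); rewrite ?normr1 ?normr0.
rewrite [leRHS]mx_normrE; apply/bigmax_geP; right; exists (0, i) => //=.
by rewrite mxE !eqxx normr1.
Qed.

Lemma is_derive_line (i : 'I_d) (x : 'rV[R]_d) (t : R) :
  is_derive t (1 : R) (fun t : R => f (x + t *: delta_mx 0 i) : R^o)
    (partial i f (x + t *: delta_mx 0 i)).
Proof.
have [sf _ _] := tf; have [_ df] := sf [::].
have E : (fun h : R => h^-1 *: (((fun t : R => f (x + t *: delta_mx 0 i)) \o shift t) (h *: (1 : R)) -
    f (x + t *: delta_mx 0 i))) =
  (fun h : R => h^-1 *: ((f \o shift (x + t *: delta_mx 0 i)) (h *: delta_mx 0 i) -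
    f (x + t *: delta_mx 0 i))).
  apply/funext => h /=; congr (_ *: (f _ - _)).
  by rewrite [h *: (1 : R)]mulr1 scalerDl addrCA.
split.
  by have := df i (x + t *: delta_mx 0 i); rewrite /derivable -E.
by rewrite /partial /derive -E.
Qed.

Lemma continuous_partial (i : 'I_d) : continuous (partial i f).
Proof. by have [sf _ _] := tf; have [] := sf [:: i]. Qed.

Lemma line_mvt (i : 'I_d) (x : 'rV[R]_d) (eps : R) : 0 < eps ->
  exists2 y, `|y - x| <= eps &
    f (x + eps *: delta_mx 0 i) - f x = eps * partial i f y.
Proof.
move=> e0; have cl (t : R) : {for t, continuous (fun t : R => f (x + t *: delta_mx 0 i) : R^o)}.
  apply/differentiable_continuous/derivable1_diffP.
  by have [] := is_derive_line i x t.
have [|c] := @MVT_segment R (fun t : R => f (x + t *: delta_mx 0 i))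
    (fun t => partial i f (x + t *: delta_mx 0 i)) 0 eps (ltW e0)
    (fun t _ => is_derive_line i x t).
  by apply: continuous_subspaceT => t; exact: cl.
rewrite in_itv/= => /andP[c0 ce]; rewrite scale0r addr0 subr0 => E.
exists (x + c *: delta_mx 0 i); last by rewrite E mulrC.
by rewrite addrC addKr normrZ delta_norm mulr1 ger0_norm.
Qed.

Lemma partial_out (i : 'I_d) (x : 'rV[R]_d) : ~ supp x -> partial i f x = 0.
Proof.
move=> sx; have : open (~` supp) by apply: closed_openC; exact: closed_closure.
move=> os; have := open_nbhs_nbhs (conj os sx) => ns.
have := is_derive_line i x 0; rewrite scale0r addr0 => dl.
have [_ <-] := dl.
rewrite (@near_eq_derive _ _ _ _ (cst 0)) ?derive_cst//.
have ct : {for (0 : R), continuous (fun t : R => x + t *: (delta_mx 0 i : 'rV[R]_d))}.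
  apply: cvgD; first exact: cvg_cst.
  by apply: cvgZl; exact: cvg_id.
have H : \forall t \near (0 : R), ~ supp (x + t *: delta_mx 0 i).
  by have := ct (~` supp); rewrite /= scale0r addr0 => /(_ ns).
apply: filterS H => t nt; apply/eqP/negPn/negP => ft; apply: nt.
exact: subset_closure.
Qed.

Lemma partial_bounded : exists2 L : R, 0 <= L & forall i x, `|partial i f x| <= L.
Proof.
have [_ cK _] := tf.
have bi i : exists L : R, forall x, `|partial i f x| <= L.
  have : compact (partial i f @` supp).
    by apply: continuous_compact => //; apply: continuous_subspaceT; exact: continuous_partial.
  move=> /compact_bounded[M [_ HM]]; exists (`|M| + 1) => x.
  have [sx|sx] := pselect (supp x).
    apply: (HM (`|M| + 1)); first by rewrite ltr_pwDr// ler_norm.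
    by exists x.
  by rewrite partial_out// normr0 addr_ge0.
have [L HL] := choice bi.
exists (\sum_i `|L i|); first by rewrite sumr_ge0.
move=> i x; apply: le_trans (HL i x) _; rewrite (bigD1 i)//=.
by rewrite (le_trans (ler_norm _))// lerDl sumr_ge0.
Qed.

End test_functions.

(** * Geometry of the lattice domain *)

Section lattice_geometry.
Context {R : realType} {d : nat}.
Variables (D : set 'rV[R]_d) (f : 'rV[R]_d -> R).
Hypothesis bD : bounded_set D.

Lemma in_sites (eps : R) k : 0 < eps -> (k \in sites D eps) = `[< D (vertex eps k) >].
Proof.
move=> e0; rewrite in_fset_set; last exact: finite_sites.
by apply/idP/asboolP => [/set_mem|Dk]; [|exact: mem_set].
Qed.

Lemma vertexD (eps : R) (k : 'rV[int]_d) i :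
  vertex eps (k + delta_mx 0 i) = vertex eps k + eps *: delta_mx 0 i.
Proof.
rewrite /vertex -scalerDr; congr (_ *: _); apply/rowP => j.
by rewrite !mxE intrD; congr (_ + _); case: (_ && _).
Qed.

Lemma neighbor_dist (eps : R) (k l : 'rV[int]_d) : 0 < eps ->
  nearest_neighbor k l -> `|vertex eps k - vertex eps l| = eps.
Proof.
move=> e0 /existsP[i /orP[] /eqP ->]; rewrite vertexD.
  by rewrite opprD addrA subrr sub0r normrN normrZ delta_norm mulr1 gtr0_norm.
by rewrite addrC addKr normrZ delta_norm mulr1 gtr0_norm.
Qed.

Lemma coordinate_le (x : 'rV[R]_d) i : `|x 0 i| <= `|x|.
Proof. by rewrite [leRHS]mx_normrE; apply/bigmax_geP; right; exists (0, i). Qed.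

Lemma bounded_setP : exists2 B : R, 0 < B & forall x, D x -> `|x| <= B.
Proof.
have [M [Mreal HM]] := bD; exists (`|M| + 1); first by rewrite ltr_wpDl.
by apply: HM; rewrite ltr_pwDr// ler_norm.
Qed.

Lemma size_sites : exists2 C : R, 0 < C & forall eps : R, 0 < eps -> eps <= 1 ->
  (size (sites D eps))%:R <= (C / eps) ^+ d.
Proof.
have [B B0 HB] := bounded_setP.
exists (2 * B + 3); first by lra.
move=> eps e0 e1; pose N := `|Num.ceil (B / eps)|%N.
pose g (h : 'rV['I_(N + N).+1]_d) : 'rV[int]_d := \row_i ((h 0 i)%:Z - N%:Z).
have sub : {subset sites D eps <= [seq g h | h <- enum {: 'rV['I_(N + N).+1]_d}]}.
  move=> k; rewrite in_sites// => /asboolP /HB kM.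
  have kN i : `|k 0 i| <= N%:Z.
    have := le_trans (coordinate_le (vertex eps k) i) kM.
    rewrite !mxE normrM gtr0_norm// mulrC -ler_pdivlMr// => kiM.
    have := le_trans kiM (ceil_ge (B / eps)).
    rewrite -intr_norm ler_int => /le_trans; apply.
    by rewrite /N abszE ler_norm.
  have kN' i : (absz (k 0 i + N%:Z)%R < (N + N).+1)%N.
    have := kN i; rewrite ler_norml => /andP[k1 k2].
    by rewrite ltnS -lez_nat gez0_abs; lia.
  apply/mapP; exists (\row_i inord (absz (k 0 i + N%:Z))); first by rewrite mem_enum.
  apply/rowP => i; rewrite !mxE inordK// gez0_abs ?addrK//.
  by have := kN i; rewrite ler_norml; lia.
have := uniq_leq_size (fset_uniq (sites D eps)) sub.
rewrite size_map -cardE card_mx card_ord mul1n => sz.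
apply: (@le_trans _ _ (((N + N).+1 ^ d)%N%:R)); first by rewrite ler_nat.
have c0 : 0 <= Num.ceil (B / eps).
  by rewrite -(ler_int R) (le_trans _ (ceil_ge _))// divr_ge0// ltW.
have NE : N%:R = (Num.ceil (B / eps))%:~R :> R.
  by rewrite -[LHS]/(N%:Z%:~R) /N gez0_abs.
have BN : N%:R < B / eps + 1.
  by rewrite NE; have := ceilB1_lt (B / eps); rewrite intrB mulr1z; lra.
have key : (N + N).+1%:R <= (2 * B + 3) / eps.
  rewrite -[(N + N).+1%:R]natr1 natrD ler_pdivlMr//.
  have : B / eps * eps = B by rewrite divfK// gt_eqF.
  by nra.
by rewrite natrX lerXn2r ?nnegrE// (le_trans _ key).
Qed.

Lemma size_edges : exists2 C : R, 0 < C & forall eps : R, 0 < eps -> eps <= 1 ->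
  (size (edges D eps))%:R <= (C / eps) ^+ (2 * d).
Proof.
have [C C0 HC] := size_sites; exists C => // eps e0 e1.
have : (size (edges D eps) <= size (sites D eps) * size (sites D eps))%N.
  rewrite -(size_allpairs pair); apply: uniq_leq_size; first exact: fset_uniq.
  move=> [a b]; rewrite !inE /= => /andP[/andP[a1 b1] _].
  by apply/allpairsP; exists (a, b).
rewrite -(ler_nat R) natrM => /le_trans; apply.
rewrite mul2n -addnn exprD; apply: ler_pM => //; exact: HC.
Qed.

Hypothesis oD : open D.
Hypothesis tf : test_function D f.

Lemma test_function_dom x : f x != 0 -> D x.
Proof. by have [_ _ H] := tf => fx; apply: H; exact: subset_closure. Qed.

(** Consequently a shift proportional to [f] does not move the pinned angles. *)
Lemma vanish_boundary : exists2 delta : R, 0 < delta &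
  forall eps, 0 < eps -> eps < delta -> forall k l, nearest_neighbor k l ->
    l \notin sites D eps -> f (vertex eps k) = 0.
Proof.
have [delta delta0 H] := test_function_margin oD tf.
exists delta => // eps e0 ed k l kl; rewrite in_sites// => /asboolPn nD.
apply/eqP/negPn/negP => fk; apply: nD; apply: (H _ _ fk).
by rewrite neighbor_dist.
Qed.

Lemma edge_step (eps : R) e : e \in edges D eps ->
  exists i, e.2 = e.1 + delta_mx 0 i.
Proof. by rewrite !inE /= => /andP[_ /existsP[i /eqP ->]]; exists i. Qed.

Lemma edge_increment : exists2 L : R, 0 <= L & forall eps, 0 < eps ->
  forall e, e \in edges D eps -> `|f (vertex eps e.2) - f (vertex eps e.1)| <= eps * L.
Proof.
have [L L0 HL] := partial_bounded tf; exists L => // eps e0 e /edge_step[i ->].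
rewrite vertexD; have [y _ ->] := line_mvt tf i (vertex eps e.1) e0.
by rewrite normrM gtr0_norm// ler_wpM2l ?(ltW e0).
Qed.

End lattice_geometry.

(** * Convergence of the lattice energy *)

Section riemann_sum.
Context {R : realType} {d : nat}.
Variables (D : set 'rV[R]_d) (f : 'rV[R]_d -> R).
Hypothesis bD : bounded_set D.
Hypothesis oD : open D.
Hypothesis tf : test_function D f.
Local Notation space := (d.-tuple (measurableTypeR R)).
Local Notation mu := (@lebesgue_tuple R d).

Definition lattice_point (eps : R) (x : space) : 'rV[int]_d :=
  \row_i Num.floor (tnth x i / eps).

Definition cell (eps : R) (k : 'rV[int]_d) : set space :=
  [set x | forall i, `[eps * (k 0 i)%:~R, eps * (k 0 i + 1)%:~R[%classic (tnth x i)].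

Lemma cellP (eps : R) k x : 0 < eps -> cell eps k x <-> lattice_point eps x = k.
Proof.
move=> e0; have itv (m : int) (y : R) :
    (`[eps * m%:~R, eps * (m + 1)%:~R[%classic y) <-> Num.floor (y / eps) = m.
  rewrite /= in_itv /=; split => [/andP[y1 y2]|<-].
    by apply/floor_def; rewrite ler_pdivlMr// ltr_pdivrMr// ![_ * eps]mulrC y1.
  have /andP[] := floor_itv (y / eps).
  by rewrite ler_pdivlMr// ltr_pdivrMr// ![_ * eps]mulrC => -> ->.
split=> [kx|<- i].
  by apply/rowP => i; rewrite mxE; apply/itv; exact: kx.
by apply/itv; rewrite mxE.
Qed.

Lemma measurable_cell (eps : R) k : measurable (cell eps k).
Proof.
rewrite (_ : cell eps k = \bigcap_(i in [set: 'I_d])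
    ((fun x : space => tnth x i) @^-1` `[eps * (k 0 i)%:~R, eps * (k 0 i + 1)%:~R[)).
  apply: fin_bigcap_measurable => // i _.
  by rewrite -[X in measurable X]setTI; apply: measurable_tnth => //; exact: measurable_itv.
by apply/seteqP; split => x /= kx i => [_|]; exact: kx.
Qed.

Lemma cell_volume (eps : R) k : 0 < eps -> mu (cell eps k) = (eps ^+ d)%:E.
Proof.
move=> e0.
pose I (i : 'I_d) : set (measurableTypeR R) := `[eps * (k 0 i)%:~R, eps * (k 0 i + 1)%:~R[%classic.
have mI i : measurable (I i) by exact: measurable_itv.
transitivity (\prod_(i < d) (lebesgue_measure (I i) : \bar R))%E.
  exact: (tuple_product_box (fun=> lebesgue_measure) mI).
rewrite (eq_bigr (fun=> eps%:E)); last first.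
  move=> i _; rewrite lebesgue_measure_itv /= lte_fin intrD mulr1z ltr_pM2l//.
  by rewrite ltrDl ltr01 -EFinD; congr EFin; ring.
by rewrite prodEFin prodr_const card_ord.
Qed.

Definition box (B : R) : set space := [set x | forall i, `[- B, B]%classic (tnth x i)].

Lemma measurable_box B : measurable (box B).
Proof.
rewrite (_ : box B = \bigcap_(i in [set: 'I_d])
    ((fun x : space => tnth x i) @^-1` `[- B, B])).
  apply: fin_bigcap_measurable => // i _.
  by rewrite -[X in measurable X]setTI; apply: measurable_tnth => //; exact: measurable_itv.
by apply/seteqP; split => x /= kx i => [_|]; exact: kx.
Qed.

Lemma box_volume B : (mu (box B) < +oo)%E.
Proof.
pose I (i : 'I_d) : set (measurableTypeR R) := `[- B, B]%classic.
have mI i : measurable (I i) by exact: measurable_itv.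
have -> : mu (box B) = (\prod_(i < d) (lebesgue_measure (I i) : \bar R))%E.
  exact: (tuple_product_box (fun=> lebesgue_measure) mI).
have /choice[c cE] : forall i : 'I_d, exists c : R, (lebesgue_measure (I i) : \bar R) = c%:E.
  move=> i; rewrite lebesgue_measure_itv /=; case: ifP => _; last by exists 0.
  by exists (B - - B).
by rewrite (eq_bigr (fun i => (c i)%:E)) ?prodEFin ?ltry// => i _; rewrite -cE.
Qed.

Definition cell_energy (eps : R) (k : 'rV[int]_d) : R :=
  \sum_(i < d) ((f (vertex eps (k + delta_mx 0 i)) - f (vertex eps k)) / eps) ^+ 2.

(** With [F] vanishing on edges that leave the domain, the sum runs over all
    pairs of a site and a direction. *)
Lemma sum_edges (eps : R) (F : 'rV[int]_d * 'rV[int]_d -> R) :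
  (forall k l, nearest_neighbor k l -> l \notin sites D eps -> F (k, l) = 0) ->
  \sum_(e <- edges D eps) F e =
  \sum_(k <- sites D eps) \sum_(i < d) F (k, k + delta_mx 0 i).
Proof.
move=> F0.
have delta_inj : injective (fun i : 'I_d => delta_mx 0 i : 'rV[int]_d).
  move=> i j /rowP/(_ i); rewrite !mxE !eqxx /=.
  by case: eqP => // ->.
pose pairs := [seq (k, k + delta_mx 0 i) | k <- sites D eps, i <- index_enum 'I_d].
transitivity (\sum_(e <- pairs | e.2 \in sites D eps) F e).
  rewrite -[RHS]big_filter; apply: perm_big; apply: uniq_perm; first exact: fset_uniq.
    apply: filter_uniq; apply: allpairs_uniq; first exact: fset_uniq.
      exact: index_enum_uniq.
    by move=> [k i] [l j] _ _ /= [-> /addrI /delta_inj ->].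
  move=> [k l]; rewrite mem_filter !inE /=; apply/idP/idP.
    move=> /andP[/andP[kS lS] /existsP[i /eqP lE]]; rewrite lS /=.
    by apply/allpairsP; exists (k, i); rewrite /= kS mem_index_enum lE.
  move=> /andP[lS /allpairsP[[k' i] /= [kS _ [kE lE]]]].
  subst k; rewrite lS kS /=; apply/existsP; exists i; exact/eqP.
rewrite big_rmcond_in => [|e /allpairsP[[k i] /= [_ _ ->]] /= nS].
  by rewrite big_allpairs_dep.
by apply: F0 => //; apply/existsP; exists i; rewrite eqxx.
Qed.

Lemma cell_energy_out (eps delta : R) : 0 < eps -> eps < delta ->
  (forall eps, 0 < eps -> eps < delta -> forall k l, nearest_neighbor k l ->
    l \notin sites D eps -> f (vertex eps k) = 0) ->
  forall k, k \notin sites D eps -> cell_energy eps k = 0.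
Proof.
move=> e0 ed vb k kS; rewrite /cell_energy big1// => i _.
have fk : f (vertex eps k) = 0.
  apply/eqP/negPn/negP => /(test_function_dom tf) Dk.
  by move: kS; rewrite in_sites// => /asboolPn.
rewrite fk (vb _ e0 ed (k + delta_mx 0 i) k)// ?subrr ?mul0r ?expr0n//.
by apply/existsP; exists i; rewrite eqxx orbT.
Qed.

Lemma cell_energy_line (eps : R) k i : 0 < eps -> exists2 y, `|y - vertex eps k| <= eps &
  (f (vertex eps (k + delta_mx 0 i)) - f (vertex eps k)) / eps = partial i f y.
Proof.
move=> e0; rewrite vertexD; have [y yk ->] := line_mvt tf i (vertex eps k) e0.
by exists y => //; rewrite mulrAC divff ?mul1r// gt_eqF.
Qed.

Lemma vertex_lattice_point (eps : R) x : 0 < eps ->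
  `|vertex eps (lattice_point eps x) - row_of_tuple x| <= eps.
Proof.
move=> e0; rewrite [leLHS]mx_normrE; apply/bigmax_leP; split; first exact: ltW.
move=> -[a i] _ /=; rewrite !mxE.
have /andP[] := floor_itv (tnth x i / eps); set m := Num.floor _.
rewrite ler_pdivlMr// ltr_pdivrMr// intrD mulr1z mulrDl mul1r => m1 m2.
by rewrite distrC ger0_norm; [lra|lra].
Qed.

Lemma cell_energy_cvg (u : nat -> R) x : (forall n, 0 < u n) -> u @ \oo --> 0 ->
  cell_energy (u n) (lattice_point (u n) x) @[n --> \oo] -->
  \sum_(i < d) (partial i f (row_of_tuple x)) ^+ 2.
Proof.
move=> u0 ucvg.
have cvg1 i : (f (vertex (u n) (lattice_point (u n) x + delta_mx 0 i)) -
    f (vertex (u n) (lattice_point (u n) x))) / u n @[n --> \oo] -->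
    partial i f (row_of_tuple x).
  have /choice[y yP] : forall n, exists y,
      `|y - vertex (u n) (lattice_point (u n) x)| <= u n /\
      (f (vertex (u n) (lattice_point (u n) x + delta_mx 0 i)) -
       f (vertex (u n) (lattice_point (u n) x))) / u n = partial i f y.
    by move=> n; have [y] := cell_energy_line (lattice_point (u n) x) i (u0 n); exists y.
  rewrite (_ : (fun n => _) = (fun n => partial i f (y n))); last first.
    by apply/funext => n; have [_ ->] := yP n.
  have ycvg : y n @[n --> \oo] --> row_of_tuple x.
    apply/cvgrPdist_le => e e0.
    have e2 : 0 < e / 2 by rewrite divr_gt0.
    have /cvgrPdist_le/(_ _ e2) := ucvg; apply: filterS => n.
    rewrite sub0r normrN gtr0_norm// => une.
    have [yn _] := yP n; have vn := vertex_lattice_point x (u0 n).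
    rewrite distrC -(subrK (vertex (u n) (lattice_point (u n) x)) (y n)) -addrA.
    rewrite (le_trans (ler_normD _ _))// [leRHS]splitr.
    by apply: lerD; [exact: le_trans yn une|exact: le_trans vn une].
  exact: (continuous_cvg _ (@continuous_partial _ _ D f tf i (row_of_tuple x)) ycvg).
rewrite /cell_energy; apply: cvg_big => [|i _].
  exact: add_continuous.
exact: (cvgM (cvg1 i) (cvg1 i)).
Qed.

Lemma measurable_cell_indic (eps : R) k :
  measurable_fun setT (\1_(cell eps k) : space -> R).
Proof. by apply: measurable_indic; exact: measurable_cell. Qed.

Definition lattice_energy (eps : R) : R := \sum_(e <- edges D eps)
  (eps `^ (d%:R / 2 - 1) * (f (vertex eps e.2) - f (vertex eps e.1))) ^+ 2.

Lemma powR_half_dim (eps : R) : 0 < eps ->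
  (eps `^ (d%:R / 2 - 1)) ^+ 2 = eps ^+ d / eps ^+ 2.
Proof.
move=> e0; rewrite -powR_mulrn ?powR_ge0// -powRrM.
have -> : (d%:R / 2 - 1) * 2%:R = d%:R - 2%:R :> R by field.
have e1 : eps != 0 by rewrite gt_eqF.
rewrite (@powRB _ eps d%:R 2%:R); last by rewrite e1 implybT.
by rewrite !powR_mulrn// ltW.
Qed.

Section small_mesh.
Variable delta : R.
Hypothesis vb : forall eps, 0 < eps -> eps < delta -> forall k l,
  nearest_neighbor k l -> l \notin sites D eps -> f (vertex eps k) = 0.
Variable eps : R.
Hypotheses (e0 : 0 < eps) (ed : eps < delta).

Lemma lattice_energyE :
  lattice_energy eps = eps ^+ d * \sum_(k <- sites D eps) cell_energy eps k.
Proof.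
rewrite /lattice_energy sum_edges => [|k l kl lS] /=; last first.
  rewrite (vb e0 ed kl lS) subr0.
  have [fl|fl] := eqVneq (f (vertex eps l)) 0; first by rewrite fl mulr0 expr0n.
  by move: lS; rewrite in_sites// => /asboolPn; case; exact: test_function_dom fl.
rewrite mulr_sumr; apply: eq_bigr => k _; rewrite mulr_sumr; apply: eq_bigr => i _.
by rewrite exprMn powR_half_dim// expr_div_n mulrAC -mulrA.
Qed.

Lemma cell_energy_step x : cell_energy eps (lattice_point eps x) =
  \sum_(k <- sites D eps) cell_energy eps k * \1_(cell eps k) x.
Proof.
have indicE k : \1_(cell eps k) x = (lattice_point eps x == k)%:R :> R.
  rewrite indicE; congr (_%:R); congr nat_of_bool; apply/idP/eqP.
    by move=> /set_mem /cellP; apply.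
  by move=> kE; apply/mem_set/cellP.
have [kS|kS] := boolP (lattice_point eps x \in sites D eps).
  rewrite (big_fsetD1 _ kS) /= indicE eqxx mulr1 big_seq big1 ?addr0// => l.
  by rewrite !inE indicE eq_sym => /andP[/negbTE -> _]; rewrite mulr0.
rewrite (cell_energy_out e0 ed vb kS) big_seq big1// => l lS.
by rewrite indicE; case: eqP => [lE|]; rewrite ?mulr0//; rewrite lE lS in kS.
Qed.

Lemma cell_energy_ge0 k : 0 <= cell_energy eps k.
Proof. by apply: sumr_ge0 => i _; exact: sqr_ge0. Qed.

Lemma measurable_cell_energy :
  measurable_fun setT (fun x : space => cell_energy eps (lattice_point eps x)).
Proof.
rewrite (_ : (fun x => _) = (fun x =>
    \sum_(k <- sites D eps) cell_energy eps k * \1_(cell eps k) x)).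
  apply: measurable_sum => k; apply: measurable_funM => //.
  exact: measurable_cell_indic.
by apply/funext => x; exact: cell_energy_step.
Qed.

Lemma integral_cell_energy :
  (\int[mu]_x (cell_energy eps (lattice_point eps x))%:E)%E = (lattice_energy eps)%:E.
Proof.
rewrite lattice_energyE mulr_sumr -sumEFin.
transitivity (\int[mu]_x \sum_(k <- sites D eps)
    (cell_energy eps k * \1_(cell eps k) x)%:E)%E.
  by apply: eq_integral => x _; rewrite cell_energy_step sumEFin.
rewrite ge0_integral_sum//; last 2 first.
- move=> k; apply/measurable_EFinP; apply: measurable_funM => //.
  exact: measurable_cell_indic.
- by move=> k x _; rewrite lee_fin mulr_ge0 ?cell_energy_ge0.
apply: eq_bigr => k _; under eq_integral do rewrite EFinM.
rewrite ge0_integralZl//; last 2 first.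
- by apply/measurable_EFinP; exact: measurable_cell_indic.
- by rewrite lee_fin cell_energy_ge0.
rewrite integral_indic//; last exact: measurable_cell.
by rewrite setIT EFinM muleC; congr (_ * _)%E; exact: cell_volume.
Qed.

Lemma cell_energy_le (B L : R) : eps <= 1 -> (forall x, D x -> `|x| <= B) ->
  0 <= L -> (forall i x, `|partial i f x| <= L) -> forall x,
  cell_energy eps (lattice_point eps x) <= d%:R * L ^+ 2 * \1_(box (B + 1)) x.
Proof.
move=> e1 DB L0 fL x.
have [kS|kS] := boolP (lattice_point eps x \in sites D eps); last first.
  by rewrite (cell_energy_out e0 ed vb kS) mulr_ge0// mulr_ge0// sqr_ge0.
have -> : \1_(box (B + 1)) x = 1 :> R.
  rewrite indicE mem_set// => i; rewrite /= in_itv /= -ler_norml.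
  have -> : tnth x i = row_of_tuple x 0 i by rewrite mxE.
  apply: le_trans (coordinate_le _ _) _.
  rewrite -(subrK (vertex eps (lattice_point eps x)) (row_of_tuple x)) addrC.
  rewrite (le_trans (ler_normD _ _))// lerD//.
    by apply: DB; move: kS; rewrite in_sites// => /asboolP.
  by rewrite distrC (le_trans (vertex_lattice_point x e0)).
have -> : d%:R * L ^+ 2 = \sum_(i < d) L ^+ 2 by rewrite sumr_const card_ord mulr_natl.
rewrite mulr1 /cell_energy; apply: ler_sum => i _.
have [y _ ->] := cell_energy_line (lattice_point eps x) i e0.
by rewrite -real_normK ?num_real// lerXn2r ?nnegrE.
Qed.

End small_mesh.

(** The cells tile the space, so that the lattice energy is the integral of a
    step function. This function converges pointwise by the mean value theorem,
    and it is bounded and supported in a fixed box. *)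
Lemma lattice_energy_cvg : lattice_energy eps @[eps --> 0^'+] --> dirichlet_energy D f.
Proof.
have [B B0 DB] := bounded_setP bD.
have [L L0 fL] := partial_bounded tf.
have [delta delta0 vb] := vanish_boundary bD oD tf.
apply/cvg_at_rightP => u [u0 ucvg].
have usmall : \forall n \near \oo, u n < Num.min delta 1.
  by apply: (cvgr_lt _ ucvg); rewrite lt_min delta0 ltr01.
have [N _ uN] := usmall.
rewrite -(cvg_shiftn N).
pose w n := u (n + N)%N.
have w0 n : 0 < w n by exact: u0.
have wd n : w n < delta by have := uN _ (leq_addl n N); rewrite /= lt_min => /andP[].
have w1 n : w n <= 1.
  by have := uN _ (leq_addl n N); rewrite /= lt_min => /andP[_ /ltW].
have wcvg : w @ \oo --> 0 by rewrite -(cvg_shiftn N) in ucvg.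
pose F (x : space) : R := \sum_(i < d) (partial i f (row_of_tuple x)) ^+ 2.
have FF x := @cell_energy_cvg w x w0 wcvg.
have mF : measurable_fun setT F.
  apply: (@measurable_fun_cvg _ _ _ setT
    (fun n x => cell_energy (w n) (lattice_point (w n) x))) => [n|x _]; last exact: FF.
  exact: (measurable_cell_energy vb (w0 n) (wd n)).
have energyE : dirichlet_energy D f = fine (\int[mu]_x (F x)%:E)%E.
  rewrite /dirichlet_energy Rintegral_mkcond; congr fine.
  apply: eq_integral => x _ /=; congr EFin; rewrite patchE; case: ifPn => // xD.
  rewrite /F big1// => i _; rewrite (partial_out tf) ?expr0n// => sx.
  have [_ _ /(_ _ sx) Dx] := tf.
  by move: xD; rewrite notin_setE; apply.
have igb : mu.-integrable setT (EFin \o (fun x : space => d%:R * L ^+ 2 * \1_(box (B + 1)) x)).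
  apply/integrableP; split.
    apply/measurable_EFinP; apply: measurable_funM => //.
    by apply: measurable_indic; exact: measurable_box.
  under eq_integral => x _ do
    rewrite /= ger0_norm ?EFinM ?mulr_ge0// ?sqr_ge0//.
  rewrite ge0_integralZl//; last 2 first.
  - by apply/measurable_EFinP; apply: measurable_indic; exact: measurable_box.
  - by rewrite lee_fin mulr_ge0// sqr_ge0.
  rewrite integral_indic//; last exact: measurable_box.
  by rewrite setIT lte_mul_pinfty// ?box_volume// lee_fin mulr_ge0// sqr_ge0.
have [] := @dominated_convergence _ _ R mu setT measurableT
    (fun n x => (cell_energy (w n) (lattice_point (w n) x))%:E) (EFin \o F)
    (EFin \o (fun x : space => d%:R * L ^+ 2 * \1_(box (B + 1)) x)).
- by move=> n; apply/measurable_EFinP; exact: (measurable_cell_energy vb (w0 n) (wd n)).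
- exact/measurable_EFinP.
- by apply: aeW => x _; apply/fine_cvgP; split; [exact: nearW|exact: FF].
- exact: igb.
- apply: aeW => x n _; rewrite /= lee_fin ger0_norm ?cell_energy_ge0//.
  exact: (cell_energy_le vb (w0 n) (wd n) (w1 n) DB L0 fL).
move=> iF _ cvgI; rewrite energyE.
have Ifin : (\int[mu]_x (F x)%:E)%E \is a fin_num by exact: integrable_fin_num.
have /fine_cvgP[_] : (\int[mu]_x (cell_energy (w n) (lattice_point (w n) x))%:E)%E @[n --> \oo]
    --> (fine (\int[mu]_x (F x)%:E)%E)%:E by rewrite fineK.
apply: cvg_trans; apply: near_eq_cvg; apply: nearW => n /=.
by rewrite (integral_cell_energy vb (w0 n) (wd n)).
Qed.

End riemann_sum.

(** * Size of the error terms *)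

Section error_estimate.
Context {R : realType} {I : eqType}.
Implicit Types (beta tau A L S : R) (es : seq I) (s : I -> R).

Lemma sqrtr_ge1 (x : R) : 1 <= x -> 1 <= Num.sqrt x.
Proof. by move=> x1; rewrite -[leLHS]sqrtr1 ler_wsqrtr. Qed.

(** The exponential on the left is the bound that the number of edges will
    obey; the truncation at order about beta / 2 gains its square. *)
Lemma truncation_decay beta : 1 <= beta -> exists2 M : nat, (2 * M).+1%:R <= beta &
  Num.sqrt beta * expR (beta / 4) * truncation_error M * moment_bound beta <=
  16 * 12 ^+ 3 * pi * expR 32 / beta.
Proof.
move=> b1; have b0 : 0 < beta by rewrite (lt_le_trans ltr01).
have x0 : 0 <= (beta - 1) / 2 by lra.
exists (Num.truncn ((beta - 1) / 2)).
  rewrite -[(2 * _).+1%:R]natr1 natrM; have /andP[] := truncn_itv x0; lra.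
have /andP[] := truncn_itv x0.
move: (Num.truncn _) => M; rewrite -[M.+1%:R]natr1 => M1 M2.
have q1 : 1 <= Num.sqrt beta by exact: sqrtr_ge1.
have qq : Num.sqrt beta ^+ 2 = beta by rewrite sqr_sqrtr// ltW.
rewrite /moment_bound /truncation_error -[M.+1%:R]natr1.
(* The cube of u is at least (beta / 12) ^+ 3, which absorbs the powers of beta. *)
pose u := expR (beta / 12).
have u0 : 0 < u by exact: expR_gt0.
have ub : beta / 12 <= u by have := expR_ge1Dx (beta / 12); rewrite -/u; lra.
have E4 : expR (beta / 4) = u ^+ 3.
  by rewrite /u -expRM_natl; congr expR; field.
have EM : expR (- (M%:R + 1)) <= 2 / u ^+ 6.
  have -> : u ^+ 6 = expR (beta / 2) by rewrite /u -expRM_natl; congr expR; field.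
  have h2 : expR (2^-1) <= 2 :> R.
    have := expR_ge1Dx (- 2^-1 : R); rewrite expRN => h.
    rewrite -[expR _]invrK -[leRHS]invrK lef_pV2 ?posrE ?invr_gt0 ?expR_gt0//; lra.
  rewrite -expRN; apply: (@le_trans _ _ (expR (2^-1) * expR (- (beta / 2)))).
    by rewrite -expRD ler_expR; lra.
  by rewrite ler_wpM2r ?expR_ge0.
rewrite E4; move: (Num.sqrt beta) (expR 32) (@pi_gt0 R) (expR_gt0 (32 : R)) q1 qq.
move=> q E; move: (@pi R) => p p0 E0 q1 qq.
have q0 : 0 <= q by lra.
have MB : M%:R + 1 <= beta by lra.
have M0 : 0 <= (M%:R + 1 : R) by rewrite addr_ge0.
have u3 : (beta / 12) ^+ 3 <= u ^+ 3 by rewrite lerXn2r ?nnegrE ?divr_ge0// ltW.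
apply: (@le_trans _ _ (q * u ^+ 3 * (2 * p * beta * (2 / u ^+ 6)) * (2 * E * (q + q)))).
  apply: ler_pM.
  - by rewrite !mulr_ge0 ?expR_ge0 ?exprn_ge0// ltW.
  - by rewrite !mulr_ge0 ?addr_ge0// ltW.
  - rewrite ler_wpM2l ?mulr_ge0 ?exprn_ge0 ?(ltW u0)//.
    by apply: ler_pM; rewrite ?mulr_ge0 ?expR_ge0 ?(ltW p0)// ler_wpM2l ?mulr_ge0 ?(ltW p0).
  - by rewrite ler_wpM2l ?mulr_ge0 ?(ltW E0)// lerD2l.
have -> : q * u ^+ 3 * (2 * p * beta * (2 / u ^+ 6)) * (2 * E * (q + q)) =
    16 * p * E * beta * q ^+ 2 / u ^+ 3 by field; rewrite gt_eqF.
rewrite qq ler_pdivrMr ?exprn_gt0//.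
apply: (@le_trans _ _ (16 * 12 ^+ 3 * p * E / beta * (beta / 12) ^+ 3)); last first.
  by rewrite ler_wpM2l// divr_ge0 ?mulr_ge0 ?ltW.
by rewrite le_eqVlt; apply/orP; left; apply/eqP; field; rewrite gt_eqF.
Qed.

Lemma cubic_error_le beta es s tau L S : 1 <= beta -> 0 <= L ->
  (forall e, e \in es -> `|s e| <= Num.sqrt beta * L) ->
  \sum_(e <- es) s e ^+ 2 <= beta * S ->
  \sum_(e <- es) beta * `|tau * s e / beta| ^+ 3 <=
  `|tau| ^+ 3 * L * S / Num.sqrt (Num.sqrt beta).
Proof.
move=> b1 L0 sL sS; have b0 : 0 < beta by rewrite (lt_le_trans ltr01).
pose r := Num.sqrt (Num.sqrt beta).
have q1 : 1 <= Num.sqrt beta by exact: sqrtr_ge1.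
have r1 : 1 <= r by exact: sqrtr_ge1.
have r0 : 0 < r by rewrite (lt_le_trans ltr01).
have rq : Num.sqrt beta = r ^+ 2 by rewrite sqr_sqrtr// (le_trans ler01).
have rb : beta = r ^+ 4 by rewrite (exprM r 2 2) -rq sqr_sqrtr// ltW.
have S0 : 0 <= S.
  rewrite -(pmulr_rge0 _ b0); apply: le_trans sS; apply: sumr_ge0 => e _; exact: sqr_ge0.
have r_r2 : r^-1 ^+ 2 <= r^-1.
  by rewrite expr2 ler_piMl ?invr_ge0 ?(ltW r0)// invf_le1.
rewrite -/r.
apply: (@le_trans _ _ (\sum_(e <- es) `|tau| ^+ 3 * (Num.sqrt beta * L) / beta ^+ 2 * s e ^+ 2)).
  rewrite big_seq [leRHS]big_seq; apply: ler_sum => e ees.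
  rewrite normrM normrM normfV (gtr0_norm b0) -[s e ^+ 2]real_normK ?num_real//.
  have -> : beta * (`|tau| * `|s e| / beta) ^+ 3 =
      `|tau| ^+ 3 / beta ^+ 2 * `|s e| ^+ 2 * `|s e| by field; rewrite gt_eqF.
  have -> : `|tau| ^+ 3 * (Num.sqrt beta * L) / beta ^+ 2 * `|s e| ^+ 2 =
      `|tau| ^+ 3 / beta ^+ 2 * `|s e| ^+ 2 * (Num.sqrt beta * L) by ring.
  by rewrite ler_wpM2l ?sL// mulr_ge0 ?divr_ge0 ?exprn_ge0// ltW.
rewrite -mulr_sumr.
apply: (@le_trans _ _ (`|tau| ^+ 3 * (Num.sqrt beta * L) / beta ^+ 2 * (beta * S))).
  by rewrite ler_wpM2l// divr_ge0 ?mulr_ge0 ?exprn_ge0 ?(ltW b0)// (le_trans ler01).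
have -> : `|tau| ^+ 3 * (Num.sqrt beta * L) / beta ^+ 2 * (beta * S) =
    `|tau| ^+ 3 * L * S * (r^-1 ^+ 2).
  by rewrite rq rb; field; rewrite gt_eqF.
by rewrite ler_wpM2l// !mulr_ge0.
Qed.

Definition error_constant tau A L S : R :=
  `|tau| * (A * (16 * 12 ^+ 3 * pi * expR 32) + 1 + 24 * expR 32 * S) +
  2 * (`|tau| ^+ 3 * L * S) + 8 * expR 32 * tau ^+ 2 * S.

Lemma clt_error_le beta es s tau A L S : 1 <= beta -> 0 <= A -> 0 <= L ->
  (forall e, e \in es -> `|s e| <= Num.sqrt beta * L) ->
  \sum_(e <- es) `|s e| <= A * (Num.sqrt beta * expR (beta / 4)) ->
  \sum_(e <- es) s e ^+ 2 <= beta * S ->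
  exists M kappa, [/\ (2 * M).+1%:R <= beta, 0 < kappa &
    clt_error beta es s tau M kappa <=
    error_constant tau A L S / Num.sqrt (Num.sqrt beta)].
Proof.
move=> b1 A0 L0 sL sA sS; have b0 : 0 < beta by rewrite (lt_le_trans ltr01).
have [M Mb HM] := truncation_decay b1.
pose r := Num.sqrt (Num.sqrt beta).
have q1 : 1 <= Num.sqrt beta by exact: sqrtr_ge1.
have r1 : 1 <= r by exact: sqrtr_ge1.
have r0 : 0 < r by rewrite (lt_le_trans ltr01).
have rq : Num.sqrt beta = r ^+ 2 by rewrite sqr_sqrtr// (le_trans ler01).
have rb : beta = r ^+ 4 by rewrite (exprM r 2 2) -rq sqr_sqrtr// ltW.
(* With kappa = beta ^ (- 1/4), kappa and sqrt beta / (beta * kappa) both vanish. *)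
exists M, r^-1; split => //; first by rewrite invr_gt0.
have G0 : 0 <= moment_bound beta.
  by rewrite /moment_bound !mulr_ge0 ?expR_ge0// addr_ge0// (le_trans ler01).
have Gr : moment_bound beta <= 4 * expR 32 * r ^+ 2.
  rewrite /moment_bound rq; have := expR_gt0 (32 : R); move: (expR 32) => E E0.
  have r2 : 1 <= r ^+ 2 by rewrite exprn_ege1.
  by nra.
have T0 := truncation_error_ge0 (R := R) M.
have S0 : 0 <= S.
  rewrite -(pmulr_rge0 _ b0); apply: le_trans sS; apply: sumr_ge0 => e _; exact: sqr_ge0.
have term1 : (\sum_(e <- es) `|s e|) * truncation_error M * moment_bound beta <=
    A * (16 * 12 ^+ 3 * pi * expR 32) / r.
  apply: (@le_trans _ _ (A * (16 * 12 ^+ 3 * pi * expR 32 / beta))); last first.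
    rewrite -[leRHS]mulrA ler_wpM2l// ler_wpM2l ?mulr_ge0 ?pi_ge0 ?expR_ge0//.
    by rewrite lef_pV2 ?posrE// rb exprS ler_peMr ?exprn_ege1// ltW.
  apply: le_trans (ler_wpM2l A0 HM).
  move: (truncation_error M) (moment_bound beta) (expR (beta / 4)) T0 G0 sA => T G v T0 G0 sA.
  have -> : A * (Num.sqrt beta * v * T * G) = A * (Num.sqrt beta * v) * T * G by ring.
  by rewrite ler_wpM2r// ler_wpM2r.
have Q0 : 0 <= \sum_(e <- es) s e ^+ 2 by apply: sumr_ge0 => e _; exact: sqr_ge0.
have term2 : 6 / beta ^+ 2 * (\sum_(e <- es) s e ^+ 2) * moment_bound beta / r^-1 <=
    24 * expR 32 * S / r.
  apply: (@le_trans _ _ (6 / beta ^+ 2 * (beta * S) * (4 * expR 32 * r ^+ 2) / r^-1)).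
    rewrite invrK ler_wpM2r ?(ltW r0)//; apply: ler_pM => //.
      by rewrite mulr_ge0// divr_ge0// sqr_ge0.
    by rewrite ler_wpM2l ?divr_ge0 ?sqr_ge0.
  by rewrite le_eqVlt rb; apply/orP; left; apply/eqP; field; rewrite gt_eqF.
have r_r2 : r^-1 ^+ 2 <= r^-1.
  by rewrite expr2 ler_piMl ?invr_ge0 ?(ltW r0)// invf_le1.
have term3 := cubic_error_le tau b1 L0 sL sS; rewrite -/r in term3.
have term4 : 2 * (tau ^+ 2 * (\sum_(e <- es) s e ^+ 2) / beta) / beta * moment_bound beta <=
    8 * expR 32 * tau ^+ 2 * S / r.
  apply: (@le_trans _ _ (2 * (tau ^+ 2 * (beta * S) / beta) / beta * (4 * expR 32 * r ^+ 2))).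
    apply: ler_pM => //.
      by rewrite divr_ge0 ?(ltW b0)// mulr_ge0// divr_ge0 ?(ltW b0)// mulr_ge0 ?sqr_ge0.
    have bV : 0 <= beta^-1 by rewrite invr_ge0 ltW.
    by rewrite ler_wpM2r// ler_wpM2l// ler_wpM2r// ler_wpM2l ?sqr_ge0.
  have -> : 2 * (tau ^+ 2 * (beta * S) / beta) / beta * (4 * expR 32 * r ^+ 2) =
      8 * expR 32 * tau ^+ 2 * S * (r^-1 ^+ 2).
    by rewrite rb; field; rewrite gt_eqF.
  by rewrite ler_wpM2l// mulr_ge0// mulr_ge0 ?sqr_ge0// mulr_ge0 ?expR_ge0.
rewrite /clt_error /error_constant -/r.
have -> : (`|tau| * (A * (16 * 12 ^+ 3 * pi * expR 32) + 1 + 24 * expR 32 * S) +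
  2 * (`|tau| ^+ 3 * L * S) + 8 * expR 32 * tau ^+ 2 * S) / r =
  `|tau| * (A * (16 * 12 ^+ 3 * pi * expR 32) / r + r^-1 + 24 * expR 32 * S / r) +
  2 * (`|tau| ^+ 3 * L * S / r) + 8 * expR 32 * tau ^+ 2 * S / r by move: (@pi R) => p; ring.
apply: lerD => //; apply: lerD; last by rewrite ler_wpM2l.
by rewrite ler_wpM2l// lerD// lerD.
Qed.

End error_estimate.

(** * The Gaussian limit *)

Section gaussian_limit.
Context {R : realType} {d : nat}.
Variables (D : set 'rV[R]_d) (f : 'rV[R]_d -> R) (beta : R -> R) (t : R).
Hypothesis bD : bounded_set D.
Hypothesis oD : open D.
Hypothesis tf : test_function D f.
Hypothesis beta_infty : beta eps + 9 * d%:R * ln eps @[eps --> 0^'+] --> +oo.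

Definition edge_weight (eps : R) (e : 'rV[int]_d * 'rV[int]_d) : R :=
  eps `^ (d%:R / 2 - 1) * Num.sqrt (beta eps) * (f (vertex eps e.2) - f (vertex eps e.1)).

Local Notation W eps := (xy_integral (@lattice_measure R d D eps) (edge_char D eps)
  (beta eps) (edges D eps)).
Local Notation Z eps := (xy_mass (@lattice_measure R d D eps) (edge_char D eps)
  (beta eps) (edges D eps)).
Local Notation total eps := (angle_sum (edge_char D eps) (edges D eps) (edge_weight eps)).
Local Notation r eps := (Num.sqrt (Num.sqrt (beta eps))).

Lemma near_mesh_lt (c : R) : 0 < c -> \forall eps \near 0^'+, 0 < eps /\ eps < c.
Proof.
move=> c0; near=> eps; split; near: eps; first exact: nbhs_right_gt.
exact: nbhs_right_lt.
Unshelve. all: by end_near. Qed.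

Lemma beta_ge (c : R) : \forall eps \near 0^'+, c <= beta eps.
Proof.
near=> eps; have [e0 e1] : 0 < eps /\ eps < 1 by near: eps; exact: near_mesh_lt.
have h : c <= beta eps + 9 * d%:R * ln eps.
  by near: eps; move/cvgryPge : beta_infty; apply.
apply: le_trans h _; rewrite gerDl mulr_ge0_le0 ?mulr_ge0//.
by rewrite ln_le0// ltW.
Unshelve. all: by end_near. Qed.

(** The growth of [beta] enters here: the number of edges is a power of the
    inverse mesh, and stays below the gain of the truncation. *)
Lemma inverse_mesh_le : \forall eps \near 0^'+, (eps^-1) ^+ (2 * d) <= expR (beta eps / 4).
Proof.
near=> eps; have [e0 e1] : 0 < eps /\ eps < 1 by near: eps; exact: near_mesh_lt.
have h : 0 <= beta eps + 9 * d%:R * ln eps.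
  by near: eps; move/cvgryPge : beta_infty; apply.
rewrite -{1}(@lnK _ eps)// -expRN -expRM_natl ler_expR natrM.
have ln0 : d%:R * - ln eps >= 0 by rewrite mulr_ge0// oppr_ge0 ln_le0// ltW.
by lra.
Unshelve. all: by end_near. Qed.

Lemma le_sqrt_sqrt (x b : R) : 0 <= x -> x ^+ 4 <= b -> x <= Num.sqrt (Num.sqrt b).
Proof.
move=> x0 xb; have sqrtK (y : R) : 0 <= y -> Num.sqrt (y ^+ 2) = y.
  by move=> y0; rewrite sqrtr_sqr ger0_norm.
rewrite -[leLHS]sqrtK// ler_wsqrtr// -[leLHS]sqrtK ?sqr_ge0// ler_wsqrtr//.
by rewrite -exprM.
Qed.

Lemma cvg_of_decay (F : R -> R) (K : R) :
  (\forall eps \near 0^'+, `|F eps| <= K / r eps) -> F eps @[eps --> 0^'+] --> (0 : R).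
Proof.
move=> FK; apply/cvgr0Pnorm_le => e e0; near=> eps.
have Fle : `|F eps| <= K / r eps by near: eps.
have b0 : (`|K| / e) ^+ 4 <= beta eps by near: eps; exact: beta_ge.
have b1 : 1 <= beta eps by near: eps; exact: beta_ge.
apply: le_trans Fle _; rewrite ler_pdivrMr; last first.
  by rewrite !sqrtr_gt0 (lt_le_trans ltr01).
apply: le_trans (ler_norm K) _; rewrite mulrC -ler_pdivrMr//.
by apply: le_sqrt_sqrt => //; rewrite divr_ge0// ltW.
Unshelve. all: by end_near. Qed.

Lemma edge_weight_square eps : 0 <= beta eps ->
  \sum_(e <- edges D eps) edge_weight eps e ^+ 2 = beta eps * lattice_energy D f eps.
Proof.
move=> b0; rewrite /lattice_energy mulr_sumr; apply: eq_bigr => e _.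
by rewrite /edge_weight mulrAC exprMn sqr_sqrtr// mulrC.
Qed.

Lemma edge_weight_le : exists2 L : R, 0 <= L & forall eps, 0 < eps -> eps <= 1 ->
  forall e, e \in edges D eps -> `|edge_weight eps e| <= Num.sqrt (beta eps) * L.
Proof.
have [L L0 HL] := edge_increment tf; exists L => // eps e0 e1 e eE.
rewrite /edge_weight !normrM (ger0_norm (powR_ge0 _ _)) (ger0_norm (sqrtr_ge0 _)).
rewrite mulrAC mulrC ler_wpM2l ?sqrtr_ge0//.
apply: le_trans (ler_wpM2l (powR_ge0 _ _) (HL _ e0 _ eE)) _.
have -> : eps `^ (d%:R / 2 - 1) * (eps * L) = eps `^ (d%:R / 2) * L.
  rewrite mulrA powRB; last by rewrite (gt_eqF e0) implybT.
  by rewrite powRr1 ?(ltW e0)// divfK// gt_eqF.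
rewrite ler_piMl// -[leRHS](powRr0 eps).
by apply: ger_powR; rewrite ?e0// divr_ge0.
Qed.

Lemma edge_weight_sum : exists2 A : R, 0 <= A & \forall eps \near 0^'+,
  \sum_(e <- edges D eps) `|edge_weight eps e| <=
  A * (Num.sqrt (beta eps) * expR (beta eps / 4)).
Proof.
have [L L0 HL] := edge_weight_le; have [C C0 HC] := size_edges bD.
exists (C ^+ (2 * d) * L); first by rewrite mulr_ge0// exprn_ge0// ltW.
near=> eps; have [e0 e1] : 0 < eps /\ eps < 1 by near: eps; exact: near_mesh_lt.
have me : (eps^-1) ^+ (2 * d) <= expR (beta eps / 4) by near: eps; exact: inverse_mesh_le.
apply: (@le_trans _ _ (\sum_(e <- edges D eps) Num.sqrt (beta eps) * L)).
  by rewrite big_seq [leRHS]big_seq; apply: ler_sum => e eE; exact: HL (ltW e1) _ eE.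
rewrite big_const_seq count_predT iter_addr addr0 -[leLHS]mulr_natl.
apply: le_trans (ler_wpM2r _ (HC _ e0 (ltW e1))) _; first by rewrite mulr_ge0 ?sqrtr_ge0.
rewrite exprMn; move: me; move: (expR _) (eps^-1 ^+ _) (Num.sqrt _) (sqrtr_ge0 (beta eps)).
move=> u v q q0 vu; have -> : C ^+ (2 * d) * L * (q * u) = C ^+ (2 * d) * u * (q * L) by ring.
by rewrite ler_wpM2r ?mulr_ge0// ler_wpM2l// exprn_ge0// ltW.
Unshelve. all: by end_near. Qed.

Definition twist_exponent eps : R := \sum_(e <- edges D eps)
  beta eps * (coshr (t * edge_weight eps e / beta eps) - 1).

Lemma weights_small : \forall eps \near 0^'+, forall e, e \in edges D eps ->
  `|t * edge_weight eps e / beta eps| <= 2^-1.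
Proof.
have [L L0 HL] := edge_weight_le.
near=> eps => e eE; have [e0 e1] : 0 < eps /\ eps < 1 by near: eps; exact: near_mesh_lt.
have b1 : 1 <= beta eps by near: eps; exact: beta_ge.
have b0 : 0 < beta eps by rewrite (lt_le_trans ltr01).
have bL : (2 * (`|t| * L)) ^+ 2 <= beta eps by near: eps; exact: beta_ge.
rewrite normrM normfV (gtr0_norm b0) normrM ler_pdivrMr//.
apply: le_trans (ler_wpM2l (normr_ge0 _) (HL _ e0 (ltW e1) _ eE)) _.
have qq : Num.sqrt (beta eps) ^+ 2 = beta eps by rewrite sqr_sqrtr// ltW.
have h : 2 * (`|t| * L) <= Num.sqrt (beta eps).
  by rewrite -[leLHS]ger0_norm ?mulr_ge0// -sqrtr_sqr ler_wsqrtr.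
by rewrite -[in leRHS]qq; have := ler_wpM2l (sqrtr_ge0 (beta eps)) h; lra.
Unshelve. all: by end_near. Qed.

Lemma energy_le : \forall eps \near 0^'+, 1 <= beta eps /\
  \sum_(e <- edges D eps) edge_weight eps e ^+ 2 <= beta eps * (dirichlet_energy D f + 1).
Proof.
have lec := lattice_energy_cvg bD oD tf.
near=> eps; have b1 : 1 <= beta eps by near: eps; exact: beta_ge.
have b0 : 0 <= beta eps by rewrite (le_trans ler01).
split => //; rewrite edge_weight_square// ler_wpM2l//; near: eps.
by apply: (cvgr_le _ lec); rewrite ltrDl.
Unshelve. all: by end_near. Qed.

(** To second order the exponent is half of [t ^+ 2] times the lattice energy. *)
Lemma twist_exponent_cvg :
  twist_exponent eps @[eps --> 0^'+] --> t ^+ 2 / 2 * dirichlet_energy D f.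
Proof.
have [L L0 HL] := edge_weight_le.
have lec := lattice_energy_cvg bD oD tf.
have diff : twist_exponent eps - t ^+ 2 / 2 * lattice_energy D f eps @[eps --> 0^'+] --> (0 : R).
  apply: (@cvg_of_decay _ (`|t| ^+ 3 * L * (dirichlet_energy D f + 1))).
  near=> eps; have [e0 e1] : 0 < eps /\ eps < 1 by near: eps; exact: near_mesh_lt.
  have [b1 sS] : 1 <= beta eps /\
      \sum_(e <- edges D eps) edge_weight eps e ^+ 2 <= beta eps * (dirichlet_energy D f + 1).
    by near: eps; exact: energy_le.
  have b0 : 0 < beta eps by rewrite (lt_le_trans ltr01).
  have sm : forall e, e \in edges D eps -> `|t * edge_weight eps e / beta eps| <= 2^-1.
    by near: eps; exact: weights_small.
  apply: le_trans (cubic_error_le t b1 L0 (fun e => HL _ e0 (ltW e1) e) sS).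
  have := gaussian_exponent b0 sm; rewrite edge_weight_square ?(ltW b0)//.
  have -> : t ^+ 2 * (beta eps * lattice_energy D f eps) / beta eps / 2 =
    t ^+ 2 / 2 * lattice_energy D f eps by field; rewrite gt_eqF.
  by [].
rewrite (_ : twist_exponent = fun eps => (twist_exponent eps -
    t ^+ 2 / 2 * lattice_energy D f eps) + t ^+ 2 / 2 * lattice_energy D f eps); last first.
  by apply/funext => eps; rewrite subrK.
rewrite -[X in _ --> X]add0r; apply: cvgD => //.
by apply: cvgM => //; exact: cvg_cst.
Unshelve. all: by end_near. Qed.

(** The shift is proportional to [f], which vanishes on the pinned sites. *)
Lemma characteristic_error : exists K : R, \forall eps \near 0^'+,
  `|W eps (fun th => cos (t * total eps th)) / Z eps - expR (- twist_exponent eps)| <= K / r eps /\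
  `|W eps (fun th => sin (t * total eps th)) / Z eps| <= K / r eps.
Proof.
have [L L0 HL] := edge_weight_le; have [A A0 HA] := edge_weight_sum.
have [delta delta0 vb] := vanish_boundary bD oD tf.
exists (error_constant t A L (dirichlet_energy D f + 1)).
near=> eps; have [e0 e1] : 0 < eps /\ eps < 1 by near: eps; exact: near_mesh_lt.
have [_ ed] : 0 < eps /\ eps < delta by near: eps; exact: near_mesh_lt.
have [b1 sS] : 1 <= beta eps /\
    \sum_(e <- edges D eps) edge_weight eps e ^+ 2 <= beta eps * (dirichlet_energy D f + 1).
  by near: eps; exact: energy_le.
have b0 : 0 < beta eps by rewrite (lt_le_trans ltr01).
have sm : forall e, e \in edges D eps -> `|t * edge_weight eps e / beta eps| <= 2^-1.
  by near: eps; exact: weights_small.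
have sA : \sum_(e <- edges D eps) `|edge_weight eps e| <=
  A * (Num.sqrt (beta eps) * expR (beta eps / 4)) by near: eps.
have [M [kappa [Mb k0 err]]] :=
  clt_error_le t b1 A0 L0 (fun e => HL _ e0 (ltW e1) e) sA sS.
pose psi (k : 'rV[int]_d) := eps `^ (d%:R / 2 - 1) * Num.sqrt (beta eps) * f (vertex eps k).
have psic (i : 'I_(size (sites D eps))) (k : int) : psi (site i) != 0 -> k != 0 ->
    site_coef i k = 0.
  move=> psi0 /negbTE k0'; rewrite /site_coef k0'; case: ifPn => // ib.
  exfalso; move: psi0 => /negP; apply; apply/eqP.
  move: ib; rewrite !inE /= => /andP[_ /asboolP[l kl lS]].
  by rewrite /psi (vb _ e0 ed _ _ kl lS) mulr0.
have spsi e : e \in edges D eps ->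
    gradient (fun i => psi (site i)) (edge_char D eps e) = edge_weight eps e.
  by move=> eE; rewrite (gradient_edge psi eE) /psi /edge_weight mulrBr.
have Z0 := xy_mass_gt0 D eps (beta eps).
have [c s] := characteristic_bound (@lattice_moments _ _ D eps) b0 psic spsi sm Mb k0.
split; apply: le_trans err; rewrite -(ler_pM2r Z0).
  rewrite -[X in _ * X](gtr0_norm Z0) -normrM mulrBl divfK ?gt_eqF//.
by rewrite -[X in _ * X](gtr0_norm Z0) -normrM divfK ?gt_eqF.
Unshelve. all: by end_near. Qed.

Lemma cos_cvg : W eps (fun th => cos (t * total eps th)) / Z eps @[eps --> 0^'+] -->
  expR (- (t ^+ 2 / 2) * dirichlet_energy D f).
Proof.
have [K HK] := characteristic_error.
have diff : W eps (fun th => cos (t * total eps th)) / Z eps - expR (- twist_exponent eps)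
    @[eps --> 0^'+] --> (0 : R).
  by apply: (@cvg_of_decay _ K); apply: filterS HK => eps [].
have ex : expR (- twist_exponent eps) @[eps --> 0^'+] -->
    expR (- (t ^+ 2 / 2) * dirichlet_energy D f).
  have h : - twist_exponent eps @[eps --> 0^'+] --> - (t ^+ 2 / 2) * dirichlet_energy D f.
    by rewrite mulNr; exact: cvgN twist_exponent_cvg.
  exact: continuous_cvg _ (@continuous_expR R _) h.
rewrite -[X in _ --> X]add0r.
rewrite (_ : (fun eps => _) = (fun eps => (W eps (fun th => cos (t * total eps th)) / Z eps -
    expR (- twist_exponent eps)) + expR (- twist_exponent eps))).
  exact: cvgD diff ex.
by apply/funext => eps; rewrite subrK.
Qed.

Lemma sin_cvg : W eps (fun th => sin (t * total eps th)) / Z eps @[eps --> 0^'+] --> (0 : R).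
Proof.
have [K HK] := characteristic_error.
by apply: (@cvg_of_decay _ K); apply: filterS HK => eps [].
Qed.

End gaussian_limit.

(** * Convergence of the complex expectations *)

Section complex_limit.
Context {R : realType}.
Local Open Scope complex_scope.

Lemma cvg_complex (F : set_system R) (FF : ProperFilter F) (u v : R -> R) (a b : R) :
  u x @[x --> F] --> a -> v x @[x --> F] --> b ->
  ((u x +i* v x) : R[i]) @[x --> F] --> (a +i* b : R[i]).
Proof.
move=> ua vb; apply/cvgrPdist_le => -[e e']; rewrite ltcE /= => /andP[/eqP -> e0].
have e2 : 0 < e / 2 by rewrite divr_gt0.
move/cvgrPdist_le : ua => /(_ _ e2); move/cvgrPdist_le : vb => /(_ _ e2).
apply: filterS2 => x vx ux.
rewrite -[X in `|X|]/((a - u x) +i* (b - v x)) lecE /= eqxx /=.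
apply: (@le_trans _ _ (`|a - u x| + `|b - v x|)).
  exact: (normc_le ((a - u x) +i* (b - v x))%C).
by rewrite [leRHS]splitr lerD.
Qed.

End complex_limit.

Theorem theorem2 (R : realType) (d : nat) (D : set 'rV[R]_d) (beta : R -> R)
    (disp : measure_display) (Omega : R -> measurableType disp)
    (P : forall eps : R, probability (Omega eps) R)
    (theta : forall eps : R, {RV (P eps) >-> config D eps}) :
  (2 <= d)%N ->
  bounded_domain D ->
  smooth_boundary D ->
  discretely_simply_connected D ->
  (forall eps : R, 0 < eps -> 0 < beta eps) ->
  beta eps + 9 * d%:R * ln eps @[eps --> 0^'+] --> +oo ->
  (forall eps : R, 0 < eps -> forall A, measurable A ->
     distribution (P eps) (theta eps) A = gibbs D (beta eps) eps A) ->
  forall f : 'rV[R]_d -> R, test_function D f ->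
  forall t : R,
  complex_expectation (P eps)
    (fun w => expi (t * pairing D (beta eps) eps f (theta eps w))) @[eps --> 0^'+]
  --> ((expR (- (t ^+ 2 / 2) * dirichlet_energy D f))%:C)%C.
Proof.
move=> _ [_ oD _ bD] _ _ _ beta_infty thetaE f tf t.
have limit := cvg_complex (at_right_proper_filter 0)
  (@cos_cvg _ _ D f beta t bD oD tf beta_infty)
  (@sin_cvg _ _ D f beta t bD oD tf beta_infty).
apply: (cvg_trans _ limit); apply: near_eq_cvg; near=> eps.
have e0 : 0 < eps by near: eps; exact: nbhs_right_gt.
pose X := angle_sum (edge_char D eps) (edges D eps) (edge_weight f beta eps).
have mtX : measurable_fun setT (fun th : config D eps => t * X th).
  by apply: measurable_funM => //; have [] := bm_angle_sum (edge_char D eps) (edges D eps)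
    (edge_weight f beta eps).
rewrite /complex_expectation /expi /=.
rewrite -(expectation_gibbs (thetaE _ e0) (bm_cos mtX)).
rewrite -(expectation_gibbs (thetaE _ e0) (bm_sin mtX)).
have cE : (fun w => cos (t * X (theta eps w))) =
  (fun w => cos (t * pairing D (beta eps) eps f (theta eps w))).
  by apply/funext => w; rewrite pairingE.
have sE : (fun w => sin (t * X (theta eps w))) =
  (fun w => sin (t * pairing D (beta eps) eps f (theta eps w))).
  by apply/funext => w; rewrite pairingE.
by rewrite cE sE.
Unshelve. all: by end_near. Qed.
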